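(* Let $(\omega_t,J_t)$ be a solution of symplectic curvature flow on $M^{2n}$, with associated metrics $g_t$. Then the Chern scalar curvature $\varrho$ evolves by $$\left(\tfrac{\partial}{\partial t}-\Delta\right)\varrho=4|\mathrm{Rc}-B|^2+2\Delta|\tau|^2+4g^{ip}g^{jq}\left(\nabla_j\nabla_iB_{pq}\right)+16\,g^{ap}g^{re}g^{bq}g^{sc}\left(\nabla_a\nabla_r\tau_{ebc}\right)\tau_{pqs}.$$
   Context: Conventions. An almost Kähler manifold $(M^{2n},g,J,\omega)$ is a smooth manifold with Riemannian metric $g$, almost complex structure $J$ (with $J\partial_i=J_i^k\partial_k$), $g(JX,JY)=g(X,Y)$, and $\omega(X,Y):=g(JX,Y)$ closed, i.e. $\omega_{ij}=J_i^a g_{ja}$, $d\omega=0$. Set $\omega^{ij}:=J^i_s g^{js}$, so that $\omega^{ac}\omega_{cb}=\delta^a_b$. Repeated indices are summed. Chern connection: $\nabla=\partial+\Upsilon$ is the unique connection with $\nabla\omega=0$, $\nabla J=0$ and torsion $\tau_{ij}^k:=\Upsilon_{ij}^k-\Upsilon_{ji}^k$ satisfying $\tau_{ij}^k=-J_i^aJ_j^b\tau_{ab}^k$. $\tau_{ijk}:=\tau_{ij}^l g_{lk}$. Its curvature $\Omega$ is defined by $[\nabla_a,\nabla_b]X^k=\Omega_{abd}^kX^d-\tau_{ab}^e\nabla_eX^k$, and $\Omega_{abcd}:=\Omega_{abc}^kg_{kd}$. $\nabla_a\nabla_r T$ denotes components of the second covariant derivative $\nabla(\nabla T)$, with $a$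 the outer derivative; $\Delta:=g^{ij}\nabla_i\nabla_j$. All norms are full tensor norms induced by $g$. $\mathrm{Rc}$ is the Ricci tensor of $g$; $D$ is the Levi-Civita connection. $P_{ab}:=\omega^{cd}\Omega_{abcd}$; the Chern scalar curvature is $\varrho:=\omega^{ba}P_{ab}$. For a 2-tensor $A$, $A^{2,0+0,2}_{ij}:=\tfrac12(A_{ij}-J_i^sJ_j^uA_{su})$. Also $$B:=\tfrac14B^1-\tfrac12B^2,\quad B^1_{ij}:=g^{kl}g_{mn}(D_iJ_k^m)(D_jJ_l^n),\quad B^2_{ij}:=g^{kl}g_{mn}(D_kJ_i^m)(D_lJ_j^n).$$ Symplectic curvature flow: one-parameter families of almost Kähler structures $(\omega_t,J_t)$ (with metric $g_t$) solving $$\left(\tfrac{\partial\omega}{\partial t}\right)_{ij}=-P_{ij},\qquad \left(\tfrac{\partial J}{\partial t}\right)_i^k=-\left(P^{2,0+0,2}_{iw}-2J_i^e\mathrm{Rc}^{2,0+0,2}_{ew}\right)g^{wk};$$ the resulting metric evolution is $\tfrac{\partial g}{\partial t}=-2\mathrm{Rc}+2B$. *)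

(* Defs.v *)
(* Tensors are written in components in the charts of a smooth manifold;
   components carry indices in 'I_m and summation over a
   repeated index is a \sum over 'I_m. *)
From HB Require Import structures.
From mathcomp Require Export all_boot all_order all_algebra.
From mathcomp Require Export all_classical all_reals all_analysis.
Set Implicit Arguments.
Unset Strict Implicit.
Unset Printing Implicit Defensive.
Import Order.TTheory GRing.Theory Num.Theory.
Import numFieldNormedType.Exports.
Local Open Scope classical_set_scope.
Local Open Scope ring_scope.

Section calculus.
Variables (R : realType) (m : nat).
Implicit Types (U : set 'rV[R]_m) (I : set R).

Definition pd (a : 'I_m) (f : 'rV[R]_m -> R) : 'rV[R]_m -> R :=
  'D_(delta_mx 0 a) f.

Fixpoint Ck k U (f : 'rV[R]_m -> R) : Prop :=
  (forall x, U x -> {for x, continuous f}) /\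
  if k is k'.+1 then
    forall a, (forall x, U x -> derivable f x (delta_mx 0 a)) /\ Ck k' U (pd a f)
  else True.

(* meant for U open *)
Definition smooth U f := forall k, Ck k U f.

Definition tquot (u : R -> R) (t s : R) := (s - t)^-1 * (u s - u t).

(* Derivative relative to the interval I: the usual one in the interior of I,
   one-sided at an end point belonging to I. *)
Definition derivable_in I (u : R -> R) (t : R) :=
  cvg (tquot u t @ within I t^').
Definition dt I (u : R -> R) (t : R) : R := lim (tquot u t @ within I t^').

Fixpoint Ck_family k I U (u : R -> 'rV[R]_m -> R) : Prop :=
  {within I `*` U, continuous (fun z : R * 'rV[R]_m => u z.1 z.2)} /\
  if k is k'.+1 then
    [/\ forall t x, I t -> U x -> derivable_in I (u ^~ x) t,
        Ck_family k' I U (fun t x => dt I (u ^~ x) t)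
      & forall a, (forall t x, I t -> U x -> derivable (u t) x (delta_mx 0 a)) /\
                  Ck_family k' I U (fun t => pd a (u t))]
  else True.

(* joint smoothness in (t, x), up to the end points of I that belong to I *)
Definition smooth_family I U u := forall k, Ck_family k I U u.

End calculus.

Record smooth_manifold (R : realType) (m : nat) := SmoothManifold {
  carrier :> topologicalType;
  manifold_hausdorff : hausdorff_space carrier;
  manifold_second_countable : @second_countable carrier;
  chart : Type;
  dom : chart -> set carrier;
  coord : chart -> carrier -> 'rV[R]_m;
  param : chart -> 'rV[R]_m -> carrier;
  dom_open : forall c, open (dom c);
  dom_cover : forall p, exists c, dom c p;
  codom_open : forall c, open (coord c @` dom c);
  coordK : forall c p, dom c p -> param c (coord c p) = p;
  coord_continuous : forall c, {within dom c, continuous (coord c)};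
  param_continuous :
    forall c, {within coord c @` dom c, continuous (param c)};
  transition_smooth : forall c d a,
    smooth (coord c @` (dom c `&` dom d)) (fun x => coord d (param c x) 0 a) }.

Section geometry.
Variables (R : realType) (m : nat) (M : smooth_manifold R m).
Local Notation chart := (chart M).
Local Notation pt := 'rV[R]_m.

Definition cdom (c : chart) : set pt := coord c @` dom c.

(* jac c d x a b = d y^b / d x^a, where x are the coordinates of the chart c and
   y those of the chart d *)
Definition jac (c d : chart) (x : pt) : 'M[R]_m :=
  \matrix_(a, b) pd a (fun z => coord d (param c z) 0 b) x.

Definition mxfield := chart -> pt -> 'M[R]_m.

Definition smooth_mxfield (A : mxfield) :=
  forall c i j, smooth (cdom c) (fun x => A c x i j).

(* A_ij, two lower indices *)
Definition tensorial02 (A : mxfield) := forall c d p, dom c p -> dom d p ->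
  A c (coord c p) = jac c d (coord c p) *m A d (coord d p)
                      *m (jac c d (coord c p))^T.

(* A_i^k: the row is the lower index, the column is the upper index *)
Definition tensorial11 (A : mxfield) := forall c d p, dom c p -> dom d p ->
  A c (coord c p) *m jac c d (coord c p)
    = jac c d (coord c p) *m A d (coord d p).

Record almost_kahler := AlmostKahler {
  metric : mxfield;
  acs : mxfield;    (* acs c x i k = J_i^k, i.e. J d_i = J_i^k d_k *)
  omega : mxfield;
  metric_smooth : smooth_mxfield metric;
  metric_tensorial : tensorial02 metric;
  metric_sym : forall c x, cdom c x -> (metric c x)^T = metric c x;
  metric_pos : forall c x, cdom c x -> forall v : 'rV[R]_m, v != 0 ->
    0 < (v *m metric c x *m v^T) 0 0;
  acs_smooth : smooth_mxfield acs;
  acs_tensorial : tensorial11 acs;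
  acs_sqr : forall c x, cdom c x -> acs c x *m acs c x = - 1%:M;
  acs_isometry : forall c x, cdom c x ->
    acs c x *m metric c x *m (acs c x)^T = metric c x;
  omegaE : forall c x, cdom c x -> forall i j,
    omega c x i j = \sum_a acs c x i a * metric c x j a;
  omega_closed : forall c x, cdom c x -> forall i j k,
    pd i (fun z => omega c z j k) x + pd j (fun z => omega c z k i) x
      + pd k (fun z => omega c z i j) x = 0 }.

(* G c x i j k = G_ij^k, with nabla_i X^k = d_i X^k + G_ij^k X^j *)
Definition christoffel := chart -> pt -> 'I_m -> 'I_m -> 'I_m -> R.

Definition is_connection (G : christoffel) :=
  (forall c i j k, smooth (cdom c) (fun x => G c x i j k)) /\
  (forall c d p, dom c p -> dom d p -> forall i j l,
     let x := coord c p in let A := jac c d x in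
     \sum_k G c x i j k * A k l =
       pd i (fun z => jac c d z j l) x
       + \sum_a \sum_b A i a * A j b * G d (coord d p) a b l).

Definition torsion (G : christoffel) c x i j k : R := G c x i j k - G c x j i k.

(* Components, in a chart, of a tensor field of arbitrary type: T I K is the
   component with list I of lower and list K of upper indices.  A field of type
   (p, q) is only meaningful on lists of sizes p and q. *)
Definition components := seq 'I_m -> seq 'I_m -> pt -> R.

(* covariant derivative; the new lower index comes first *)
Definition nabla (G : christoffel) (c : chart) (T : components) : components :=
  fun I K x => if I is a :: I' then
    pd a (T I' K) x
    - \sum_(s < size I') \sum_e
        G c x a (nth a I' s) e * T (set_nth e I' s e) K x
    + \sum_(s < size K) \sum_e
        G c x a e (nth a K s) * T I' (set_nth e K s e) x
  else 0.

Definition comp00 (f : pt -> R) : components := fun _ _ => f.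
Definition comp01 (X : 'I_m -> pt -> R) : components :=
  fun _ K x => if K is [:: k] then X k x else 0.
Definition comp11 (A : pt -> 'M[R]_m) : components :=
  fun I K x => match I, K with [:: i], [:: k] => A x i k | _, _ => 0 end.
Definition comp20 (A : pt -> 'M[R]_m) : components :=
  fun I _ x => if I is [:: i; j] then A x i j else 0.
Definition comp30 (T : pt -> 'I_m -> 'I_m -> 'I_m -> R) : components :=
  fun I _ x => if I is [:: i; j; k] then T x i j k else 0.

(* Q c x a b d k = Q_abd^k *)
Definition curvature := chart -> pt -> 'I_m -> 'I_m -> 'I_m -> 'I_m -> R.

(* [nabla_a, nabla_b] X^k = Q_abd^k X^d - tau_ab^e nabla_e X^k *)
Definition is_curvature (G : christoffel) (Q : curvature) :=
  forall c (X : 'I_m -> pt -> R), (forall k, smooth (cdom c) (X k)) ->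
  forall x, cdom c x -> forall a b k,
    let DX := nabla G c (comp01 X) in
    nabla G c DX [:: a; b] [:: k] x - nabla G c DX [:: b; a] [:: k] x
    = \sum_d Q c x a b d k * X d x
      - \sum_e torsion G c x a b e * DX [:: e] [:: k] x.

Section structure.
Variable K : almost_kahler.
Local Notation g := (metric K).
Local Notation J := (acs K).

Definition is_levi_civita (G : christoffel) :=
  [/\ is_connection G,
      forall c x, cdom c x -> forall i j k, torsion G c x i j k = 0
    & forall c x, cdom c x -> forall i j k,
        nabla G c (comp20 (g c)) [:: i; j; k] [::] x = 0].

Definition is_chern (G : christoffel) :=
  [/\ is_connection G,
      forall c x, cdom c x -> forall i j k,
        nabla G c (comp20 (omega K c)) [:: i; j; k] [::] x = 0,
      forall c x, cdom c x -> forall i j k,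
        nabla G c (comp11 (J c)) [:: i; j] [:: k] x = 0
    & forall c x, cdom c x -> forall i j k,
        torsion G c x i j k
        = - \sum_a \sum_b J c x i a * J c x j b * torsion G c x a b k].

Definition ginv : mxfield := fun c x => invmx (g c x).

(* omega^ij = J^i_s g^js *)
Definition omega_up : mxfield := fun c x =>
  \matrix_(i, j) \sum_s J c x s i * ginv c x j s.

(* Rc_bd = Rm_abd^a, for Rm the curvature of the Levi-Civita connection *)
Definition ricci (Rm : curvature) : mxfield := fun c x =>
  \matrix_(b, d) \sum_a Rm c x a b d a.

Definition low_curvature (Om : curvature) c x a b i j : R :=
  \sum_k Om c x a b i k * g c x k j.

Definition chern_P (Om : curvature) : mxfield := fun c x =>
  \matrix_(a, b) \sum_i \sum_j omega_up c x i j * low_curvature Om c x a b i j.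

Definition chern_scalar (Om : curvature) c x : R :=
  \sum_a \sum_b omega_up c x b a * chern_P Om c x a b.

(* A^{2,0+0,2} *)
Definition anti_part (A : mxfield) : mxfield := fun c x =>
  \matrix_(i, j)
    (2^-1 * (A c x i j - \sum_s \sum_u J c x i s * J c x j u * A c x s u)).

Definition DJ (D : christoffel) c x i j k : R :=
  nabla D c (comp11 (J c)) [:: i; j] [:: k] x.

Definition B1 (D : christoffel) : mxfield := fun c x =>
  \matrix_(i, j) \sum_k \sum_l \sum_p \sum_q
    ginv c x k l * g c x p q * DJ D c x i k p * DJ D c x j l q.

Definition B2 (D : christoffel) : mxfield := fun c x =>
  \matrix_(i, j) \sum_k \sum_l \sum_p \sum_q
    ginv c x k l * g c x p q * DJ D c x k i p * DJ D c x l j q.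

Definition tensorB (D : christoffel) : mxfield := fun c x =>
  4^-1 *: B1 D c x - 2^-1 *: B2 D c x.

Definition low_torsion (G : christoffel) c x i j k : R :=
  \sum_l torsion G c x i j l * g c x l k.

Definition normsq2 (A : mxfield) c x : R :=
  \sum_i \sum_j \sum_k \sum_l
    ginv c x i k * ginv c x j l * A c x i j * A c x k l.

Definition normsq_torsion (G : christoffel) c x : R :=
  \sum_i \sum_j \sum_k \sum_a \sum_b \sum_d
    ginv c x i a * ginv c x j b * ginv c x k d
    * low_torsion G c x i j k * low_torsion G c x a b d.

Definition nabla2 (G : christoffel) c (T : components) : components :=
  nabla G c (nabla G c T).

(* g^ij nabla_i nabla_j f *)
Definition laplacian (G : christoffel) c (f : pt -> R) x : R :=
  \sum_i \sum_j ginv c x i j * nabla2 G c (comp00 f) [:: i; j] [::] x.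

End structure.

Record symplectic_curvature_flow (I : set R) (S : R -> almost_kahler)
    (Rm Om : R -> curvature) : Prop := SymplecticCurvatureFlow {
  flow_omega_smooth : forall c i j,
    smooth_family I (cdom c) (fun t x => omega (S t) c x i j);
  flow_acs_smooth : forall c i k,
    smooth_family I (cdom c) (fun t x => acs (S t) c x i k);
  flow_omega : forall t c x, I t -> cdom c x -> forall i j,
    dt I (fun s => omega (S s) c x i j) t = - chern_P (S t) (Om t) c x i j;
  flow_acs : forall t c x, I t -> cdom c x -> forall i k,
    dt I (fun s => acs (S s) c x i k) t =
    - \sum_w (anti_part (S t) (chern_P (S t) (Om t)) c x i w
              - 2 * \sum_e acs (S t) c x i e
                           * anti_part (S t) (ricci (Rm t)) c x e w)
             * ginv (S t) c x w k }.

End geometry.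

(* Main.v *)
(* The Chern connection differs from the Levi-Civita connection by a contorsion
   which, by type considerations and d omega = 0, is a permutation of the
   torsion: g(A_X Y, Z) = tau(Z, Y, X).  Comparing the curvatures and contracting
   gives rho = 2 R + 2 |tau|^2, where R is the scalar curvature of g, together
   with formulas for P and for the anti-invariant part of Rc in terms of Rc, B
   and the divergence of tau.  Along the flow these yield
   dg/dt = - 2 Rc + 2 B and g((dJ/dt) X, Y) = - 4 (div tau)(X, J Y).
   The variation formula of R under the first equation, the contracted second
   Bianchi identity and tr_g (dg/dt) = - rho give
   dR/dt = Delta (rho - R) + 2 div div B + 2 <Rc - B, Rc>;
   the second equation, through the variation of the Chern connection, gives
   d|tau|^2/dt = - 2 <Rc - B, B> + 8 <nabla div tau, tau>.
   Adding the two yields the theorem.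

   The identities are proved without coordinates, for derivations of a
   commutative ring; they are applied to the ring of the functions of (t, x)
   smooth on I x U, for U the image of a chart, which carries the derivations
   d/dx^a and d/dt. *)
Require Import Defs.
From HB Require Import structures.
From mathcomp Require Import ring lra.
Set Implicit Arguments.
Unset Strict Implicit.
Unset Printing Implicit Defensive.
Import Order.TTheory GRing.Theory Num.Theory.
Import numFieldNormedType.Exports.
Local Open Scope classical_set_scope.
Local Open Scope ring_scope.

(** * Connections over a Lie-Rinehart algebra *)

(** The Levi-Civita and Chern connections are given separately at each time, while the argument
    differentiates them in time. They are therefore rebuilt from $\omega$ and $J$ by explicit
    formulas, hence smoothly in time, and identified at each fixed time with the given ones. The
    scalar curvature is varied with the Levi-Civita connection and the torsion with the Chern
    connection, whereas the theorem only has Chern derivatives. In the traces that occur, exchanging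
    the two costs nothing: the torsion is of type $(3,0)+(0,3)$, hence trace free. The variation of
    the Chern connection is never computed in full. Only the part anticommuting with $J$ pairs with
    the torsion, and it is read off from the commutator with $J$, which is $-\nabla(\partial_tJ)$.
    Constants: as $2R=\varrho-2|\tau|^2$, the term $2\Delta(\varrho-R)$ equals
    $\Delta\varrho+2\Delta|\tau|^2$, which produces both Laplacians; $4$ and $16$ are the doubles of
    $2$ and $8$ in the variations of $R$ and $|\tau|^2$. *)

Section multilinear.
Variables (F : comPzRingType) (V : lmodType F).

Definition lin (f : V -> F) := forall a u v, f (a *: u + v) = a * f u + f v.
Definition lin2 (f : V -> V -> F) :=
  (forall y, lin (f^~ y)) /\ (forall x, lin (f x)).
Definition lin3 (f : V -> V -> V -> F) :=
  (forall y z, lin (fun x => f x y z)) /\ (forall x, lin2 (f x)).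
Definition lin4 (f : V -> V -> V -> V -> F) :=
  (forall y z w, lin (fun x => f x y z w)) /\ (forall x, lin3 (f x)).

Lemma lin0 f : lin f -> f 0 = 0.
Proof.
move=> fP; have := fP 1 0 0; rewrite scale1r addr0 mul1r => /eqP.
by rewrite -subr_eq0 opprD addrA subrr sub0r oppr_eq0 => /eqP.
Qed.

Lemma linD f : lin f -> {morph f : u v / u + v}.
Proof. by move=> fP u v; rewrite -[u]scale1r fP mul1r scale1r. Qed.

Lemma linZ f : lin f -> forall a u, f (a *: u) = a * f u.
Proof. by move=> fP a u; rewrite -[a *: u]addr0 fP (lin0 fP) addr0. Qed.

Lemma linN f : lin f -> {morph f : u / - u}.
Proof. by move=> fP u; rewrite -scaleN1r linZ // mulN1r. Qed.

Lemma lin_sum f : lin f -> forall (I : finType) (c : I -> F) (v : I -> V),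
  f (\sum_i c i *: v i) = \sum_i c i * f (v i).
Proof.
move=> fP I c v; apply: (big_ind2 (fun x y => f x = y)) => [|? ? ? ? <- <-|i _].
- exact: lin0.
- exact: linD.
- exact: linZ.
Qed.

End multilinear.

Section metric_module.
Variables (F : comPzRingType) (V : lmodType F).
Variables (act : V -> F -> F) (br : V -> V -> V).

(* V stands for the vector fields, F for the ring of functions on which they act. *)
Record lie_rinehart : Prop := LieRinehart {
  actE : forall f, lin (act^~ f);
  actD : forall X, {morph act X : f h / f + h};
  actM : forall X f h, act X (f * h) = act X f * h + f * act X h;
  act_br : forall X Y f, act (br X Y) f = act X (act Y f) - act Y (act X f);
  brC : forall X Y, br X Y = - br Y X;
  brD : forall X, {morph br X : Y Z / Y + Z};
  brZ : forall X f Y, br X (f *: Y) = act X f *: Y + f *: br X Y;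
  br_jacobi : forall X Y Z,
    br X (br Y Z) + br Y (br Z X) + br Z (br X Y) = 0 }.

Variables (g : V -> V -> F) (m : nat) (e : 'I_m -> V) (gi : 'I_m -> 'I_m -> F).

(** An arbitrary frame [e] with the inverse [gi] of its Gram matrix, not an orthonormal one:
    coordinate frames can then be used as they stand, and no square roots are taken in [F]. *)
Record riemannian : Prop := Riemannian {
  metric_lin : forall y, lin (g^~ y);
  metricC : forall x y, g x y = g y x;
  cometricC : forall i j, gi i j = gi j i;
  frame_dec : forall v, v = \sum_i (\sum_j gi i j * g v (e j)) *: e i;
  cometricK : forall i j, \sum_k gi i k * g (e k) (e j) = (i == j)%:R }.

Hypotheses (LR : lie_rinehart) (GR : riemannian).

Definition metric_tr (f : V -> V -> F) := \sum_i \sum_j gi i j * f (e i) (e j).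

Lemma eq_tr f h : (forall u v, f u v = h u v) -> metric_tr f = metric_tr h.
Proof. by move=> fh; do 2!apply: eq_bigr => ? _; rewrite fh. Qed.

Lemma tr0 f : (forall u v, f u v = 0) -> metric_tr f = 0.
Proof.
by move=> f0; rewrite /metric_tr big1 // => i _; rewrite big1 // => j _; rewrite f0 mulr0.
Qed.

Lemma trD f h : metric_tr (fun u v => f u v + h u v) = metric_tr f + metric_tr h.
Proof.
rewrite -big_split; apply: eq_bigr => i _; rewrite -big_split.
by apply: eq_bigr => j _; rewrite mulrDr.
Qed.

Lemma trN f : metric_tr (fun u v => - f u v) = - metric_tr f.
Proof.
by rewrite -sumrN; apply: eq_bigr => i _; rewrite -sumrN; apply: eq_bigr => j _;
  rewrite mulrN.
Qed.

Lemma trB f h : metric_tr (fun u v => f u v - h u v) = metric_tr f - metric_tr h.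
Proof. by rewrite trD trN. Qed.

Lemma trZ a f : metric_tr (fun u v => a * f u v) = a * metric_tr f.
Proof.
by rewrite mulr_sumr; apply: eq_bigr => i _; rewrite mulr_sumr;
  apply: eq_bigr => j _; rewrite mulrCA.
Qed.

Lemma trZr a f : metric_tr (fun u v => f u v * a) = metric_tr f * a.
Proof. by rewrite mulrC -trZ; apply: eq_tr => u v; rewrite mulrC. Qed.

Lemma tr_swap f : metric_tr (fun u v => f v u) = metric_tr f.
Proof.
rewrite /metric_tr exchange_big; do 2!apply: eq_bigr => ? _.
by rewrite (cometricC GR).
Qed.

Lemma tr_exch f : metric_tr (fun u v => metric_tr (f u v)) =
  metric_tr (fun u' v' => metric_tr (fun u v => f u v u' v')).
Proof.
rewrite /metric_tr.
under eq_bigr => i _ do under eq_bigr => j _ do rewrite mulr_sumr.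
under [RHS]eq_bigr => i _ do under eq_bigr => j _ do rewrite mulr_sumr.
under eq_bigr => i _ do (rewrite exchange_big /=;
  under eq_bigr => k _ do under eq_bigr => j _ do rewrite mulr_sumr).
under [RHS]eq_bigr => i _ do (rewrite exchange_big /=;
  under eq_bigr => k _ do under eq_bigr => j _ do rewrite mulr_sumr).
rewrite exchange_big /=; do 2!apply: eq_bigr => ? _.
rewrite exchange_big /=; do 2!apply: eq_bigr => ? _.
by rewrite mulrCA.
Qed.

Definition dual i : V := \sum_j gi i j *: e j.

Lemma trE f : lin2 f -> metric_tr f = \sum_i f (e i) (dual i).
Proof. by case=> _ fP; apply: eq_bigr => i _; rewrite lin_sum. Qed.

Lemma metric_linr x : lin (g x).
Proof. by move=> a u v; rewrite !(metricC GR x) (metric_lin GR). Qed.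

Lemma metric_dual v i : g v (dual i) = \sum_j gi i j * g v (e j).
Proof. by rewrite lin_sum //; exact: metric_linr. Qed.

Lemma dual_dec v : v = \sum_i g v (dual i) *: e i.
Proof.
by rewrite [LHS](frame_dec GR); apply: eq_bigr => i _; rewrite metric_dual.
Qed.

Lemma frame_dual v : v = \sum_i g v (e i) *: dual i.
Proof.
rewrite [LHS](frame_dec GR) /dual.
under [RHS]eq_bigr => i _ do rewrite scaler_sumr.
under [LHS]eq_bigr => i _ do rewrite scaler_suml.
rewrite exchange_big; do 2!apply: eq_bigr => ? _.
by rewrite scalerA mulrC (cometricC GR).
Qed.

Lemma metric_frame_dual i j : g (e i) (dual j) = (i == j)%:R.
Proof.
rewrite metric_dual eq_sym -(cometricK GR).
by apply: eq_bigr => k _; rewrite (metricC GR).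
Qed.

Lemma metric_inj u v : (forall w, g u w = g v w) -> u = v.
Proof.
by move=> uv; rewrite (dual_dec u) (dual_dec v); apply: eq_bigr => i _;
  rewrite uv.
Qed.

(** Both sides expand to one double sum over the frame and its dual. Applied to [J], whose adjoint
    is [- J], this moves [J] from one slot of a trace to the other. *)
Lemma tr_adjoint (L L' : V -> V) f : (forall u v, g (L u) v = g u (L' v)) ->
  (forall a u v, L (a *: u + v) = a *: L u + L v) ->
  (forall a u v, L' (a *: u + v) = a *: L' u + L' v) -> lin2 f ->
  metric_tr (fun u v => f (L u) v) = metric_tr (fun u v => f u (L' v)).
Proof.
move=> LL' LE LE' fP; have [fl fr] := fP.
rewrite !trE; last 2 first.
- by split=> [y|x] a u v; rewrite ?LE' (fl, fr).
- by split=> [y|x] a u v; rewrite ?LE (fl, fr).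
under eq_bigr => i _ do rewrite [L _]dual_dec (lin_sum (fl _)).
under [RHS]eq_bigr => i _ do rewrite [L' _]frame_dual (lin_sum (fr _)).
rewrite exchange_big; do 2!apply: eq_bigr => ? _.
by rewrite LL' (metricC GR).
Qed.

(** Contracting with the metric substitutes an argument; read backwards, it inserts a pair of
    contracted indices. *)
Lemma tr_contract f u : lin f -> metric_tr (fun s t => g u s * f t) = f u.
Proof.
move=> fP; rewrite trE; last first.
  split=> [y|x] a v w; first by rewrite metric_linr mulrDl mulrA.
  by rewrite fP mulrDr mulrCA.
by rewrite [in RHS](frame_dual u) lin_sum.
Qed.

Lemma act0 X : act X 0 = 0.
Proof.
have /eqP := actD LR X 0 0; rewrite addr0 -subr_eq0 opprD addrA subrr sub0r.
by rewrite oppr_eq0 => /eqP.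
Qed.

Lemma actN X f : act X (- f) = - act X f.
Proof.
by apply/eqP; rewrite -addr_eq0 -(actD LR) addNr act0.
Qed.

Lemma actB X f h : act X (f - h) = act X f - act X h.
Proof. by rewrite (actD LR) actN. Qed.

Lemma act1 X : act X 1 = 0.
Proof.
have /eqP := actM LR X 1 1; rewrite mulr1 mul1r mulr1 -subr_eq0 opprD addrA.
by rewrite subrr sub0r oppr_eq0 => /eqP.
Qed.

Lemma act_nat X n : act X n%:R = 0.
Proof.
by elim: n => [|n IH]; rewrite ?act0 // -addn1 natrD (actD LR) IH act1 addr0.
Qed.

Lemma act_sum X (I : finType) (f : I -> F) :
  act X (\sum_i f i) = \sum_i act X (f i).
Proof. by apply: big_morph; [exact: actD | exact: act0]. Qed.

Record affine_conn (N : V -> V -> V) : Prop := AffineConn {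
  connl : forall a X Y Z, N (a *: X + Y) Z = a *: N X Z + N Y Z;
  connD : forall X, {morph N X : Y Z / Y + Z};
  connZ : forall X f Y, N X (f *: Y) = act X f *: Y + f *: N X Y }.

(** A metric connection with arbitrary torsion, so that the Levi-Civita and the Chern connection are
    both instances. *)
Record is_conn (N : V -> V -> V) : Prop := IsConn {
  conn_affine :> affine_conn N;
  conn_metric : forall X Y Z, act X (g Y Z) = g (N X Y) Z + g Y (N X Z) }.

Definition torsion_of (N : V -> V -> V) X Y := N X Y - N Y X - br X Y.
Definition curvature_of (N : V -> V -> V) X Y Z :=
  N X (N Y Z) - N Y (N X Z) - N (br X Y) Z.
Definition cov1 (N : V -> V -> V) (f : V -> F) X Y := act X (f Y) - f (N X Y).
(** The first argument is the direction of differentiation. Iterating, as in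
    [cov3 N (cov2 N f) X Y], gives the second covariant derivative with [X] outermost, the
    correction along [N X Y] being included. *)
Definition cov2 (N : V -> V -> V) (f : V -> V -> F) X Y Z :=
  act X (f Y Z) - f (N X Y) Z - f Y (N X Z).
Definition cov3 (N : V -> V -> V) (f : V -> V -> V -> F) X Y Z W :=
  act X (f Y Z W) - f (N X Y) Z W - f Y (N X Z) W - f Y Z (N X W).
Definition cov4 (N : V -> V -> V) (f : V -> V -> V -> V -> F) X Y Z W U :=
  act X (f Y Z W U) - f (N X Y) Z W U - f Y (N X Z) W U - f Y Z (N X W) U
  - f Y Z W (N X U).

Section connection.
Variables (N : V -> V -> V).
Hypothesis NP : affine_conn N.

Lemma connE X a Y Z : N X (a *: Y + Z) = act X a *: Y + a *: N X Y + N X Z.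
Proof. by rewrite (connD NP) (connZ NP). Qed.

(** The derivatives of the coefficients cancel between the Leibniz rules of [act] and [N]. This
    tensoriality is what later allows checking identities on a frame. *)
Lemma nab2_lin f : lin2 f -> lin3 (cov2 N f).
Proof.
case=> fl fr; do !split=> *; move=> a u v; rewrite /cov2.
- by rewrite (actE LR) !(connl NP) fl fr; ring.
- rewrite connE -!addrA !(fl, fr) (actD LR) (actM LR).
  ring.
- rewrite connE -!addrA !(fl, fr) (actD LR) (actM LR).
  ring.
Qed.

Lemma nab3_lin f : lin3 f -> lin4 (cov3 N f).
Proof.
case=> f1 f23; have f2 x := (f23 x).1; have f3 x := (f23 x).2.
do !split=> *; move=> a u v; rewrite /cov3.
- by rewrite (actE LR) !(connl NP) f1 f2 f3; ring.
- rewrite connE -!addrA !(f1, f2, f3) (actD LR) (actM LR).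
  ring.
- rewrite connE -!addrA !(f1, f2, f3) (actD LR) (actM LR).
  ring.
- rewrite connE -!addrA !(f1, f2, f3) (actD LR) (actM LR).
  ring.
Qed.

End connection.

(** Besides [cov2], the derivatives of the frame and of its dual contribute $\sum
    X(g(e_i,e^j))\,f(e_j,e^i)$, and the coefficients $g(e_i,e^j)$ are the constants 0 and 1. *)
Lemma tr_deriv N : is_conn N -> forall f X, lin2 f -> act X (metric_tr f) = metric_tr (cov2 N f X).
Proof.
move=> NM f X fP; have [fl fr] := fP; have [_ nP] := nab2_lin NM fP.
rewrite !trE // act_sum.
suff: \sum_i (f (N X (e i)) (dual i) + f (e i) (N X (dual i))) = 0.
  move=> H; apply/eqP; rewrite -subr_eq0 -sumrB; apply/eqP; rewrite -[RHS]H.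
  by apply: eq_bigr => i _; rewrite /cov2; ring.
rewrite big_split /=.
under eq_bigr => i _ do rewrite [N _ _]dual_dec (lin_sum (fl _)).
under [X in _ + X]eq_bigr => i _ do rewrite [N _ _]frame_dual (lin_sum (fr _)).
rewrite exchange_big -big_split big1 //= => i _.
rewrite -big_split big1 //= => j _.
rewrite (metricC GR (N X (dual i))) -mulrDl -(conn_metric NM) metric_frame_dual.
by rewrite act_nat mul0r.
Qed.

End metric_module.

Section connections.
Variables (F : comPzRingType) (V : lmodType F).
Variables (act : V -> F -> F) (br : V -> V -> V).
Variables (g : V -> V -> F) (m : nat) (e : 'I_m -> V) (gi : 'I_m -> 'I_m -> F).
Hypotheses (LR : lie_rinehart act br) (GR : riemannian g e gi).
Local Notation is_conn := (is_conn act g).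
Local Notation tors := (torsion_of br).
Local Notation curv := (curvature_of br).

Lemma metricE a x y z : g (a *: x + y) z = a * g x z + g y z.
Proof. exact: (metric_lin GR). Qed.

Lemma metricD x y z : g (x + y) z = g x z + g y z.
Proof. exact: (linD (metric_lin GR z)). Qed.

Lemma metricZ a x z : g (a *: x) z = a * g x z.
Proof. exact: (linZ (metric_lin GR z)). Qed.

Lemma metricN x z : g (- x) z = - g x z.
Proof. exact: (linN (metric_lin GR z)). Qed.

Lemma metricDr x y z : g z (x + y) = g z x + g z y.
Proof. exact: (linD (metric_linr GR z)). Qed.

Lemma metricZr a x z : g z (a *: x) = a * g z x.
Proof. exact: (linZ (metric_linr GR z)). Qed.

Lemma metricNr x z : g z (- x) = - g z x.
Proof. exact: (linN (metric_linr GR z)). Qed.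

Definition gE := (metricD, metricZ, metricN, metricDr, metricZr, metricNr).

(** Nondegeneracy of the metric turns an identity between vectors into one in [F], where [ring]
    applies. *)
Local Ltac vring := apply: (metric_inj GR) => ?; rewrite !gE; ring.

Lemma brDl Z : {morph br^~ Z : X Y / X + Y}.
Proof.
by move=> X Y; rewrite /= !(brC LR _ Z) (brD LR) opprD.
Qed.

Lemma brZl f X Y : br (f *: X) Y = f *: br X Y - act Y f *: X.
Proof. rewrite !(brC LR _ Y) (brZ LR); vring. Qed.

Lemma brNr X Y : br X (- Y) = - br X Y.
Proof.
rewrite -scaleN1r (brZ LR) (actN LR) (act1 LR) oppr0 scale0r add0r.
by rewrite scaleN1r.
Qed.

Lemma brNl X Y : br (- X) Y = - br X Y.
Proof. by rewrite (brC LR (- X)) brNr (brC LR X). Qed.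

Section connection.
Variable N : V -> V -> V.
Hypothesis NP : affine_conn act N.

Lemma connDl X Y Z : N (X + Y) Z = N X Z + N Y Z.
Proof. by have := connl NP 1 X Y Z; rewrite !scale1r. Qed.

Lemma conn0l X : N 0 X = 0.
Proof.
by apply: (addrI (N 0 X)); rewrite -connDl !addr0.
Qed.

Lemma connZl a X Y : N (a *: X) Y = a *: N X Y.
Proof. by have := connl NP a X 0 Y; rewrite conn0l !addr0. Qed.

Lemma connNl X Y : N (- X) Y = - N X Y.
Proof. by rewrite -scaleN1r connZl scaleN1r. Qed.

Lemma connN X Y : N X (- Y) = - N X Y.
Proof.
rewrite -scaleN1r (connZ NP) (actN LR) (act1 LR) oppr0 scale0r add0r.
by rewrite scaleN1r.
Qed.

Definition connR := (connDl, connZl, connNl, connD NP, connZ NP, connN).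

Lemma torsC X Y : tors N X Y = - tors N Y X.
Proof. rewrite /torsion_of (brC LR X); vring. Qed.

Lemma tors_linl a X Y Z :
  tors N (a *: X + Y) Z = a *: tors N X Z + tors N Y Z.
Proof. rewrite /torsion_of !connR brDl brZl; vring. Qed.

Lemma tors_linr a X Y Z :
  tors N Z (a *: X + Y) = a *: tors N Z X + tors N Z Y.
Proof. rewrite ![tors N Z _]torsC tors_linl; vring. Qed.

Lemma curvC X Y Z : curv N X Y Z = - curv N Y X Z.
Proof. rewrite /curvature_of (brC LR X) !connR; vring. Qed.

Lemma curv_lin1 a X Y Z W :
  curv N (a *: X + Y) Z W = a *: curv N X Z W + curv N Y Z W.
Proof. rewrite /curvature_of brDl brZl !connR; vring. Qed.

Lemma curv_lin2 a X Y Z W :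
  curv N Z (a *: X + Y) W = a *: curv N Z X W + curv N Z Y W.
Proof. rewrite ![curv N Z _ W]curvC curv_lin1; vring. Qed.

Lemma curv_lin3 a X Y Z W :
  curv N Z W (a *: X + Y) = a *: curv N Z W X + curv N Z W Y.
Proof. rewrite /curvature_of !connR (act_br LR) scalerBl; vring. Qed.

Definition rm X Y Z W := g (curv N X Y Z) W.

Lemma rm_lin1 a u v y z w : rm (a *: u + v) y z w = a * rm u y z w + rm v y z w.
Proof. by rewrite /rm curv_lin1 metricE. Qed.

Lemma rm_lin2 a u v x z w : rm x (a *: u + v) z w = a * rm x u z w + rm x v z w.
Proof. by rewrite /rm curv_lin2 metricE. Qed.

Lemma rm_lin3 a u v x y w : rm x y (a *: u + v) w = a * rm x y u w + rm x y v w.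
Proof. by rewrite /rm curv_lin3 metricE. Qed.

Lemma rm_lin4 a u v x y z : rm x y z (a *: u + v) = a * rm x y z u + rm x y z v.
Proof. exact: (metric_linr GR). Qed.

Definition rm_lin := (rm_lin1, rm_lin2, rm_lin3, rm_lin4).

Lemma rmC12 x y z w : rm x y z w = - rm y x z w.
Proof. by rewrite /rm curvC metricN. Qed.

(** Apply [act (br x y)], the commutator of two derivatives, to [g z w]: metric compatibility turns
    this into the vanishing of the symmetric part in [z], [w]. *)
Lemma rmC34 : is_conn N -> forall x y z w, rm x y z w = - rm x y w z.
Proof.
move=> NM x y z w.
have H X Y Z W : g (N X Y) Z = act X (g Y Z) - g Y (N X Z).
  by rewrite (conn_metric NM); ring.
rewrite /rm /curvature_of !gE (metricC GR (N x (N y w))) (metricC GR (N y _) z).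
rewrite (metricC GR (N (br x y) w)).
have Hz X Y : act X (act Y (g z w)) = g (N X (N Y z)) w + g (N Y z) (N X w)
    + g (N X z) (N Y w) + g z (N X (N Y w)).
  rewrite (conn_metric NM Y) (actD LR) !(conn_metric NM X); ring.
have := act_br LR x y (g z w); rewrite !Hz (conn_metric NM) => Hb.
apply/eqP; rewrite -subr_eq0; apply/eqP.
move/eqP: Hb; rewrite -subr_eq0 => /eqP Hb.
rewrite -[RHS]oppr0 -Hb; ring.
Qed.

End connection.

(** Without torsion a bracket is a difference of covariant derivatives, and the cyclic sum becomes
    the Jacobi identity. *)
Lemma curv_bianchi N : is_conn N -> (forall X Y, tors N X Y = 0) ->
  forall X Y Z, curv N X Y Z + curv N Y Z X + curv N Z X Y = 0.
Proof.
move=> NP NT X Y Z.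
have H A B : br A B = N A B - N B A.
  by have /eqP := NT A B; rewrite subr_eq0 => /eqP.
have J := br_jacobi LR X Y Z.
rewrite -J !(H X (br _ _)) !(H Y (br _ _)) !(H Z (br _ _)) /curvature_of !H !(connR NP).
vring.
Qed.

End connections.

(** * Almost Kahler identities *)

Section almost_kahler_identities.
Variables (F : comPzRingType) (V : lmodType F).
Variables (act : V -> F -> F) (br : V -> V -> V).
Variables (g : V -> V -> F) (m : nat) (e : 'I_m -> V) (gi : 'I_m -> 'I_m -> F).
Variables (J : V -> V) (nb Dc : V -> V -> V).

(** [kahler_closed] is Cartan's formula for $d\omega$ on three fields. Division by 2 is replaced by
    the cancellation [ak_two_inj], so the algebra applies to any such ring of functions. *)
Record ak_structure : Prop := AKStructure {
  ak_lie_rinehart : lie_rinehart act br;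
  ak_riemannian : riemannian g e gi;
  ak_two_inj : forall x : F, x + x = 0 -> x = 0;
  acs_lin : forall a u v, J (a *: u + v) = a *: J u + J v;
  acsK : forall u, J (J u) = - u;
  acs_metric : forall u v, g (J u) (J v) = g u v;
  chern_conn : is_conn act g nb;
  chern_acs : forall X Y, nb X (J Y) = J (nb X Y);
  chern_tors : forall X Y, torsion_of br nb (J X) (J Y) = - torsion_of br nb X Y;
  kahler_closed : forall X Y Z,
    act X (g (J Y) Z) + act Y (g (J Z) X) + act Z (g (J X) Y)
    - g (J (br X Y)) Z - g (J (br Y Z)) X - g (J (br Z X)) Y = 0;
  lc_conn : is_conn act g Dc;
  lc_tors : forall X Y, torsion_of br Dc X Y = 0 }.

Hypothesis AK : ak_structure.
Let LR := ak_lie_rinehart AK.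
Let GR := ak_riemannian AK.
Let two_inj := ak_two_inj AK.
Let nbP := chern_conn AK.
Let DcP := lc_conn AK.
Local Notation tr := (metric_tr e gi).
Local Notation nab3 := (cov3 act).
Local Notation tau := (torsion_of br nb).
Local Notation R := (rm br g Dc).
Local Notation gE := (gE GR).
Local Ltac vring := apply: (metric_inj GR) => ?; rewrite !gE; ring.

Lemma acsD u v : J (u + v) = J u + J v.
Proof. by have := acs_lin AK 1 u v; rewrite !scale1r. Qed.

Lemma acs0 : J 0 = 0.
Proof. by apply: (addrI (J 0)); rewrite -acsD !addr0. Qed.

Lemma acsZ a u : J (a *: u) = a *: J u.
Proof. by rewrite -[a *: u]addr0 (acs_lin AK) acs0 addr0. Qed.

Lemma acsN u : J (- u) = - J u.
Proof. by rewrite -scaleN1r acsZ scaleN1r. Qed.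

Lemma acs_antisym u v : g (J u) v = - g u (J v).
Proof. by rewrite -(acs_metric AK u) (acsK AK) (metricNr GR) opprK. Qed.

Lemma tr_acs f : lin2 f -> tr (fun u v => f (J u) v) = - tr (fun u v => f u (J v)).
Proof.
move=> fP; rewrite (@tr_adjoint _ _ _ _ _ _ GR J (fun v => - J v)) //.
- by rewrite -trN; apply: eq_tr => u v; rewrite (linN (fP.2 u)).
- by move=> u v; rewrite acs_antisym (metricNr GR).
- exact: acs_lin.
- by move=> a u v; rewrite (acs_lin AK) opprD scalerN.
Qed.

Lemma tr_acs2 f : lin2 f -> tr (fun u v => f (J u) (J v)) = tr f.
Proof.
move=> fP; rewrite (@tr_acs (fun u v => f u (J v))).
  by rewrite -trN; apply: eq_tr => u v; rewrite (acsK AK) (linN (fP.2 u)) opprK.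
by split=> *; move=> a u v; rewrite ?(acs_lin AK) (fP.1, fP.2).
Qed.

(** The trace is [J]-invariant, so that of an anti-invariant form equals its own opposite. All
    vanishing by type below comes from here. *)
Lemma tr_anti f : lin2 f -> (forall u v, f (J u) (J v) = - f u v) -> tr f = 0.
Proof.
move=> fP fJ; apply: two_inj; rewrite -[X in X + _](tr_acs2 fP) -trD.
rewrite /metric_tr big1 // => i _; rewrite big1 // => j _.
by rewrite fJ addNr mulr0.
Qed.

Definition torsion3 X Y Z := g (tau X Y) Z.
Local Notation T := torsion3.

Lemma tau_lin a X Y Z : tau (a *: X + Y) Z = a *: tau X Z + tau Y Z.
Proof. exact: (tors_linl LR GR nbP). Qed.

Lemma T_lin1 a u v y z : T (a *: u + v) y z = a * T u y z + T v y z.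
Proof. by rewrite /T tau_lin (metricE GR). Qed.

Lemma T_lin2 a u v x z : T x (a *: u + v) z = a * T x u z + T x v z.
Proof. by rewrite /T (tors_linr LR GR nbP) (metricE GR). Qed.

Lemma T_lin3 a u v x y : T x y (a *: u + v) = a * T x y u + T x y v.
Proof. exact: (metric_linr GR). Qed.

Definition TE := (T_lin1, T_lin2, T_lin3).

Lemma T_lin : lin3 T.
Proof. by do !split=> *; move=> a u v; rewrite TE. Qed.

Lemma TN2 x u z : T x (- u) z = - T x u z.
Proof. exact: (linN ((T_lin.2 x).1 z)). Qed.

Lemma TN3 x y u : T x y (- u) = - T x y u.
Proof. exact: (linN ((T_lin.2 x).2 y)). Qed.

Lemma TC X Y Z : T X Y Z = - T Y X Z.
Proof. by rewrite /T (torsC LR GR nb) (metricN GR). Qed.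

(* d omega = 0 says that the cyclic sum of S vanishes. *)
Let S X Y Z := g (J (tau X Y)) Z.

Let ScycE X Y Z : S X Y Z + S Y Z X + S Z X Y = 0.
Proof.
have brE A B : br A B = nb A B - nb B A - tau A B by rewrite /torsion_of; vring.
have H := kahler_closed AK X Y Z.
(* Since [nb] preserves $\omega$, each derivative becomes connection terms; these cancel the ones in
   the brackets, and only the torsion survives. *)
have K A B C : act A (g (J B) C) = g (J (nb A B)) C - g (J (nb A C)) B.
  rewrite (conn_metric nbP) (chern_acs AK) acs_antisym.
  by rewrite [g (J (nb A C)) B]acs_antisym (metricC GR (nb A C)) acs_antisym; ring.
rewrite -[RHS]H !K !brE /S; move: (tau X Y) (tau Y Z) (tau Z X) => u v w.
by rewrite !(acsD, acsN) !gE; ring.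
Qed.

Lemma tauN X Y : tau X (- Y) = - tau X Y.
Proof. by apply: (metric_inj GR) => w; rewrite (metricN GR); exact: TN2. Qed.

Let Styp X Y Z : S (J X) Y Z = S X (J Y) Z.
Proof.
have := chern_tors AK X (J Y); rewrite (acsK AK) tauN /S => /oppr_inj ->.
by [].
Qed.

(** By type, [J] moves freely between the first two slots. Adding the cyclic identities with one
    [J], in each of the three positions, to the one with three gives twice [p + q + r]; comparing
    its vanishing with [H3] moves [J] to the third slot. *)
Let S13 X Y Z : S (J X) Y Z = S X Y (J Z).
Proof.
have S0 A B C : S (J A) (J B) (J C) = - S A B (J C).
  by rewrite /S (chern_tors AK) acsN (metricN GR).
have H1 := ScycE (J X) Y Z; have H2 := ScycE X (J Y) Z.
have H3 := ScycE X Y (J Z); have H4 := ScycE (J X) (J Y) (J Z).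
move: H1 H2 H3 H4; rewrite !S0 -!Styp.
move: (S (J X) Y Z) (S (J Y) Z X) (S (J Z) X Y) (S X Y (J Z)) (S Y Z (J X))
  (S Z X (J Y)) => p q r p' q' r' H1 H2 H3 H4.
have pqr : p + q + r = 0.
  apply: two_inj; transitivity ((p + q' + r) + (p + q + r') + (p' + q + r)
    + (- p' - q' - r')); first by ring.
  by rewrite H1 H2 H3 H4 !addr0.
apply/eqP; rewrite -subr_eq0; apply/eqP.
transitivity ((p + q + r) - (p' + q + r)); first by ring.
by rewrite pqr H3 subr0.
Qed.

Lemma T12 X Y Z : T (J X) Y Z = T X (J Y) Z.
Proof. by have := Styp X Y (J Z); rewrite /S !(acs_metric AK). Qed.

Lemma T13 X Y Z : T (J X) Y Z = T X Y (J Z).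
Proof.
by have := S13 X Y (J Z); rewrite /S !(acs_metric AK).
Qed.

Lemma T23 X Y Z : T X (J Y) Z = T X Y (J Z).
Proof. by rewrite -T12 T13. Qed.

Lemma Tcyc X Y Z : T X Y Z + T Y Z X + T Z X Y = 0.
Proof.
have := ScycE (J X) Y Z; rewrite S13 -[S Z _ _]Styp [S (J Z) _ _]S13.
by rewrite /S !(acs_metric AK).
Qed.

(** Moving [J] across both traced slots changes the sign. This is why traced derivatives for the two
    connections agree later. *)
Lemma tr_T23 X : tr (T X) = 0.
Proof.
apply: tr_anti => [|u v]; first exact: T_lin.2.
by rewrite T23 (acsK AK) TN3.
Qed.

Definition contorsion X Y := nb X Y - Dc X Y.
Local Notation A := contorsion.
Definition contorsion3 X Y Z := g (A X Y) Z.
Local Notation a := contorsion3.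

Lemma aC X Y Z : a X Y Z = - a X Z Y.
Proof.
have := conn_metric nbP X Y Z; rewrite (conn_metric DcP) => H.
rewrite /a /A !gE (metricC GR (nb X Z)) (metricC GR (Dc X Z)).
by apply/eqP; rewrite -subr_eq0; apply/eqP; move/eqP: H;
  rewrite -subr_eq0 => /eqP H; rewrite -[RHS]oppr0 -H; ring.
Qed.

Lemma a_tors X Y Z : a X Y Z - a Y X Z = T X Y Z.
Proof.
rewrite /a /T /A -(metricN GR) -(metricD GR); congr (g _ _).
have /eqP := lc_tors AK X Y; rewrite /torsion_of => H.
apply/eqP; rewrite -subr_eq0 -{1}[0]oppr0 -(eqP H); apply/eqP; vring.
Qed.

(** As in the Koszul formula, skewness in the last two arguments and the torsion in the first two
    determine [a]; the cyclic identity [Tcyc] reduces the three resulting terms to one. *)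
Lemma aE X Y Z : a X Y Z = T Z Y X.
Proof.
have H1 := a_tors X Y Z; have H2 := a_tors Y Z X; have H3 := a_tors Z X Y.
rewrite (TC Z Y X); move: (Tcyc X Y Z) H1 H2 H3.
rewrite [a Y X Z]aC [a Z Y X]aC [a X Z Y]aC => C H1 H2 H3.
apply/eqP; rewrite -subr_eq0; apply/eqP; apply: two_inj.
transitivity (T X Y Z + T Y Z X + T Z X Y); last exact: C.
by rewrite -H1 -H2 -H3; ring.
Qed.

Lemma A_acs X Y : A X (J Y) = - J (A X Y).
Proof.
apply: (metric_inj GR) => w; rewrite (metricN GR) acs_antisym opprK.
by rewrite -!/(a _ _ _) !aE T12.
Qed.

(** [nb] commutes with [J] and [A X] anticommutes with it, whence $DJ=-2AJ$. Through this the
    tensors $B^1$, $B^2$ become quadratic in the torsion. *)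
Lemma DcJ X Y : Dc X (J Y) - J (Dc X Y) = - (A X (J Y) + A X (J Y)).
Proof.
rewrite {2}A_acs /A (chern_acs AK) acsD acsN; move: (J (Dc X Y)) (J (nb X Y)).
move=> u v; vring.
Qed.

Lemma A_lin1 c u v Y : A (c *: u + v) Y = c *: A u Y + A v Y.
Proof.
rewrite /A !(connR LR nbP) !(connR LR DcP); vring.
Qed.

Lemma A_lin2 c u v Y : A Y (c *: u + v) = c *: A Y u + A Y v.
Proof.
rewrite /A !(connR LR nbP) !(connR LR DcP); vring.
Qed.

Lemma AN2 X Y : A X (- Y) = - A X Y.
Proof. rewrite /A (connN LR nbP) (connN LR DcP); vring. Qed.

(* Up to terms quadratic in the contorsion, the part of the Levi-Civita
   curvature anticommuting with J. *)
Definition curvature_defect X Y Z W :=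
  nab3 nb a Y X Z W - nab3 nb a X Y Z W - a (tau X Y) Z W.
Local Notation q := curvature_defect.

(** This is the curvature of $\nabla-A$. Writing the bracket with [nb] and its torsion is the source
    of the last term of [q]. *)
Lemma rm_chern X Y Z W : R X Y Z W =
  rm br g nb X Y Z W + q X Y Z W + g (A X (A Y Z)) W - g (A Y (A X Z)) W.
Proof.
have DE u v : Dc u v = nb u v - A u v by rewrite /A; vring.
have brE : br X Y = nb X Y - nb Y X - tau X Y by rewrite /torsion_of; vring.
have AD u v w : A (u + v) w = A u w + A v w.
  by have := A_lin1 1 u v w; rewrite !scale1r.
have AN u w : A (- u) w = - A u w.
  have := A_lin1 (-1) u 0 w; rewrite !scaleN1r addr0 => ->.
  have := A_lin1 0 0 0 w; rewrite !scale0r !add0r => H.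
  by have := A_lin1 1 0 0 w; rewrite !scale1r addr0 -{1}[A 0 w]addr0 => /addrI <-; rewrite addr0.
have AD2 u v w : A w (u - v) = A w u - A w v.
  by have := A_lin2 (-1) v u w; rewrite !scaleN1r addrC => ->; rewrite addrC.
rewrite /rm /curvature_of !DE brE /q /nab3 /a.
move: (tau X Y) A {DE brE} AD AN AD2 => t A' AD AN AD2.
by rewrite !(connR LR nbP) !(AD, AN, AD2) !(conn_metric nbP) !gE; ring.
Qed.
End almost_kahler_identities.

(** * Traces of the curvatures and of the torsion *)

Section ricci_identities.
Variables (F : comPzRingType) (V : lmodType F).
Variables (act : V -> F -> F) (br : V -> V -> V).
Variables (g : V -> V -> F) (m : nat) (e : 'I_m -> V) (gi : 'I_m -> 'I_m -> F).
Variables (J : V -> V) (nb Dc : V -> V -> V).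
Hypothesis AK : ak_structure act br g e gi J nb Dc.
Let LR := ak_lie_rinehart AK.
Let GR := ak_riemannian AK.
Let two_inj := ak_two_inj AK.
Let nbP := chern_conn AK.
Let DcP := lc_conn AK.
Local Notation tr := (metric_tr e gi).
Local Notation nab3 := (cov3 act).
Local Notation tau := (torsion_of br nb).
Local Notation R := (rm br g Dc).
Local Notation T := (torsion3 br g nb).
Local Notation A := (contorsion nb Dc).
Local Notation q := (curvature_defect act br g nb Dc).
Local Notation a := (contorsion3 g nb Dc).
Local Notation gE := (gE GR).
Local Notation TE := (TE AK).

Definition cov_torsion3 := nab3 nb T.
Local Notation nT := cov_torsion3.

Lemma nT_lin : lin4 nT.
Proof. exact: (nab3_lin LR nbP (T_lin AK)). Qed.

Lemma nT_lin1 c u v x y z : nT (c *: u + v) x y z = c * nT u x y z + nT v x y z.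
Proof. by rewrite (nT_lin.1 x y z). Qed.
Lemma nT_lin2 c u v w y z : nT w (c *: u + v) y z = c * nT w u y z + nT w v y z.
Proof. by rewrite ((nT_lin.2 w).1 y z). Qed.
Lemma nT_lin3 c u v w x z : nT w x (c *: u + v) z = c * nT w x u z + nT w x v z.
Proof. by rewrite (((nT_lin.2 w).2 x).1 z). Qed.
Lemma nT_lin4 c u v w x y : nT w x y (c *: u + v) = c * nT w x y u + nT w x y v.
Proof. by rewrite (((nT_lin.2 w).2 x).2 y). Qed.
Definition nTE := (nT_lin1, nT_lin2, nT_lin3, nT_lin4).

Lemma nTN4 w x y u : nT w x y (- u) = - nT w x y u.
Proof. exact: (linN (((nT_lin.2 w).2 x).2 y)). Qed.

(** As [J] is parallel for [nb], the derivative of the torsion inherits its type. *)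
Lemma nT12 W X Y Z : nT W (J X) Y Z = nT W X (J Y) Z.
Proof. by rewrite /nT /cov3 !(chern_acs AK) !(T12 AK). Qed.

Lemma nT23 W X Y Z : nT W X (J Y) Z = nT W X Y (J Z).
Proof. by rewrite /nT /cov3 !(chern_acs AK) !(T23 AK). Qed.

Lemma nT13 W X Y Z : nT W (J X) Y Z = nT W X Y (J Z).
Proof. by rewrite nT12 nT23. Qed.

Lemma nTC W X Y Z : nT W X Y Z = - nT W Y X Z.
Proof.
rewrite /nT /cov3 (TC AK X Y Z) (TC AK (nb W X)) (TC AK X (nb W Y)).
by rewrite (TC AK X Y (nb W Z)) (actN LR); ring.
Qed.

Definition div_torsion3 Y Z := tr (fun s t => nT s t Y Z).
Local Notation divT := div_torsion3.

Lemma divT_lin : lin2 divT.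
Proof.
split=> *; move=> c u v; rewrite /divT -trZ -trD; apply: eq_tr => s t;
  by rewrite nTE.
Qed.

Lemma divTJ Y Z : divT (J Y) Z = divT Y (J Z).
Proof. by apply: eq_tr => s t; rewrite nT23. Qed.

Lemma divTJ2 Y Z : divT (J Y) (J Z) = - divT Y Z.
Proof. by rewrite divTJ (acsK AK) (linN (divT_lin.2 Y)). Qed.

(** The numeral is the slot of the torsion left free in both factors; the other two slots are
    contracted. *)
Definition torsion_sq1 X Y :=
  tr (fun s t => tr (fun k l => T X s k * T Y t l)).
Local Notation gam := torsion_sq1.
Definition torsion_sq3 X Y :=
  tr (fun s t => tr (fun k l => T s k X * T t l Y)).
Local Notation bet := torsion_sq3.
(** This is $B=\frac14B^1-\frac12B^2$, because $B^1$ is 4 [bet] and $B^2$ is 4 [gam]; see [B1_frame]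
    and [B2_frame]. *)
Definition B_tensor X Y := bet X Y - 2 * gam X Y.
Local Notation Btens := B_tensor.

Lemma gamC X Y : gam X Y = gam Y X.
Proof.
rewrite /gam -(tr_swap GR); apply: eq_tr => s t.
by rewrite -(tr_swap GR); apply: eq_tr => k l; rewrite mulrC.
Qed.

Lemma betC X Y : bet X Y = bet Y X.
Proof.
rewrite /bet -(tr_swap GR); apply: eq_tr => s t.
by rewrite -(tr_swap GR); apply: eq_tr => k l; rewrite mulrC.
Qed.

Lemma gam_lin : lin2 gam.
Proof.
split=> *; move=> c u v; rewrite /gam -trZ -trD; apply: eq_tr => s t;
  by rewrite -trZ -trD; apply: eq_tr => k l; rewrite TE; ring.
Qed.

Lemma bet_lin : lin2 bet.
Proof.
split=> *; move=> c u v; rewrite /bet -trZ -trD; apply: eq_tr => s t;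
  by rewrite -trZ -trD; apply: eq_tr => k l; rewrite TE; ring.
Qed.

Lemma gamJ X Y : gam (J X) (J Y) = gam X Y.
Proof.
rewrite /gam -[RHS](tr_acs2 AK).
  by apply: eq_tr => s t; apply: eq_tr => k l; rewrite !(T12 AK).
split=> *; move=> c u v; rewrite -trZ -trD; apply: eq_tr => k l;
  by rewrite TE; ring.
Qed.

Lemma betJ X Y : bet (J X) (J Y) = bet X Y.
Proof.
rewrite /bet -[RHS](tr_acs2 AK).
  by apply: eq_tr => s t; apply: eq_tr => k l; rewrite !(T13 AK).
split=> *; move=> c u v; rewrite -trZ -trD; apply: eq_tr => k l;
  by rewrite TE; ring.
Qed.

Lemma Btens_lin : lin2 Btens.
Proof.
have [b1 b2] := bet_lin; have [g1 g2] := gam_lin.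
by split=> *; move=> c u v; rewrite /Btens ?(b1, g1) ?(b2, g2); ring.
Qed.

Lemma BtensJ X Y : Btens (J X) (J Y) = Btens X Y.
Proof. by rewrite /Btens betJ gamJ. Qed.

Lemma BtensC X Y : Btens X Y = Btens Y X.
Proof. by rewrite /Btens betC gamC. Qed.

Lemma antisymJ (f : V -> V -> F) X Y : lin2 f ->
  (forall X Y, f (J X) (J Y) = f X Y) -> f X (J Y) = - f (J X) Y.
Proof. by move=> fP fJ; rewrite -fJ (acsK AK) (linN (fP.2 _)). Qed.

Definition torsion_normsq := tr (fun i a => tr (fun j b => tr (fun k d => T i j k * T a b d))).
Local Notation nrmT := torsion_normsq.

Lemma tr_gam : tr gam = nrmT. Proof. by []. Qed.

Lemma tr_bet : tr bet = nrmT.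
Proof.
rewrite /bet tr_exch; apply: eq_tr => i j; rewrite tr_exch; apply: eq_tr => k l.
by [].
Qed.

Lemma tr_Btens : tr Btens = - nrmT.
Proof. by rewrite /Btens trB trZ tr_gam tr_bet; ring. Qed.

Lemma qE X Y Z W : q X Y Z W = nT Y W Z X - nT X W Z Y - T W Z (tau X Y).
Proof.
have aE := aE AK.
by rewrite /curvature_defect /nT /cov3 !aE; ring.
Qed.

Lemma T_tau X Y Z W : T W Z (tau X Y) = tr (fun k l => T X Y k * T W Z l).
Proof. by rewrite -(tr_contract GR (tau X Y) (((T_lin AK).2 W).2 Z)). Qed.

Lemma q_lin12 : (forall y z w, lin (fun x => q x y z w)) *
  (forall x z w, lin (fun y => q x y z w)) *
  (forall x y w, lin (fun z => q x y z w)) *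
  (forall x y z, lin (fun w => q x y z w)).
Proof.
do !split=> *; move=> c u v; rewrite !qE !nTE ?(tau_lin AK) ?(tors_linr LR GR nbP) !TE;
  by ring.
Qed.

Lemma qJ X Y Z W : q X Y (J Z) (J W) = - q X Y Z W.
Proof.
rewrite !qE !nT12 (T12 AK) !(acsK AK) (linN (((T_lin AK).2 _).1 _)).
by rewrite !(linN (((nT_lin.2 _).2 _).1 _)); ring.
Qed.

(** In [rm_chern] the Chern curvature and the products of two contorsions commute with [J], while
    [q] anticommutes; only [q] is seen by the defect of invariance. *)
Lemma rmJ X Y Z W : R X Y (J Z) (J W) = R X Y Z W - 2 * q X Y Z W.
Proof.
rewrite !(rm_chern AK) qJ.
have -> : rm br g nb X Y (J Z) (J W) = rm br g nb X Y Z W.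
  rewrite /rm /curvature_of !(chern_acs AK) -!(acsN AK) -!(acsD AK).
  by rewrite (acs_metric AK).
have H u v w : A u (A v (J w)) = J (A u (A v w)).
  by rewrite (A_acs AK) (AN2 AK) (A_acs AK) opprK.
by rewrite !H !(acs_metric AK); ring.
Qed.

Definition ricci_of Y Z := tr (fun s t => R s Y Z t).
Local Notation Rc := ricci_of.
(** Since $\omega^{cd}=J^c_sg^{ds}$, contracting with it is taking the metric trace after inserting
    [J]. *)
Definition chern_ricci X Y := tr (fun s t => rm br g nb X Y (J s) t).
Local Notation P := chern_ricci.

Local Notation RE := (rm_lin LR GR DcP).

Lemma rm_bianchi x y z w : R x y z w + R y z x w + R z x y w = 0.
Proof.
rewrite /rm -!(metricD GR) (curv_bianchi LR GR DcP (lc_tors AK)).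
exact: (lin0 (metric_lin GR w)).
Qed.

(** The octahedron argument: a signed sum of four Bianchi identities is twice the difference of the
    two sides. *)
Lemma rm_pair X Y Z W : R X Y Z W = R Z W X Y.
Proof.
have C12 := rmC12 LR GR DcP; have C34 := rmC34 LR GR DcP.
have b1 := rm_bianchi X Y Z W; have b2 := rm_bianchi Y Z W X.
have b3 := rm_bianchi Z W X Y; have b4 := rm_bianchi W X Y Z.
rewrite (C34 Y Z) (C34 Z W) (C34 W Y) in b2.
rewrite (C12 X Z) (C34 Z X W) opprK in b3.
rewrite (C34 W X) (C34 X Y) (C12 Y W) in b4.
apply/eqP; rewrite -subr_eq0; apply/eqP; apply: two_inj.
transitivity ((R X Y Z W + R Y Z X W + R Z X Y W)
  + (- R Y Z X W - R Z W X Y - R W Y X Z)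
  - (R Z W X Y + R W X Z Y + R Z X Y W)
  - (- R W X Z Y - R X Y Z W - R W Y X Z)); first by ring.
by rewrite b1 b2 b3 b4 !subr0 addr0.
Qed.

Lemma Rc_lin : lin2 Rc.
Proof.
by split=> *; move=> c u v; rewrite /Rc -trZ -trD; apply: eq_tr => s t;
  rewrite RE.
Qed.

Lemma RcC X Y : Rc X Y = Rc Y X.
Proof.
rewrite /Rc -(tr_swap GR); apply: eq_tr => s t.
by rewrite rm_pair (rmC12 LR GR DcP) (rmC34 LR GR DcP) opprK.
Qed.

Lemma tr_anti13 (f : V -> V -> V -> F) :
  (forall y z, lin (fun x => f x y z)) -> (forall x y, lin (fun z => f x y z)) ->
  (forall x y z, f (J x) y z = f x y (J z)) ->
  forall y, tr (fun s t => f s y t) = 0.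
Proof.
move=> f1 f3 fJ y; apply: (tr_anti AK) => [|u v]; first by split.
by rewrite fJ (acsK AK) (linN (f3 _ _)).
Qed.

Lemma gam_tau X Y : tr (fun s t => T X s (tau Y t)) = gam X Y.
Proof.
by rewrite gamC /gam -(tr_swap GR); apply: eq_tr => s t; rewrite T_tau.
Qed.

(** Of the two derivative terms of [q], the one along the untraced direction [Y] is a trace of
    torsion and vanishes by type; the other is a divergence. The same holds for [tr_q']. *)
Lemma tr_q Y Z : tr (fun s t => q s Y Z t) = - divT Z Y - gam Y Z.
Proof.
have -> : tr (fun s t => q s Y Z t) = tr (fun s t => nT Y t Z s)
    - tr (fun s t => nT s t Z Y) - tr (fun s t => T t Z (tau s Y)).
  by rewrite -!trB; apply: eq_tr => s t; rewrite qE.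
have -> : tr (fun s t => nT Y t Z s) = 0.
  rewrite (tr_swap GR (fun s t => nT Y s Z t)).
  apply: (@tr_anti13 (nT Y)) => *; last by rewrite nT13.
    by move=> c u v; rewrite nTE.
  by move=> c u v; rewrite nTE.
have -> : tr (fun s t => T t Z (tau s Y)) = gam Z Y.
  rewrite -gam_tau -(tr_swap GR); apply: eq_tr => s t.
  by rewrite (TC AK) (torsC LR GR nb) (TN3 AK) opprK.
by rewrite gamC /divT; ring.
Qed.

Lemma tr_q' X Y : tr (fun s t => q Y t s X) = - divT X Y - gam Y X.
Proof.
have -> : tr (fun s t => q Y t s X) = tr (fun s t => nT t X s Y)
    - tr (fun s t => nT Y X s t) - tr (fun s t => T X s (tau Y t)).
  by rewrite -!trB; apply: eq_tr => s t; rewrite qE.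
have -> : tr (fun s t => nT Y X s t) = 0.
  apply: (tr_anti AK) => [|u v].
    by split=> *; move=> c u v; rewrite nTE.
  by rewrite nT23 (acsK AK) nTN4.
rewrite gam_tau gamC (tr_swap GR (fun s t => nT s X t Y)).
have -> : tr (fun s t => nT s X t Y) = - divT X Y.
  by rewrite -trN; apply: eq_tr => s t; rewrite nTC.
by ring.
Qed.

(** [rmJ] is applied to the last pair of arguments and, after the pair symmetry, to the other pair.
    Each application costs a trace of [q]; the [gam] parts cancel and the divergences add up. *)
Lemma Rc_antiJ X Y : Rc X Y - Rc (J X) (J Y) = - 2 * (divT X Y + divT Y X).
Proof.
have E1 : Rc (J X) (J Y) = - tr (fun s t => R s (J X) Y (J t)) +
    2 * tr (fun s t => q s (J X) Y (J t)).
  rewrite -trZ -trN -trD; apply: eq_tr => s t.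
  transitivity (- R s (J X) (J Y) (J (J t))).
    by rewrite (acsK AK) /rm (metricNr GR) opprK.
  by rewrite rmJ; ring.
have E2 : tr (fun s t => R s (J X) Y (J t)) =
    - tr (fun s t => R Y t (J s) (J X)).
  rewrite (@tr_acs _ _ _ _ _ _ _ _ _ _ _ AK (fun s t => R Y t s (J X))).
    by rewrite opprK; apply: eq_tr => s t; rewrite rm_pair.
  by split=> *; move=> c u v; rewrite RE.
have E3 : tr (fun s t => R Y t (J s) (J X)) =
    Rc X Y - 2 * tr (fun s t => q Y t s X).
  rewrite -trZ -trB; apply: eq_tr => s t.
  by rewrite rmJ rm_pair.
have E4 : tr (fun s t => q s (J X) Y (J t)) = tr (fun s t => q s (J X) (J Y) t).
  apply: eq_tr => s t; apply: oppr_inj.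
  by rewrite -qJ (acsK AK) (linN (q_lin12.2 _ _ _)).
rewrite E1 E2 E3 E4 tr_q tr_q' divTJ2 gamJ gamC; ring.
Qed.

(** In the trace of [rm_chern] with [J] inserted, [q] drops out by type and the products of
    contorsions give [bet]. The first Bianchi identity turns the Levi-Civita term into Ricci traces,
    whose [J]-defect supplies [divT] and [gam]. *)
Lemma PE X Y : P X Y = Rc Y (J X) - Rc X (J Y) - 2 * Btens (J X) Y
   + 2 * divT X (J Y) - 2 * divT Y (J X).
Proof.
have E1 : P X Y = tr (fun s t => R X Y (J s) t) - tr (fun s t => q X Y (J s) t)
   - tr (fun s t => g (A X (A Y (J s))) t) + tr (fun s t => g (A Y (A X (J s))) t).
  by rewrite -!trB -trD; apply: eq_tr => s t; rewrite (rm_chern AK); ring.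
have E2 : tr (fun s t => q X Y (J s) t) = 0.
  apply: (tr_anti AK) => [|u v]; last by rewrite qJ.
  by split=> *; move=> c u v; rewrite ?(acs_lin AK) q_lin12.
have E3 Z W : tr (fun s t => g (A Z (A W (J s))) t) = - bet (J W) Z.
  rewrite /bet tr_exch -trN; apply: eq_tr => s t.
  transitivity (- g (A Z t) (A W (J s))); first exact: (aC AK Z (A W (J s)) t).
  congr (- _); rewrite -(tr_contract GR (A W (J s)) (metric_linr GR (A Z t))).
  apply: eq_tr => k l; have aE := aE AK.
  by rewrite -!/(contorsion3 _ _ _ _ _ _) !aE (T23 AK).
have E4 Z W : tr (fun s t => R (J s) Z W t) =
    Rc Z (J W) + 2 * divT (J W) Z + 2 * gam Z (J W).
  rewrite (@tr_acs _ _ _ _ _ _ _ _ _ _ _ AK (fun s t => R s Z W t)); last first.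
    by split=> *; move=> c u v; rewrite RE.
  transitivity (Rc Z (J W) - 2 * tr (fun s t => q s Z (J W) t)); last first.
    by rewrite tr_q; ring.
  rewrite -trN -trZ -trB; apply: eq_tr => s t.
  by rewrite -rmJ (acsK AK) (linN (fun c u v => rm_lin3 LR GR DcP c u v s Z (J t))).
have E5 : tr (fun s t => R X Y (J s) t) =
    tr (fun s t => R (J s) Y X t) - tr (fun s t => R (J s) X Y t).
  rewrite -trB; apply: eq_tr => s t.
  have := rm_bianchi X Y (J s) t; rewrite (rmC12 LR GR DcP Y) => /eqP.
  by rewrite -addrA addr_eq0 => /eqP ->; ring.
rewrite E1 E2 !E3 E5 !E4 !divTJ (antisymJ X Y gam_lin gamJ) (gamC Y).
by rewrite (betC (J Y)) (antisymJ X Y bet_lin betJ) /Btens; ring.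
Qed.
End ricci_identities.

(** * Scalar curvatures, Bianchi identities and comparison of traced derivatives *)

Section scalar_curvature.
Variables (F : comPzRingType) (V : lmodType F).
Variables (act : V -> F -> F) (br : V -> V -> V).
Variables (g : V -> V -> F) (m : nat) (e : 'I_m -> V) (gi : 'I_m -> 'I_m -> F).
Variables (J : V -> V) (nb Dc : V -> V -> V).
Hypothesis AK : ak_structure act br g e gi J nb Dc.
Let LR := ak_lie_rinehart AK.
Let GR := ak_riemannian AK.
Let DcP := lc_conn AK.
Local Notation tr := (metric_tr e gi).
Local Notation nab1 := (cov1 act).
Local Notation nab2 := (cov2 act).
Local Notation nab3 := (cov3 act).
Local Notation nab4 := (cov4 act).
Local Notation R := (rm br g Dc).
Local Notation A := (contorsion nb Dc).
Local Notation gE := (gE GR).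
Local Notation TE := (TE AK).
Local Notation divT := (div_torsion3 act br g e gi nb).
Local Notation Btens := (B_tensor br g e gi nb).
Local Notation nrmT := (torsion_normsq br g e gi nb).
Local Notation Rc := (ricci_of br g e gi Dc).
Local Notation P := (chern_ricci br g e gi J nb).
Local Notation RE := (rm_lin LR GR DcP).

Definition chern_scalar_curvature := tr (fun s t => P s (J t)).
Local Notation chern_scal := chern_scalar_curvature.
Definition scalar_curvature := tr Rc.
Local Notation scal := scalar_curvature.

(** In the trace of [PE] the two divergences cancel by symmetry, and [tr_Btens] provides the norm of
    the torsion. *)
Lemma chern_scalE : chern_scal = 2 * scal + 2 * nrmT.
Proof.
rewrite -(opprK nrmT) -(tr_Btens br g e gi nb) mulrN -!trZ.
have -> : tr (fun u v => 2 * Rc u v) - tr (fun u v => 2 * Btens u v) =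
    tr (fun u v => Rc u v + Rc v u - 2 * Btens u v - 2 * divT u v + 2 * divT v u)
    - (tr (fun u v => 2 * divT v u) - tr (fun u v => 2 * divT u v)).
  by rewrite -!trB; apply: eq_tr => s t; rewrite (RcC AK t s); ring.
rewrite (tr_swap GR (fun u v => 2 * divT u v)) subrr subr0.
rewrite /chern_scal.
transitivity (tr (fun s t => Rc (J t) (J s) + Rc s t - 2 * Btens s t
    - 2 * divT s t + 2 * divT t s)).
  apply: eq_tr => s t; rewrite (PE AK) (acsK AK) (linN ((Rc_lin AK).2 _)).
  by rewrite (linN ((divT_lin AK).2 _)) (BtensJ AK) (divTJ2 AK); ring.
rewrite !trD; congr (_ + _ + _ + _); rewrite addrC; congr (_ + _).
rewrite (tr_swap GR (fun u v => Rc u v)) -(tr_swap GR (fun u v => Rc (J v) (J u))).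
exact: (tr_acs2 AK (Rc_lin AK)).
Qed.

Section trace_derivative.
Variable N : V -> V -> V.
Hypothesis NP : is_conn act g N.

Lemma nab1_tr (f : V -> V -> V -> F) X Y : (forall y, lin2 (fun s t => f s t y)) ->
  nab1 N (fun y => tr (fun s t => f s t y)) X Y = tr (fun s t => nab3 N f X s t Y).
Proof.
move=> fP; rewrite /cov1 (tr_deriv LR GR NP _ (fP Y)) -trB.
by apply: eq_tr => s t.
Qed.

Lemma nab2_tr (f : V -> V -> V -> V -> F) X Y Z :
  (forall y z, lin2 (fun s t => f s t y z)) ->
  nab2 N (fun y z => tr (fun s t => f s t y z)) X Y Z =
  tr (fun s t => nab4 N f X s t Y Z).
Proof.
move=> fP; rewrite /cov2 (tr_deriv LR GR NP _ (fP Y Z)) -!trB.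
by apply: eq_tr => s t.
Qed.

End trace_derivative.

Definition cov_riemann := nab4 Dc R.
Local Notation nR := cov_riemann.

Lemma nab2_Rc X Y Z : nab2 Dc Rc X Y Z = tr (fun s t => nR X s Y Z t).
Proof.
rewrite (@nab2_tr _ DcP (fun s t y z => R s y z t)).
  by apply: eq_tr => s t; rewrite /nR /cov4; ring.
by split=> *; move=> c u v; rewrite RE.
Qed.

Lemma nR_C12 E X Y Z W : nR E X Y Z W = - nR E Y X Z W.
Proof.
have C := rmC12 LR GR DcP; rewrite /nR /cov4 (C X) (C X (Dc E Y)) (C (Dc E X)).
by rewrite (actN LR) (C X Y (Dc E Z)) (C X Y Z (Dc E W)); ring.
Qed.

Lemma nR_C34 E X Y Z W : nR E X Y Z W = - nR E X Y W Z.
Proof.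
have C := rmC34 LR GR DcP; rewrite /nR /cov4 (C X Y Z W) (C X Y Z (Dc E W)).
by rewrite (actN LR) (C _ _ Z W) (C _ (Dc E Y) Z W) (C X Y (Dc E Z) W); ring.
Qed.

(** Expanding everything leaves the covariant derivative of [Z] along a cyclic sum of double
    brackets, which vanishes by the Jacobi identity: this is [H2]. *)
Lemma second_bianchi E X Y Z W :
  nR E X Y Z W + nR X Y E Z W + nR Y E X Z W = 0.
Proof.
have brE B C : br B C = Dc B C - Dc C B.
  by apply/eqP; rewrite eq_sym -subr_eq0; apply/eqP; exact: (lc_tors AK).
have H : br (br E X) Y + br (br X Y) E + br (br Y E) X = 0.
  rewrite (brC LR (br E X)) (brC LR (br X Y)) (brC LR (br Y E)) -!opprD.
  have := br_jacobi LR Y E X; rewrite -addrA addrC -addrA => H.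
  by rewrite -[RHS]oppr0 -H; congr (- _); rewrite addrCA addrA addrC addrA.
have H2 := congr1 (fun v => g (Dc v Z) W) H.
have D0 : Dc 0 Z = 0 by exact: (conn0l DcP).
rewrite /= D0 (lin0 (metric_lin GR W)) !(brE E X) !(brE X Y) !(brE Y E) in H2.
have brN u v w : br (u - v) w = br u w - br v w.
  by rewrite (brDl LR) (brNl LR).
rewrite !brN !(connR LR DcP) !gE in H2.
rewrite -[RHS]H2.
rewrite /nR /cov4 /rm !(conn_metric DcP) /curvature_of.
rewrite (brC LR X (Dc E Y)) (brC LR Y (Dc X E)) (brC LR E (Dc Y X)).
rewrite (brE E X) (brE X Y) (brE Y E).
by rewrite !(connR LR DcP) !gE; ring.
Qed.

Lemma contracted_bianchi X : 2 * tr (fun s t => nab2 Dc Rc s t X) = act X scal.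
Proof.
have nRcC E u v : nab2 Dc Rc E u v = nab2 Dc Rc E v u.
  by rewrite /cov2 !(RcC AK u) !(RcC AK _ v); ring.
have H1 : tr (fun s t => tr (fun y z => nR s X y z t)) = tr (fun s t => nab2 Dc Rc s t X).
  apply: eq_tr => s t; rewrite nRcC nab2_Rc; apply: eq_tr => y z.
  by rewrite nR_C12 nR_C34 opprK.
have H2 : tr (fun s t => tr (fun y z => nR X y s z t)) = - act X scal.
  rewrite (tr_deriv LR GR DcP _ (Rc_lin AK)) tr_exch -trN; apply: eq_tr => y z.
  by rewrite nab2_Rc -trN; apply: eq_tr => s t; rewrite nR_C12.
have H3 : tr (fun s t => tr (fun y z => nR y s X z t)) = tr (fun s t => nab2 Dc Rc s t X).
  rewrite tr_exch; apply: eq_tr => y z; rewrite nRcC nab2_Rc; exact: eq_tr.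
have : tr (fun s t => tr (fun y z => nR s X y z t)) +
   tr (fun s t => tr (fun y z => nR X y s z t)) +
   tr (fun s t => tr (fun y z => nR y s X z t)) = 0.
  rewrite -!trD; apply: tr0 => s t; rewrite -!trD; apply: tr0 => y z.
  exact: second_bianchi.
rewrite H1 H2 H3 => /eqP; rewrite addrAC subr_eq0 => /eqP <-; ring.
Qed.

(** By [aE] the contraction $g^{st}A_{e_s}e_t$ is a trace of the torsion, hence zero. So divergences
    of 1-forms, and Laplacians, are the same for both connections. *)
Lemma tr_A (f : V -> F) : lin f -> tr (fun s t => f (A s t)) = 0.
Proof.
move=> fP; transitivity (tr (fun s t => tr (fun k l => g (A s t) k * f l))).
  by apply: eq_tr => s t; rewrite (tr_contract GR).
rewrite tr_exch; apply: tr0 => k l; rewrite trZr.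
have -> : tr (fun u v => g (A u v) k) = 0; last by rewrite mul0r.
rewrite -[RHS](tr_T23 AK k) -(tr_swap GR); apply: eq_tr => s t.
exact: (aE AK).
Qed.

Lemma tr_nab1 f : lin f -> tr (nab1 nb f) = tr (nab1 Dc f).
Proof.
move=> fP; apply/eqP; rewrite -subr_eq0 -trB; apply/eqP.
rewrite -[RHS]oppr0 -(tr_A fP) -trN; apply: eq_tr => s t.
by rewrite /cov1 /contorsion (linD fP) (linN fP); ring.
Qed.

Lemma A_acs1 X Y : A (J X) Y = - J (A X Y).
Proof.
apply: (metric_inj GR) => w; rewrite (metricN GR) (acs_antisym AK) opprK.
have := aE AK; rewrite /contorsion3 => aE; rewrite !aE.
by rewrite (T13 AK).
Qed.

(** The correction in the traced slot is [tr_A]. The one in the free slot vanishes by type: [Btens]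
    is [J]-invariant and [A] is [J]-antilinear in its first argument. *)
Lemma tr_nab2_Btens Y :
  tr (fun s t => nab2 nb Btens s t Y) = tr (fun s t => nab2 Dc Btens s t Y).
Proof.
have [B1 B2] := Btens_lin AK.
apply/eqP; rewrite -subr_eq0 -trB; apply/eqP.
have H1 := tr_A (B1 Y).
have H2 : tr (fun s t => Btens t (A s Y)) = 0.
  apply: (tr_anti AK) => [|u v].
    split=> *; move=> c u v; last by rewrite B1.
    by rewrite (A_lin1 AK) B2.
  by rewrite A_acs1 (linN (B2 _)) (BtensJ AK).
rewrite -[RHS]oppr0 -[X in _ = - X]addr0 -{1}H1 -H2 -trD -trN; apply: eq_tr => s t.
rewrite /cov2 /contorsion (linD (B1 Y)) (linN (B1 Y)) (linD (B2 t)) (linN (B2 t)).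
by ring.
Qed.

End scalar_curvature.

(** * Evolution of the scalar curvatures *)

Section evolution.
Variables (F : comPzRingType) (V : lmodType F).
Variables (act : V -> F -> F) (br : V -> V -> V).
Variables (g : V -> V -> F) (m : nat) (e : 'I_m -> V) (gi : 'I_m -> 'I_m -> F).
Variables (J : V -> V) (nb Dc : V -> V -> V).
Variables (dt : F -> F) (dv : V -> V).
Hypothesis AK : ak_structure act br g e gi J nb Dc.
Let LR := ak_lie_rinehart AK.
Let GR := ak_riemannian AK.
Let two_inj := ak_two_inj AK.
Let nbP := chern_conn AK.
Let DcP := lc_conn AK.
Local Notation tr := (metric_tr e gi).
Local Notation nab1 := (cov1 act).
Local Notation nab2 := (cov2 act).
Local Notation nab3 := (cov3 act).
Local Notation nab4 := (cov4 act).
Local Notation tau := (torsion_of br nb).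
Local Notation R := (rm br g Dc).
Local Notation T := (torsion3 br g nb).
Local Notation a := (contorsion3 g nb Dc).
Local Notation gE := (gE GR).
Local Notation TE := (TE AK).
Local Notation nT := (cov_torsion3 act br g nb).
Local Notation divT := (div_torsion3 act br g e gi nb).
Local Notation gam := (torsion_sq1 br g e gi nb).
Local Notation bet := (torsion_sq3 br g e gi nb).
Local Notation Btens := (B_tensor br g e gi nb).
Local Notation nrmT := (torsion_normsq br g e gi nb).
Local Notation Rc := (ricci_of br g e gi Dc).
Local Notation P := (chern_ricci br g e gi J nb).
Local Ltac vring := apply: (metric_inj GR) => ?; rewrite !gE; ring.

Local Notation chern_scal := (chern_scalar_curvature br g e gi J nb).
Local Notation scal := (scalar_curvature br g e gi Dc).

(* dt is the time derivative of functions, dv that of the components of vector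
   fields in a time independent frame. *)
Record time_derivative : Prop := TimeDerivative {
  dtD : {morph dt : f h / f + h};
  dtM : forall f h, dt (f * h) = dt f * h + f * dt h;
  dvD : {morph dv : X Y / X + Y};
  dvZ : forall f X, dv (f *: X) = dt f *: X + f *: dv X;
  dt_act : forall X f, dt (act X f) = act (dv X) f + act X (dt f);
  dv_br : forall X Y, dv (br X Y) = br (dv X) Y + br X (dv Y) }.

(** Subtracting the terms in [dv] removes the derivatives of the coefficients: [h] is the tensor
    $\partial g/\partial t$, and [acs_dt] is $\partial J/\partial t$. *)
Definition metric_dt X Y := dt (g X Y) - g (dv X) Y - g X (dv Y).
Definition acs_dt X := dv (J X) - J (dv X).

Hypothesis DT : time_derivative.
Hypothesis flow_omega : forall X Y,
  dt (g (J X) Y) - g (J (dv X)) Y - g (J X) (dv Y) = - P X Y.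
(** The equation for [J] with its index lowered, doubled to clear the $\frac12$ of the
    anti-invariant parts. *)
Hypothesis flow_acs : forall X Y, 2 * g (acs_dt X) Y =
  - (P X Y - P (J X) (J Y)) + 2 * (Rc (J X) Y - Rc (J (J X)) (J Y)).
Local Notation h := metric_dt.
Local Notation K := acs_dt.

Lemma dv0 : dv 0 = 0.
Proof. by apply: (addrI (dv 0)); rewrite -(dvD DT) !addr0. Qed.
Lemma dvN X : dv (- X) = - dv X.
Proof. by apply: (addrI (dv X)); rewrite -(dvD DT) !subrr dv0. Qed.
Lemma dt0 : dt 0 = 0.
Proof. by apply: (addrI (dt 0)); rewrite -(dtD DT) !addr0. Qed.
Lemma dt1 : dt 1 = 0.
Proof.
by apply: (addrI (dt 1)); rewrite addr0 -{3}[1]mulr1 (dtM DT) mulr1 mul1r.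
Qed.
Lemma dt_nat n : dt n%:R = 0.
Proof.
by elim: n => [|n IH]; rewrite ?dt0 // -addn1 natrD (dtD DT) IH dt1 addr0.
Qed.
Lemma dt_sum (I : finType) (f : I -> F) : dt (\sum_i f i) = \sum_i dt (f i).
Proof. by apply: big_morph; [exact: dtD | exact: dt0]. Qed.
Lemma dvE f X Y : dv (f *: X + Y) = dt f *: X + f *: dv X + dv Y.
Proof. by rewrite (dvD DT) (dvZ DT). Qed.

Lemma metric_dt_lin : lin2 h.
Proof.
split=> *; move=> c u v; rewrite /metric_dt dvE !gE !(dtD DT) (dtM DT); ring.
Qed.

Lemma metric_dtC X Y : h X Y = h Y X.
Proof.
by rewrite /metric_dt (metricC GR X) (metricC GR (dv X)) (metricC GR X); ring.
Qed.

Lemma double_inj : injective (fun x : F => 2 * x).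
Proof.
move=> x y /= /eqP; rewrite -subr_eq0 -mulrBr => /eqP H.
by apply/eqP; rewrite -subr_eq0; apply/eqP; apply: two_inj; rewrite -H; ring.
Qed.

Lemma P_antiJ X Y : P X Y - P (J X) (J Y) = 4 * divT X (J Y) - 4 * divT Y (J X).
Proof.
have N2 := fun u => linN ((Rc_lin AK).2 u).
have D2 := fun u => linN ((divT_lin AK).2 u).
rewrite !(PE AK) !(acsK AK) !(linN ((Rc_lin AK).2 _)) !(linN ((divT_lin AK).2 _)).
rewrite (linN ((Btens_lin AK).1 _)) (RcC AK (J Y)) (RcC AK (J X)).
rewrite (antisymJ AK X Y (Btens_lin AK) (BtensJ AK)) !(divTJ AK).
by ring.
Qed.

Lemma acs_dtE X Y : g (K X) Y = - 4 * divT X (J Y).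
Proof.
apply: double_inj => /=; rewrite flow_acs P_antiJ (Rc_antiJ AK) (divTJ AK).
by ring.
Qed.

(** Differentiating $\omega=g(J\cdot,\cdot)$ gives $h(JU,W)=-P(U,W)-g(KU,W)$, and every vector has
    the form [J U]. The divergences in [P] and [K] cancel through [Rc_antiJ]. *)
Lemma metric_dtE X Y : h X Y = - 2 * Rc X Y + 2 * Btens X Y.
Proof.
have flow U W : h (J U) W = - P U W - g (K U) W.
  by rewrite -flow_omega /metric_dt /acs_dt !gE; ring.
suff H U : h (J U) Y = - 2 * Rc (J U) Y + 2 * Btens (J U) Y.
  have := H (- J X); rewrite (acsN AK) (acsK AK) opprK; exact.
have RJ := Rc_antiJ AK (J U) Y.
rewrite (acsK AK) (linN ((Rc_lin AK).1 _)) opprK in RJ.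
apply: double_inj => /=.
rewrite flow mulrBr flow_acs P_antiJ (acsK AK) (linN ((Rc_lin AK).1 _)) opprK RJ.
rewrite (PE AK) (RcC AK Y) -[Rc U (J Y)](addKr (Rc (J U) Y)) RJ.
by ring.
Qed.

(** The indices are paired crosswise, as they come out of the derivative of a trace; this is the
    tensor inner product as soon as one of the two forms is symmetric. *)
Definition ip (f1 f2 : V -> V -> F) :=
  tr (fun u v => tr (fun k l => f1 u l * f2 k v)).

Lemma eq_ip f1 f2 f3 : (forall u v, f1 u v = f3 u v) -> ip f1 f2 = ip f3 f2.
Proof. by move=> H; apply: eq_tr => u v; apply: eq_tr => k l; rewrite H. Qed.

Lemma ipZl c f1 f : ip (fun u v => c * f1 u v) f = c * ip f1 f.
Proof.
by rewrite /ip -trZ; apply: eq_tr => u v; rewrite -trZ; apply: eq_tr => k l;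
  rewrite mulrA.
Qed.

Lemma ipBr f1 f2 f : ip f (fun u v => f1 u v - f2 u v) = ip f f1 - ip f f2.
Proof.
by rewrite /ip -trB; apply: eq_tr => u v; rewrite -trB; apply: eq_tr => k l;
  rewrite mulrBr.
Qed.

Lemma ipZr c f1 f : ip f (fun u v => c * f1 u v) = c * ip f f1.
Proof.
by rewrite /ip -trZ; apply: eq_tr => u v; rewrite -trZ; apply: eq_tr => k l;
  rewrite mulrCA.
Qed.

Lemma ip_dual f1 f2 : lin2 f1 -> lin2 f2 -> ip f1 f2 =
  \sum_i \sum_k f1 (e i) (dual e gi k) * f2 (e k) (dual e gi i).
Proof.
move=> [f1l f1r] [f2l f2r]; rewrite /ip trE.
  apply: eq_bigr => i _; rewrite trE //.
  by split=> *; move=> c u v; rewrite ?f1r ?f2l; ring.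
by split=> *; move=> c u v; rewrite -trZ -trD; apply: eq_tr => k l;
  rewrite ?f1l ?f2r; ring.
Qed.

(** The correction is the variation of the inverse metric: differentiating the constants
    $g(e_i,e^j)$ in time expresses the variation of the dual frame by [- h]. *)
Lemma dt_tr f : lin2 f ->
  dt (tr f) = tr (fun u v => dt (f u v) - f (dv u) v - f u (dv v)) - ip h f.
Proof.
move=> fP; have [f1 f2] := fP; have hP := metric_dt_lin.
rewrite ip_dual // !trE //; last first.
  split=> *; move=> c u v; rewrite dvE ?(f1, f2) -!addrA ?(f1, f2).
    by rewrite (dtD DT) (dtM DT); ring.
  by rewrite (dtD DT) (dtM DT); ring.
rewrite dt_sum -sumrB.
suff: \sum_i (f (dv (e i)) (dual e gi i) + f (e i) (dv (dual e gi i))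
   + \sum_k h (e i) (dual e gi k) * f (e k) (dual e gi i)) = 0.
  move=> H; apply/eqP; rewrite -subr_eq0 -sumrB; apply/eqP; rewrite -[RHS]H.
  by apply: eq_bigr => i _; ring.
rewrite !big_split /=.
under eq_bigr => i _ do rewrite [dv _](dual_dec GR) (lin_sum (f1 _)).
under [X in _ + X + _]eq_bigr => i _ do
  rewrite [dv _](frame_dual GR) (lin_sum (f2 _)).
rewrite [X in _ + X + _]exchange_big -!big_split big1 //= => i _.
rewrite -!big_split big1 //= => j _.
have := dt_nat (i == j); rewrite -(metric_frame_dual GR) => H.
transitivity (dt (g (e i) (dual e gi j)) * f (e j) (dual e gi i)); last first.
  by rewrite H mul0r.
by rewrite /metric_dt (metricC GR (dv (dual e gi j))); ring.
Qed.

(** The trace of an endomorphism does not depend on the metric, so the terms in [h] cancel. Hence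
    none appears in the variation of [Rc]. *)
Lemma dt_trace_endo (L : V -> V) :
  (forall c u v, L (c *: u + v) = c *: L u + L v) ->
  dt (tr (fun s t => g (L s) t)) = tr (fun s t => g (dv (L s) - L (dv s)) t).
Proof.
move=> LP; have [h1 h2] := metric_dt_lin.
have gl := metric_lin GR; have gr := metric_linr GR.
rewrite dt_tr; last by split=> *; move=> c u v; rewrite ?LP ?gl ?gr.
have -> : ip h (fun s t => g (L s) t) = tr (fun k l => h (L k) l).
  rewrite /ip tr_exch; apply: eq_tr => k l.
  by rewrite -(tr_contract GR (L k) (h1 l)) (tr_swap GR) ; apply: eq_tr => u v; rewrite mulrC.
rewrite -trB; apply: eq_tr => s t.
by rewrite /metric_dt !gE; ring.
Qed.

Section connection_dt.
Variable N : V -> V -> V.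
Hypothesis NP : is_conn act g N.

(** The variation of a connection; being a difference of connections in the limit, it is tensorial
    in both arguments. *)
Definition conn_dt X Y := dv (N X Y) - N (dv X) Y - N X (dv Y).

Lemma conn_dt_lin1 c u v Y : conn_dt (c *: u + v) Y = c *: conn_dt u Y + conn_dt v Y.
Proof.
rewrite /conn_dt dvE !(connR LR NP) dvE; vring.
Qed.

Lemma conn_dt_lin2 c u v Y : conn_dt Y (c *: u + v) = c *: conn_dt Y u + conn_dt Y v.
Proof.
rewrite /conn_dt dvE !(connR LR NP) !(dvD DT, dvZ DT) (dt_act DT); vring.
Qed.

End connection_dt.

Local Notation C := (conn_dt Dc).
Definition lc_dt X Y Z := g (C X Y) Z.

Lemma lc_dt_lin : lin3 lc_dt.
Proof.
by do !split=> *; move=> c u v; rewrite /lc_dt ?conn_dt_lin1 ?conn_dt_lin2 //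
  ?(metricE GR) // (metric_linr GR).
Qed.

Lemma lc_dtC X Y Z : lc_dt X Y Z = lc_dt Y X Z.
Proof.
have brE U W : Dc U W = Dc W U + br U W.
  by have := lc_tors AK U W; rewrite /torsion_of => H; apply/eqP; rewrite -subr_eq0 opprD addrA H.
rewrite /lc_dt /conn_dt (brE X Y) (brE (dv X)) (brE X (dv Y)).
by rewrite (dvD DT) (dv_br DT); congr (g _ _); vring.
Qed.

(** The time derivative of $Dg=0$. *)
Lemma lc_dt_metric X Y Z : nab2 Dc h X Y Z = lc_dt X Y Z + lc_dt X Z Y.
Proof.
have H := congr1 dt (conn_metric DcP X Y Z).
rewrite (dt_act DT) (dtD DT) in H.
have hE U W : dt (g U W) = h U W + g (dv U) W + g U (dv W).
  by rewrite /metric_dt; ring.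
move: H; rewrite !hE (actD LR _ (h Y Z + _)) (actD LR _ (h Y Z)).
rewrite !(conn_metric DcP) => H.
rewrite /lc_dt (metricC GR (C X Z)) /conn_dt !gE /cov2.
apply/eqP; rewrite -subr_eq0; apply/eqP; move/eqP: H; rewrite -subr_eq0 => /eqP H.
by rewrite -[RHS]H; ring.
Qed.

Lemma palatini X Y Z W :
  g (dv (curvature_of br Dc X Y Z) - curvature_of br Dc (dv X) Y Z - curvature_of br Dc X (dv Y) Z
     - curvature_of br Dc X Y (dv Z)) W = nab3 Dc lc_dt X Y Z W - nab3 Dc lc_dt Y X Z W.
Proof.
have brE U W' : br U W' = Dc U W' - Dc W' U.
  by apply/eqP; rewrite eq_sym -subr_eq0; apply/eqP; exact: (lc_tors AK).
have C1 U u v : C (u - v) U = C u U - C v U.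
  have := conn_dt_lin1 DcP (-1) v u U; rewrite !scaleN1r addrC => ->.
  by rewrite addrC.
have dvc U W' : dv (Dc U W') = C U W' + Dc (dv U) W' + Dc U (dv W').
  by rewrite /conn_dt; vring.
rewrite /curvature_of !(dvD DT) !dvN !dvc (dv_br DT) !(brE X Y) C1 /cov3 /lc_dt.
move: (conn_dt Dc) {C1 dvc} => C'.
rewrite !(conn_metric DcP) !(connR LR DcP) !gE; ring.
Qed.

Lemma dt_Rc Y Z : dt (Rc Y Z) - Rc (dv Y) Z - Rc Y (dv Z) =
  tr (fun s t => nab3 Dc lc_dt s Y Z t - nab3 Dc lc_dt Y s Z t).
Proof.
rewrite /ricci_of /rm (dt_trace_endo (L := fun s => curvature_of br Dc s Y Z)); last first.
  by move=> c u v; rewrite (curv_lin1 LR GR DcP).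
rewrite -!trB; apply: eq_tr => s t; rewrite -palatini; move: (curvature_of br Dc) => c.
by rewrite !gE; ring.
Qed.

Definition div_dt X := tr (fun s t => nab2 Dc h s t X).

Lemma dt_scal : dt scal =
  tr (nab1 Dc (fun X => div_dt X - act X (tr h))) - ip h Rc.
Proof.
have [c1 c23] := lc_dt_lin; have c2 x := (c23 x).1; have c3 x := (c23 x).2.
have hP := metric_dt_lin.
rewrite dt_tr; last exact: (Rc_lin AK).
congr (_ - _).
(* The two traces of the variation of the connection. By symmetry and [lc_dt_metric], [w2] is half
   of $d\,\mathrm{tr}\,h$ and [w1 + w2] is the divergence of [h]. *)
pose w1 Z := tr (fun s t => lc_dt s t Z); pose w2 Z := tr (fun s t => lc_dt s Z t).
have w2E Z : 2 * w2 Z = act Z (tr h).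
  rewrite (tr_deriv LR GR DcP _ hP) -trZ.
  transitivity (tr (fun s t => lc_dt Z s t) + tr (fun s t => lc_dt Z t s)).
    rewrite (tr_swap GR (lc_dt Z)) -trD; apply: eq_tr => s t.
    by rewrite lc_dtC; ring.
  by rewrite -trD; apply: eq_tr => s t; rewrite lc_dt_metric.
have w1E Z : 2 * w1 Z = 2 * div_dt Z - act Z (tr h).
  have -> : div_dt Z = tr (fun s t => lc_dt s t Z) + tr (fun s t => lc_dt s Z t).
    by rewrite -trD; apply: eq_tr => s t; rewrite lc_dt_metric.
  by rewrite -w2E /w1 /w2; ring.
have wE Z : div_dt Z - act Z (tr h) = w1 Z - w2 Z.
  by apply: double_inj => /=; rewrite [RHS]mulrBr w1E w2E; ring.
have -> : tr (nab1 Dc (fun X => div_dt X - act X (tr h))) =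
   tr (nab1 Dc w1) - tr (nab1 Dc w2).
  by rewrite -trB; apply: eq_tr => s t; rewrite /cov1 !wE (actB LR); ring.
have -> : tr (nab1 Dc w1) = tr (fun s t => tr (fun k l => nab3 Dc lc_dt s k l t)).
  apply: eq_tr => s t; rewrite /w1 (nab1_tr AK DcP (f := lc_dt)) //.
have -> : tr (nab1 Dc w2) = tr (fun s t => tr (fun k l => nab3 Dc lc_dt s k t l)).
  apply: eq_tr => s t; rewrite /w2.
  rewrite (nab1_tr AK DcP (f := fun k l t => lc_dt k t l)); last first.
    by move=> y; split=> *; move=> c u v; rewrite ?c1 ?c3.
  by apply: eq_tr => k l; rewrite /cov3; ring.
rewrite [X in _ = X - _]tr_exch -trB; apply: eq_tr => k l.
by rewrite dt_Rc trB.
Qed.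

Local Notation al := (conn_dt nb).
Definition tors_dt X Y := dv (tau X Y) - tau (dv X) Y - tau X (dv Y).

Lemma tors_dtE X Y : tors_dt X Y = al X Y - al Y X.
Proof.
by rewrite /tors_dt /torsion_of /conn_dt !(dvD DT) !dvN (dv_br DT); vring.
Qed.

Lemma acs_dt_tensor X Y Z :
  g (K (nb X Y) - nb X (K Y)) Z = 4 * nab2 nb divT X Y (J Z).
Proof.
rewrite (metricD GR) (metricN GR) acs_dtE.
have -> : g (nb X (K Y)) Z = act X (g (K Y) Z) - g (K Y) (nb X Z).
  by rewrite (conn_metric nbP); ring.
rewrite !acs_dtE /cov2 (chern_acs AK) (actM LR) (actN LR) (act_nat LR).
by ring.
Qed.

(** Differentiate [nb X (J Y) = J (nb X Y)] in time. The commutator of [al X] with [J] is thus a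
    derivative of [K], that is, of [divT]. *)
Lemma conn_dt_acs X Y : al X (J Y) = J (al X Y) + (K (nb X Y) - nb X (K Y)).
Proof.
have dvJ U : dv (J U) = K U + J (dv U) by rewrite /acs_dt; vring.
rewrite /conn_dt !(acsD AK) !(acsN AK) !(chern_acs AK) !dvJ (connD nbP) (chern_acs AK).
by move: K => K'; vring.
Qed.

Lemma tau_acs X Y : tau X (J Y) = - J (tau X Y).
Proof.
apply: (metric_inj GR) => w; rewrite (metricN GR) (acs_antisym AK) opprK.
exact: (T23 AK).
Qed.

Lemma gamE X Y : gam X Y = tr (fun j b => g (tau X j) (tau Y b)).
Proof.
apply: eq_tr => j b; rewrite (metricC GR).
by rewrite -(tr_contract GR (tau X j) (metric_linr GR (tau Y b))).
Qed.

Definition divT_tau :=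
  tr (fun i a => tr (fun j b => nab2 nb divT i j (tau a b))).

(** Applying [J] to the traced arguments [j], [b] uses that [tau a] anticommutes with [J]: the part
    of [al] commuting with [J] drops out, and [S = - S + 4 * divT_tau] results from
    [conn_dt_acs]. *)
Lemma tr_tors_dt :
  tr (fun i a => tr (fun j b => g (tors_dt i j) (tau a b))) = 4 * divT_tau.
Proof.
have alE := conn_dt_lin2 nbP; have tauE := tors_linr LR GR nbP.
pose S := tr (fun i a => tr (fun j b => g (al i j) (tau a b))).
have S1 : tr (fun i a => tr (fun j b => g (al j i) (tau a b))) = - S.
  rewrite tr_exch -trN; apply: eq_tr => j b; rewrite -trN; apply: eq_tr => i a.
  by rewrite (torsC LR GR nb) (metricNr GR).
transitivity (S + S).
  rewrite -{2}[S]opprK -S1 -trB; apply: eq_tr => i a; rewrite -trB.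
  by apply: eq_tr => j b; rewrite tors_dtE; move: al => al'; rewrite !gE.
have S2 : S = - S + 4 * divT_tau.
  rewrite {1}/S -trN -trZ -trD; apply: eq_tr => i a; rewrite -trN -trZ -trD.
  rewrite -(tr_acs2 AK).
    apply: eq_tr => j b; rewrite conn_dt_acs tau_acs (metricNr GR) -(acs_antisym AK).
    rewrite (acsD AK) (acsK AK) (metricD GR) (metricN GR); congr (_ + _).
    rewrite (acs_antisym AK) acs_dt_tensor (acsK AK).
    by rewrite (linN (((nab2_lin LR nbP (divT_lin AK)).2 _).2 _)) mulrN opprK.
  split=> *; move=> c u v.
    by rewrite alE (metricE GR).
  by rewrite tauE (metric_linr GR).
by rewrite {1}S2; ring.
Qed.

(** The norm is $g(\tau_{ij},\tau_{ab})$ contracted with two inverse metrics. Each of these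
    contributes [- ip h gam] and the metric contributes [ip h bet], which together make
    [ip h Btens]; the variation of the torsion gives the rest. *)
Lemma dt_nrmT : dt nrmT = ip h Btens + 8 * divT_tau.
Proof.
have tau1 := tors_linl LR GR nbP; have tau2 := tors_linr LR GR nbP.
have hP := metric_dt_lin.
pose f2 i a j b := g (tau i j) (tau a b).
have f2P i a : lin2 (f2 i a).
  by rewrite /f2; split=> *; move=> c u v; rewrite tau2; move: tau => tau';
    rewrite !gE.
have f2P' j b : lin2 (fun i a => f2 i a j b).
  by rewrite /f2; split=> *; move=> c u v; rewrite tau1; move: tau => tau';
    rewrite !gE.
have -> : nrmT = tr gam by [].
rewrite dt_tr; last exact: (gam_lin AK).
have E1 i a : dt (gam i a) = tr (fun j b => dt (f2 i a j b) - f2 i a (dv j) b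
    - f2 i a j (dv b)) - ip h (f2 i a).
  by rewrite gamE -dt_tr.
have E2 : tr (fun i a => dt (gam i a) - gam (dv i) a - gam i (dv a)) =
   tr (fun i a => tr (fun j b => dt (f2 i a j b) - f2 i a (dv j) b
    - f2 i a j (dv b) - f2 (dv i) a j b - f2 i (dv a) j b)) - 
   tr (fun i a => ip h (f2 i a)).
  rewrite -trB; apply: eq_tr => i a; rewrite E1 !gamE.
  transitivity (tr (fun j b => dt (f2 i a j b) - f2 i a (dv j) b - f2 i a j (dv b))
     - tr (f2 (dv i) a) - tr (f2 i (dv a)) - ip h (f2 i a)); first by ring.
  by rewrite -!trB.
have E3 : tr (fun i a => ip h (f2 i a)) = ip h gam.
  rewrite /ip tr_exch; apply: eq_tr => u v; rewrite tr_exch; apply: eq_tr => k l.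
  rewrite trZ gamE; congr (_ * _); apply: eq_tr => i a.
  by rewrite /f2 (torsC LR GR nb k) (torsC LR GR nb v) (metricNr GR) (metricN GR) opprK.
have E4 : tr (fun i a => tr (fun j b => h (tau i j) (tau a b))) = ip h bet.
  have hE x y : h x y = tr (fun u v => tr (fun p q => h u q * (g x p * g y v))).
    transitivity (tr (fun u v => g y v * h u x)).
      by rewrite (tr_swap GR (fun v u => g y v * h u x)) (tr_contract GR y (hP.1 x)) metric_dtC.
    apply: eq_tr => u v; rewrite -(tr_contract GR x (hP.2 u)) -trZ.
    by apply: eq_tr => p q; ring.
  transitivity (tr (fun u v => tr (fun p q => h u q *
    tr (fun i a => tr (fun j b => T i j p * T a b v))))); last by [].
  transitivity (tr (fun i a => tr (fun u v => tr (fun p q =>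
      tr (fun j b => h u q * (T i j p * T a b v)))))).
    apply: eq_tr => i a.
    transitivity (tr (fun j b => tr (fun u v => tr (fun p q => h u q * (T i j p * T a b v))))).
      by apply: eq_tr => j b; rewrite hE.
    by rewrite tr_exch; apply: eq_tr => u v; rewrite tr_exch.
  rewrite tr_exch; apply: eq_tr => u v; rewrite tr_exch; apply: eq_tr => p q.
  by rewrite -trZ; apply: eq_tr => i a; rewrite -trZ.
have E5 : tr (fun i a => tr (fun j b => dt (f2 i a j b) - f2 i a (dv j) b
    - f2 i a j (dv b) - f2 (dv i) a j b - f2 i (dv a) j b)) =
   ip h bet + 8 * divT_tau.
  (* The two factors [tau] contribute equally, [tr_swap] on both traced pairs exchanging them; so 8
     is twice the 4 of [tr_tors_dt]. *)
  have -> : 8 * divT_tau = tr (fun i a => tr (fun j b => g (tors_dt i j) (tau a b)))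
     + tr (fun i a => tr (fun j b => g (tors_dt i j) (tau a b))).
    by rewrite tr_tors_dt; ring.
  rewrite -{2}(tr_swap GR (fun i a => tr (fun j b => g (tors_dt i j) (tau a b)))).
  rewrite -E4 -!trD; apply: eq_tr => i a.
  rewrite -(tr_swap GR (fun j b => g (tors_dt a j) (tau i b))) -!trD.
  apply: eq_tr => j b; rewrite /f2 (metricC GR (tors_dt a b)) /tors_dt /metric_dt.
  by move: tau => tau'; rewrite !gE; ring.
by rewrite E2 E3 E5 /B_tensor ipBr ipZr; ring.
Qed.

Definition lap f := tr (nab1 nb (act^~ f)).
Definition einst X Y := Rc X Y - Btens X Y.

Lemma divT_tauE : divT_tau =
  tr (fun a p => tr (fun r s => tr (fun b q => tr (fun c d =>
    nab4 nb nT a r s b c * T p q d)))).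
Proof.
apply: eq_tr => a p.
transitivity (tr (fun b q => tr (fun c d => nab2 nb divT a b c * T p q d))).
  apply: eq_tr => b q.
  rewrite -(tr_contract GR (tau p q) (((nab2_lin LR nbP (divT_lin AK)).2 _).2 _)).
  by rewrite -(tr_swap GR); apply: eq_tr => c d; rewrite mulrC.
transitivity (tr (fun b q => tr (fun c d => tr (fun r s =>
    nab4 nb nT a r s b c * T p q d)))).
  apply: eq_tr => b q; apply: eq_tr => c d.
  rewrite (nab2_tr AK nbP (f := nT)) ?trZr // => y z.
  by split=> *; move=> ? u v; rewrite (nTE AK).
rewrite [RHS]tr_exch; apply: eq_tr => b q; rewrite [RHS]tr_exch.
exact: eq_tr.
Qed.

(** Both divergences change connection without correction, the outer one by [tr_nab1], the inner one
    by [tr_nab2_Btens]. *)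
Lemma div_div_Btens :
  tr (nab1 Dc (fun Y => tr (fun s t => nab2 Dc Btens s t Y))) =
  tr (fun j q => tr (fun i p => nab3 nb (nab2 nb Btens) j i p q)).
Proof.
have BP := nab2_lin LR nbP (Btens_lin AK).
transitivity (tr (nab1 nb (fun Y => tr (fun s t => nab2 nb Btens s t Y)))).
  rewrite (tr_nab1 AK); last first.
    move=> c u v; rewrite -trZ -trD; apply: eq_tr => s t.
    by rewrite ((BP.2 s).2 t).
  by apply: eq_tr => s t; rewrite /cov1 !(tr_nab2_Btens AK).
apply: eq_tr => j q; rewrite (nab1_tr AK nbP (f := nab2 nb Btens)) // => y.
by split=> *; move=> c u v; rewrite ?(BP.1) ?((BP.2 _).1).
Qed.

Lemma chern_scal_evolution : dt chern_scal - lap chern_scal =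
  4 * ip einst einst + 2 * lap nrmT
  + 4 * tr (fun j q => tr (fun i p => nab3 nb (nab2 nb Btens) j i p q))
  + 16 * tr (fun a p => tr (fun r s => tr (fun b q => tr (fun c d =>
    nab4 nb nT a r s b c * T p q d)))).
Proof.
rewrite -div_div_Btens -divT_tauE.
have actl f : lin (act^~ f) := actE LR f.
have hE := metric_dtE.
have ipE f : ip h f = - 2 * ip einst f.
  by rewrite -ipZl; apply: eq_ip => u v; rewrite hE /einst; ring.
have trh : tr h = - chern_scal.
  rewrite (chern_scalE AK).
  transitivity (- 2 * tr Rc + 2 * tr Btens).
    by rewrite -!trZ -trD; apply: eq_tr => u v; rewrite hE.
  by rewrite tr_Btens /scalar_curvature; ring.
have divh X : div_dt X = - act X scal + 2 * tr (fun s t => nab2 Dc Btens s t X).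
  rewrite -(contracted_bianchi AK) -mulNr -!trZ -trD; apply: eq_tr => s t.
  rewrite /cov2 !hE (actD LR) !(actM LR) !(act_nat LR, actN LR); ring.
have lapB f f' : tr (nab1 nb (fun X => act X f - 2 * act X f')) =
   lap f - 2 * lap f'.
  by rewrite /lap -trZ -trB; apply: eq_tr => s t;
    rewrite /cov1 (actB LR) (actM LR) (act_nat LR); ring.
have lapDc f : tr (nab1 Dc (act^~ f)) = lap f by rewrite /lap (tr_nab1 AK (actl f)).
have lapE : lap chern_scal = 2 * lap scal + 2 * lap nrmT.
  rewrite /lap -!trZ -trD; apply: eq_tr => s t; rewrite /cov1 (chern_scalE AK).
  by rewrite !(actD LR, actM LR, act_nat LR, act0 LR); ring.
have dts : dt scal = lap chern_scal - lap scal
   + 2 * tr (nab1 Dc (fun Y => tr (fun s t => nab2 Dc Btens s t Y))) - ip h Rc.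
  rewrite dt_scal; congr (_ - _); rewrite -!lapDc -trB -trZ -trD.
  apply: eq_tr => s t; rewrite /cov1 !divh trh !(actN LR, actD LR, actM LR, act_nat LR, act0 LR).
  by ring.
have -> : dt chern_scal = 2 * dt scal + 2 * dt nrmT.
  by rewrite (chern_scalE AK) (dtD DT) !(dtM DT) dt_nat; ring.
have eE : ip einst einst = ip einst Rc - ip einst Btens by exact: ipBr.
by rewrite dts dt_nrmT !ipE eE lapE; ring.
Qed.

End evolution.

(** * Components in a coordinate frame *)

Section coordinates.
Variables (F : comPzRingType) (m : nat) (d : 'I_m -> F -> F).

Record derivations : Prop := Derivations {
  derD : forall i, {morph d i : f h / f + h};
  derM : forall i f h, d i (f * h) = d i f * h + f * d i h;
  derC : forall i j f, d i (d j f) = d j (d i f) }.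

Hypothesis dP : derivations.
Local Notation V := 'rV[F]_m.

Definition cact (X : V) f := \sum_i X 0 i * d i f.
Definition cbr (X Y : V) : V := \row_k (cact X (Y 0 k) - cact Y (X 0 k)).
Definition cframe (i : 'I_m) : V := delta_mx 0 i.
Local Notation E := cframe.

Lemma cact_lin f : lin (cact^~ f).
Proof.
move=> a u v; rewrite /cact mulr_sumr -big_split; apply: eq_bigr => i _.
by rewrite !mxE mulrDl mulrA.
Qed.

Lemma cactD X : {morph cact X : f h / f + h}.
Proof.
by move=> f h; rewrite /cact -big_split; apply: eq_bigr => i _; rewrite (derD dP) mulrDr.
Qed.

Lemma cactM X f h : cact X (f * h) = cact X f * h + f * cact X h.
Proof.
rewrite /cact mulr_suml mulr_sumr -big_split; apply: eq_bigr => i _.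
by rewrite (derM dP) /=; ring.
Qed.

Lemma cact0 X : cact X 0 = 0.
Proof. by apply: (addrI (cact X 0)); rewrite -cactD !addr0. Qed.

Lemma cactN X f : cact X (- f) = - cact X f.
Proof. by apply: (addrI (cact X f)); rewrite -cactD !subrr cact0. Qed.

Lemma cact_sum X (I : finType) (f : I -> F) :
  cact X (\sum_i f i) = \sum_i cact X (f i).
Proof. by apply: big_morph; [exact: cactD|exact: cact0]. Qed.

(** Isolates the second order part, which is symmetric in [X] and [Y] by [derC] and so disappears
    from the commutator. *)
Lemma cact2 X Y f : cact X (cact Y f) =
  cact (\row_k cact X (Y 0 k)) f + \sum_i \sum_j X 0 i * Y 0 j * d i (d j f).
Proof.
rewrite {2}/cact cact_sum /cact -[X in _ = _ + X]exchange_big -big_split.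
apply: eq_bigr => j _ /=; rewrite -/(cact X _) cactM mxE; congr (_ + _).
by rewrite /cact mulr_sumr; apply: eq_bigr => i _; ring.
Qed.

Lemma cact_br X Y f : cact (cbr X Y) f = cact X (cact Y f) - cact Y (cact X f).
Proof.
rewrite !cact2 [X in _ - (_ + X)]exchange_big /=.
have -> : \sum_j \sum_i Y 0 i * X 0 j * d i (d j f) =
    \sum_i \sum_j X 0 i * Y 0 j * d i (d j f).
  by do 2!apply: eq_bigr => ? _; rewrite (derC dP); ring.
rewrite opprD addrACA subrr addr0 [RHS]addrC -mulN1r -cact_lin; congr cact.
by apply/rowP => k; rewrite !mxE; ring.
Qed.

Lemma coord_lie_rinehart : lie_rinehart cact cbr.
Proof.
have brC X Y : cbr X Y = - cbr Y X by apply/rowP => k; rewrite !mxE opprB.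
have brD X : {morph cbr X : Y Z / Y + Z}.
  move=> Y Z; apply/rowP => k; rewrite !mxE cactD.
  by have := cact_lin (X 0 k) 1 Y Z; rewrite scale1r mul1r => ->; ring.
split=> //.
- exact: cact_lin.
- exact: cactD.
- exact: cactM.
- exact: cact_br.
- move=> X f Y; apply/rowP => k; rewrite !mxE cactM.
  have := cact_lin ((X : V) 0 k) f Y 0; rewrite addr0 => ->.
  have -> : cact 0 ((X : V) 0 k) = 0.
    by rewrite /cact big1 // => i _; rewrite mxE mul0r.
  by ring.
- move=> X Y Z; apply/rowP => k; rewrite !mxE !cactD !cactN !cact_br; ring.
Qed.

Lemma coord_dec (X : V) : X = \sum_i X 0 i *: E i.
Proof. exact: row_sum_delta. Qed.

Lemma lin_coord (f : V -> F) (X : V) : lin f -> f X = \sum_i X 0 i * f (E i).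
Proof. by move=> fP; rewrite {1}(coord_dec X) lin_sum. Qed.

(** Tensorial identities are reduced to the coordinate frame, whose brackets vanish and on which
    multilinear forms take their components as values. *)
Lemma lin_eq0 (f : V -> F) : lin f -> (forall i, f (E i) = 0) -> forall X, f X = 0.
Proof. by move=> fP f0 X; rewrite lin_coord // big1 // => i _; rewrite f0 mulr0. Qed.

Lemma lin2_eq0 (f : V -> V -> F) : lin2 f -> (forall i j, f (E i) (E j) = 0) ->
  forall X Y, f X Y = 0.
Proof.
move=> [f1 f2] f0 X Y; apply: lin_eq0 => // j.
by apply: (lin_eq0 (f1 (E j))).
Qed.

Lemma lin3_eq0 (f : V -> V -> V -> F) : lin3 f ->
  (forall i j k, f (E i) (E j) (E k) = 0) -> forall X Y Z, f X Y Z = 0.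
Proof.
move=> [f1 f2] f0 X Y Z; apply: lin2_eq0 => // j k.
by apply: (lin_eq0 (f1 (E j) (E k))).
Qed.

Definition cbil (M : 'M[F]_m) (X Y : V) := \sum_i \sum_j X 0 i * Y 0 j * M i j.

Lemma cbil_linl M Y : lin (cbil M ^~ Y).
Proof.
move=> a u v; rewrite /cbil mulr_sumr -big_split; apply: eq_bigr => i _.
rewrite mulr_sumr -big_split; apply: eq_bigr => j _; rewrite !mxE /=; ring.
Qed.

Lemma cbil_linr M X : lin (cbil M X).
Proof.
move=> a u v; rewrite /cbil mulr_sumr -big_split; apply: eq_bigr => i _.
rewrite mulr_sumr -big_split; apply: eq_bigr => j _; rewrite !mxE /=; ring.
Qed.

Lemma cframeE i j : E i 0 j = (j == i)%:R.
Proof. by rewrite mxE eqxx. Qed.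

Lemma sum_cframe i (f : 'I_m -> F) : \sum_j E i 0 j * f j = f i.
Proof.
rewrite (bigD1 i) //= cframeE eqxx mul1r big1 ?addr0 // => j /negbTE ji.
by rewrite cframeE ji mul0r.
Qed.

Lemma cbil_frame M i j : cbil M (E i) (E j) = M i j.
Proof.
rewrite /cbil; under eq_bigr => k _ do
  (under eq_bigr => l _ do rewrite -mulrA; rewrite -mulr_sumr sum_cframe).
exact: sum_cframe.
Qed.

Lemma cbil_framel M i (Y : V) : cbil M (E i) Y = \sum_j Y 0 j * M i j.
Proof. by rewrite (lin_coord _ (cbil_linr M _)); apply: eq_bigr => j _; rewrite cbil_frame. Qed.

Lemma cbil_framer M i (X : V) : cbil M X (E i) = \sum_j X 0 j * M j i.
Proof. by rewrite (lin_coord _ (cbil_linl M _)); apply: eq_bigr => j _; rewrite cbil_frame. Qed.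

Lemma cact_frame i f : cact (E i) f = d i f.
Proof. exact: sum_cframe. Qed.

Lemma d_frame i j k : d i (E j 0 k) = 0.
Proof.
rewrite -cact_frame cframeE; case: (_ == _); last exact: cact0.
have := cactM (E i) 1 1; rewrite !mulr1 mul1r => H.
by apply: (addrI (cact (E i) 1)); rewrite -H addr0.
Qed.

Lemma cbr_frame i j : cbr (E i) (E j) = 0.
Proof. by apply/rowP => k; rewrite [LHS]mxE [RHS]mxE !cact_frame !d_frame subrr. Qed.

Definition cnab (G : 'I_m -> 'I_m -> 'I_m -> F) (X Y : V) : V :=
  \row_k (cact X (Y 0 k) + \sum_i \sum_j X 0 i * Y 0 j * G i j k).

Lemma cnab_affine G : affine_conn cact (cnab G).
Proof.
split.
- move=> a X Y Z; apply/rowP => k; rewrite !mxE cact_lin mulrDr addrACA.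
  congr (_ + _); rewrite mulr_sumr -big_split; apply: eq_bigr => i _; rewrite mulr_sumr -big_split.
  by apply: eq_bigr => j _; rewrite !mxE /=; ring.
- move=> X Y Z; apply/rowP => k; rewrite !mxE cactD addrACA.
  congr (_ + _); rewrite -big_split; apply: eq_bigr => i _; rewrite -big_split.
  by apply: eq_bigr => j _; rewrite !mxE /=; ring.
- move=> X f Y; apply/rowP => k; rewrite !mxE cactM mulrDr -addrA.
  congr (_ + (_ + _)); rewrite mulr_sumr.
  by apply: eq_bigr => i _; rewrite mulr_sumr; apply: eq_bigr => j _; rewrite !mxE /=; ring.
Qed.

Lemma cnab_frame G i (Y : V) k :
  cnab G (E i) Y 0 k = d i (Y 0 k) + \sum_j Y 0 j * G i j k.
Proof.
rewrite mxE cact_frame; congr (_ + _).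
under eq_bigr => l _ do (under eq_bigr => j _ do rewrite -mulrA; rewrite -mulr_sumr).
exact: sum_cframe.
Qed.

Lemma cnab_frame2 G i j k : cnab G (E i) (E j) 0 k = G i j k.
Proof. by rewrite cnab_frame d_frame add0r sum_cframe. Qed.

End coordinates.

(** * The almost Kähler structure given by components in a chart *)

Section coordinate_almost_kahler.
Variables (F : comPzRingType) (m : nat) (d : 'I_m -> F -> F).
Variables (g gi J : 'M[F]_m) (G L : 'I_m -> 'I_m -> 'I_m -> F).
Local Notation V := 'rV[F]_m.
Local Notation E := (@cframe F m).

Definition c_omega : 'M[F]_m := \matrix_(i, j) \sum_a J i a * g j a.

Record coord_ak : Prop := CoordAK {
  c_der : derivations d;
  c_two : forall x : F, x + x = 0 -> x = 0;
  c_sym : forall i j, g i j = g j i;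
  c_inv : gi *m g = 1%:M;
  c_acs : J *m J = - 1%:M;
  c_isom : J *m g *m J^T = g;
  c_nab_om : forall i j k,
    d i (c_omega j k) - \sum_e G i j e * c_omega e k - \sum_e G i k e * c_omega j e = 0;
  c_nab_acs : forall i j k,
    d i (J j k) - \sum_e G i j e * J e k + \sum_e G i e k * J j e = 0;
  c_tors : forall i j k, G i j k - G j i k =
    - \sum_a \sum_b J i a * J j b * (G a b k - G b a k);
  c_closed : forall i j k, d i (c_omega j k) + d j (c_omega k i) + d k (c_omega i j) = 0;
  c_lc_sym : forall i j k, L i j k - L j i k = 0;
  c_lc_metric : forall i j k,
    d i (g j k) - \sum_e L i j e * g e k - \sum_e L i k e * g j e = 0 }.

Hypothesis H : coord_ak.
Let dP := c_der H.
Local Notation act := (cact d).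
Local Notation br := (cbr d).
Local Notation gg := (cbil g).
Local Notation jop := (fun X : V => X *m J).
Let LR := coord_lie_rinehart dP.

Lemma jop_lin a u v : (a *: u + v) *m J = a *: (u *m J) + v *m J :> V.
Proof. by rewrite mulmxDl -scalemxAl. Qed.

Lemma jop_frame i k : (E i *m J) 0 k = J i k.
Proof. by rewrite mxE; exact: sum_cframe. Qed.

Lemma jop_frameE i : E i *m J = \sum_k J i k *: E k.
Proof. by rewrite [LHS]coord_dec; apply: eq_bigr => k _; rewrite jop_frame. Qed.

Lemma jopK (u : V) : u *m J *m J = - u.
Proof. by rewrite -mulmxA (c_acs H) mulmxN mulmx1. Qed.

Lemma cogC i j : gi i j = gi j i.
Proof.
suff gs : gi = gi^T by rewrite {1}gs mxE.
have gT : g^T = g by apply/matrixP => k l; rewrite mxE (c_sym H).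
have E1 : g *m gi = 1%:M by exact: mulmx1C (c_inv H).
have E2 : gi^T *m g = 1%:M by rewrite -{1}gT -trmx_mul E1 trmx1.
by rewrite -[gi^T]mulmx1 -E1 mulmxA E2 mul1mx.
Qed.

Lemma coord_riemannian : riemannian gg E (fun i j => gi i j).
Proof.
split.
- exact: cbil_linl.
- move=> x y; rewrite /cbil exchange_big; do 2!apply: eq_bigr => ? _.
  by rewrite (c_sym H) [_ * _ 0 _]mulrC.
- exact: cogC.
- move=> v; rewrite {1}[v]coord_dec; apply: eq_bigr => i _; congr (_ *: _).
  transitivity (\sum_k v 0 k * (gi *m g) i k).
    rewrite (c_inv H) (bigD1 i) //= mxE eqxx mulr1 big1 ?addr0 // => k ki.
    by rewrite mxE eq_sym (negbTE ki) mulr0.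
  under eq_bigr => k _ do rewrite mxE mulr_sumr.
  rewrite exchange_big; apply: eq_bigr => j _.
  rewrite cbil_framer mulr_sumr; apply: eq_bigr => k _.
  by rewrite (c_sym H k); ring.
- move=> i j; have := congr1 (fun A : 'M[F]_m => A i j) (c_inv H).
  rewrite !mxE => <-; apply: eq_bigr => k _; by rewrite cbil_frame.
Qed.

Let GR := coord_riemannian.

Lemma cbil_om X Y : cbil c_omega X Y = gg (X *m J) Y.
Proof.
apply/eqP; rewrite -subr_eq0; apply/eqP; move: X Y; apply: lin2_eq0 => [|i j].
  split=> *; move=> a u v; rewrite ?jop_lin ?cbil_linl ?cbil_linr;
    by rewrite ?cbil_linl ?cbil_linr; ring.
rewrite cbil_frame cbil_framer mxE; apply/eqP; rewrite subr_eq0; apply/eqP.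
by apply: eq_bigr => k _; rewrite jop_frame (c_sym H).
Qed.

Lemma jop_metric (u v : V) : gg (u *m J) (v *m J) = gg u v.
Proof.
apply/eqP; rewrite -subr_eq0; apply/eqP; move: u v; apply: lin2_eq0 => [|i j].
  by split=> *; move=> a u v; rewrite ?jop_lin !(cbil_linl, cbil_linr); ring.
have := congr1 (fun A : 'M[F]_m => A i j) (c_isom H); rewrite cbil_frame => <-.
apply/eqP; rewrite subr_eq0; apply/eqP; rewrite /cbil exchange_big mxE.
apply: eq_bigr => k _; rewrite [(J *m g) i k]mxE [J^T k j]mxE mulr_suml.
by apply: eq_bigr => l _; rewrite !jop_frame; ring.
Qed.

Lemma tors_frame N i j k : torsion_of br (cnab d N) (E i) (E j) 0 k = N i j k - N j i k.
Proof. by rewrite /torsion_of cbr_frame // subr0 mxE [X in _ + X]mxE !cnab_frame2. Qed.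

Lemma coord_lc_conn : is_conn act gg (cnab d L).
Proof.
have AP := cnab_affine dP L; split=> // X Y Z.
have BP : lin2 gg by split=> [y|x]; [exact: (cbil_linl g y)|exact: (cbil_linr g x)].
have : cov2 act (cnab d L) gg X Y Z = 0.
  move: X Y Z; apply: lin3_eq0; first exact: (nab2_lin LR AP BP).
  move=> i j k; rewrite /cov2 cbil_frame cact_frame cbil_framer cbil_framel.
  rewrite -[RHS](c_lc_metric H i j k); congr (_ - _ - _); apply: eq_bigr => e _;
    by rewrite cnab_frame2.
by rewrite /cov2 => /eqP; rewrite -addrA -opprD subr_eq0 => /eqP.
Qed.

Lemma coord_chern_acs X Y : cnab d G X (Y *m J) = cnab d G X Y *m J.
Proof.
have AP := cnab_affine dP G; apply/rowP => k.
apply/eqP; rewrite -subr_eq0; apply/eqP; move: X Y; apply: lin2_eq0.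
  split=> [Y|X] a u v; rewrite ?jop_lin ?(connE AP) ?(connl AP) ?jop_lin.
    by rewrite !mxE; ring.
  rewrite !(mulmxDl, =^~ scalemxAl) !mxE; ring.
move=> i j; rewrite jop_frameE.
rewrite cnab_frame mxE -[RHS](c_nab_acs H i j k).
rewrite -jop_frameE jop_frame -addrA [RHS]addrAC -addrA; congr (_ + (_ - _)).
  by apply: eq_bigr => l _; rewrite jop_frame mulrC.
by apply: eq_bigr => l _; rewrite cnab_frame2.
Qed.

(** The Chern connection is characterized by $\nabla\omega=0$ and $\nabla J=0$; the metric is
    parallel because $g(U,W)=-\omega(JU,W)$. *)
Lemma coord_chern_conn : is_conn act gg (cnab d G).
Proof.
have AP := cnab_affine dP G; split=> // X Y Z.
have BP : lin2 (cbil c_omega) by split=> [y|x]; [exact: (cbil_linl c_omega y)|exact: (cbil_linr c_omega x)].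
have HO U X' Y' : act U (cbil c_omega X' Y') =
    cbil c_omega (cnab d G U X') Y' + cbil c_omega X' (cnab d G U Y').
  have : cov2 act (cnab d G) (cbil c_omega) U X' Y' = 0.
    move: U X' Y'; apply: lin3_eq0; first exact: (nab2_lin LR AP BP).
    move=> i j k; rewrite /cov2 cbil_frame cact_frame cbil_framer cbil_framel.
    rewrite -[RHS](c_nab_om H i j k); congr (_ - _ - _); apply: eq_bigr => e _;
      by rewrite cnab_frame2.
  by rewrite /cov2 => /eqP; rewrite -addrA -opprD subr_eq0 => /eqP.
have gE U W : gg U W = - cbil c_omega (U *m J) W.
  by rewrite cbil_om jopK (linN (cbil_linl g W)) opprK.
by rewrite !gE cactN // HO coord_chern_acs opprD.
Qed.

Lemma coord_ak_structure :
  ak_structure act br gg E (fun i j => gi i j) jop (cnab d G) (cnab d L).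
Proof.
have AP := cnab_affine dP G.
split.
- exact: LR.
- exact: GR.
- exact: c_two H.
- exact: jop_lin.
- exact: jopK.
- exact: jop_metric.
- exact: coord_chern_conn.
- exact: coord_chern_acs.
- move=> X Y; apply/rowP => k; rewrite [RHS]mxE.
  apply/eqP; rewrite -addr_eq0; apply/eqP; move: X Y.
  have tl := tors_linl LR GR AP; have tr := tors_linr LR GR AP.
  apply: lin2_eq0.
    by split=> *; move=> a u v; rewrite ?jop_lin !(tl, tr) !mxE; ring.
  move=> i j; rewrite tors_frame (c_tors H) !jop_frameE.
  pose f u v := torsion_of br (cnab d G) u v 0 k.
  have fP : lin2 f by split=> *; move=> a u v; rewrite /f ?tl ?tr !mxE.
  rewrite -/(f _ _) (lin_sum (fP.1 _)).
  under eq_bigr => u _ do rewrite (lin_sum (fP.2 _)) mulr_sumr.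
  rewrite addrC; apply/eqP; rewrite addr_eq0; apply/eqP; congr (- _).
  do 2!apply: eq_bigr => ? _; by rewrite /f tors_frame mulrA.
- move=> X Y Z; have N := fun U => linN (cbil_linl g U).
  pose f X Y Z := act X (gg (Y *m J) Z) + act Y (gg (Z *m J) X)
    + act Z (gg (X *m J) Y) - gg (br X Y *m J) Z - gg (br Y Z *m J) X
    - gg (br Z X *m J) Y.
  (* [f] is $d\omega$ on three fields. Being cyclic, it is linear in every slot once it is in the
     first, so the frame suffices, where the bracket terms vanish. *)
  have fC U W T : f U W T = f W T U by rewrite /f; ring.
  have f1 y z : lin (fun x => f x y z).
    move=> a u v; rewrite /f.
    (* The terms with a differentiated coefficient cancel in pairs only through the skewness of the
       form. *)
    have anti : gg (z *m J) u = - gg (u *m J) z.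
      by rewrite -[gg (u *m J) z]jop_metric jopK N opprK (metricC GR).
    rewrite (cact_lin d) !jop_lin !cbil_linl !cbil_linr.
    rewrite (brDl LR) (brZl LR GR) (brD LR) (brZ LR).
    rewrite !(mulmxDl, mulNmx, =^~ scalemxAl) !(gE GR) !(actD LR, actM LR) anti.
    by ring.
  have f2 x z : lin (fun y => f x y z) by move=> a u v; rewrite (fC x) (fC x u) (fC x v) f1.
  have f3 x y : lin (f x y) by move=> a u v; rewrite -(fC (a *: u + v)) -(fC u) -(fC v) f1.
  apply: (lin3_eq0 (f := f)); first by split=> // *; split.
  move=> i j k; rewrite /f !cbr_frame // !mul0mx !(lin0 (cbil_linl g _)) !subr0.
  by rewrite -!cbil_om !cbil_frame !cact_frame; exact: (c_closed H).
- exact: coord_lc_conn.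
- move=> X Y; apply/rowP => k; rewrite [RHS]mxE.
  have AL := cnab_affine dP L; move: X Y; apply: lin2_eq0.
    by split=> *; move=> a u v; rewrite ?(tors_linl LR GR AL) ?(tors_linr LR GR AL) !mxE.
  by move=> i j; rewrite tors_frame (c_lc_sym H).
Qed.

End coordinate_almost_kahler.

(** * Translation of the invariant identities into components *)

Section component_formulas.
Variables (F : comPzRingType) (m : nat) (d : 'I_m -> F -> F).
Variables (g gi J : 'M[F]_m) (G L : 'I_m -> 'I_m -> 'I_m -> F).
Local Notation V := 'rV[F]_m.
Local Notation E := (@cframe F m).
Implicit Type N : 'I_m -> 'I_m -> 'I_m -> F.

Definition c_omup i j := \sum_s J s i * gi j s.
Definition c_curv N a b c k := d a (N b c k) - d b (N a c k)
  + \sum_e (N b c e * N a e k - N a c e * N b e k).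
Definition c_P a b :=
  \sum_i \sum_j c_omup i j * \sum_k c_curv G a b i k * g k j.
Definition c_scal := \sum_a \sum_b c_omup b a * c_P a b.
Definition c_Rc b e := \sum_a c_curv L a b e a.
Definition c_low i j k := \sum_l (G i j l - G j i l) * g l k.
Definition c_nabJ N i j k :=
  d i (J j k) - \sum_e N i j e * J e k + \sum_e N i e k * J j e.
Definition c_B1 i j := \sum_k \sum_l \sum_p \sum_q
  gi k l * g p q * c_nabJ L i k p * c_nabJ L j l q.
Definition c_B2 i j := \sum_k \sum_l \sum_p \sum_q
  gi k l * g p q * c_nabJ L k i p * c_nabJ L l j q.
Definition c_nab2 N T a i j :=
  d a (T i j) - \sum_e N a i e * T e j - \sum_e N a j e * T i e.
Definition c_nab3 N T a i j k := d a (T i j k) - \sum_e N a i e * T e j k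
  - \sum_e N a j e * T i e k - \sum_e N a k e * T i j e.
Definition c_nab4 N T a i j k l := d a (T i j k l) - \sum_e N a i e * T e j k l
  - \sum_e N a j e * T i e k l - \sum_e N a k e * T i j e l
  - \sum_e N a l e * T i j k e.
Definition c_lap f := \sum_i \sum_j gi i j *
  (d i (d j f) - \sum_e G i j e * d e f).
Definition c_normT := \sum_i \sum_j \sum_k \sum_a \sum_b \sum_c
  gi i a * gi j b * gi k c * c_low i j k * c_low a b c.

Hypothesis H : coord_ak d g gi J G L.
Let dP := c_der H.
Let AK := coord_ak_structure H.
Let LR := ak_lie_rinehart AK.
Let GR := ak_riemannian AK.
Local Notation act := (cact d).
Local Notation br := (cbr d).
Local Notation gg := (cbil g).
Local Notation jop := (fun X : V => X *m J).
Local Notation nb := (cnab d G).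
Local Notation Dc := (cnab d L).
Local Notation tr := (metric_tr E (fun i j => gi i j)).
Local Notation P := (chern_ricci br gg E (fun i j => gi i j) jop nb).
Local Notation T := (torsion3 br gg nb).
Local Notation Rc := (ricci_of br gg E (fun i j => gi i j) Dc).
Local Notation Btens := (B_tensor br gg E (fun i j => gi i j) nb).
Local Notation bet := (torsion_sq3 br gg E (fun i j => gi i j) nb).
Local Notation gam := (torsion_sq1 br gg E (fun i j => gi i j) nb).
Local Notation nrmT := (torsion_normsq br gg E (fun i j => gi i j) nb).

Lemma curv_frame N a b c k :
  curvature_of br (cnab d N) (E a) (E b) (E c) 0 k = c_curv N a b c k.
Proof.
have N0 : cnab d N 0 (E c) = 0 by apply: (conn0l (cnab_affine dP N)).
rewrite /curvature_of cbr_frame // N0 subr0 mxE [X in _ + X]mxE.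
rewrite (cnab_frame d N a (cnab d N (E b) (E c))).
rewrite (cnab_frame d N b (cnab d N (E a) (E c))).
rewrite !(cnab_frame2 dP) /c_curv sumrB opprD addrACA.
by congr (_ + (_ - _)); apply: eq_bigr => e _; rewrite cnab_frame2.
Qed.

Lemma rm_frame N a b c j :
  rm br gg (cnab d N) (E a) (E b) (E c) (E j) = \sum_k c_curv N a b c k * g k j.
Proof. by rewrite /rm cbil_framer; apply: eq_bigr => k _; rewrite curv_frame. Qed.

Lemma tr_jop f : lin2 f -> tr (fun s t => f (s *m J) t) =
  \sum_i \sum_j c_omup i j * f (E i) (E j).
Proof.
move=> [f1 f2]; rewrite /metric_tr.
under eq_bigr => s _ do under eq_bigr => t _ do
  rewrite jop_frameE (lin_sum (f1 _)) mulr_sumr.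
under [RHS]eq_bigr => i _ do under eq_bigr => j _ do rewrite /c_omup mulr_suml.
under eq_bigr => s _ do rewrite exchange_big /=.
rewrite exchange_big; apply: eq_bigr => i _; rewrite exchange_big.
apply: eq_bigr => j _; apply: eq_bigr => s _; rewrite (cogC H) /=; ring.
Qed.

Lemma P_lin : lin2 P.
Proof.
have RE := rm_lin LR GR (chern_conn AK).
by split=> *; move=> a u v; rewrite /chern_ricci -trZ -trD; apply: eq_tr => s t; rewrite RE.
Qed.

Lemma P_frame a b : P (E a) (E b) = c_P a b.
Proof.
have RE := rm_lin LR GR (chern_conn AK).
rewrite /chern_ricci (tr_jop (f := fun s t => rm br gg nb (E a) (E b) s t)).
  by apply: eq_bigr => i _; apply: eq_bigr => j _; rewrite rm_frame.
by split=> *; move=> c u v; rewrite RE.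
Qed.

Lemma chern_scal_frame :
  chern_scalar_curvature br gg E (fun i j => gi i j) jop nb = c_scal.
Proof.
have [P1 P2] := P_lin.
rewrite /chern_scalar_curvature -(tr_swap GR) (tr_jop (f := fun s t => P t s)).
  rewrite exchange_big; apply: eq_bigr => i _; apply: eq_bigr => j _.
  by rewrite P_frame.
by split.
Qed.

Lemma tr_endo (Lm : V -> V) : tr (fun s t => gg (Lm s) t) = \sum_a Lm (E a) 0 a.
Proof.
apply: eq_bigr => s _.
transitivity (gg (Lm (E s)) (dual E (fun i j => gi i j) s)).
  by rewrite lin_sum //; exact: cbil_linr.
rewrite [in RHS](dual_dec GR (Lm (E s))) summxE (bigD1 s) //= mxE cframeE eqxx mulr1.
rewrite big1 ?addr0 // => i si.
by rewrite mxE cframeE eq_sym (negbTE si) mulr0.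
Qed.

Lemma Rc_frame b c : Rc (E b) (E c) = c_Rc b c.
Proof.
rewrite /ricci_of /rm (tr_endo (fun s => curvature_of br Dc s (E b) (E c))).
by apply: eq_bigr => a _; rewrite curv_frame.
Qed.

Lemma T_frame i j k : T (E i) (E j) (E k) = c_low i j k.
Proof.
by rewrite /torsion3 cbil_framer; apply: eq_bigr => l _; rewrite (tors_frame H).
Qed.

Lemma nabJ_frame N i j k :
  (cnab d N (E i) (E j *m J) - cnab d N (E i) (E j) *m J) 0 k = c_nabJ N i j k.
Proof.
rewrite mxE [X in _ + X]mxE jop_frameE cnab_frame -jop_frameE jop_frame.
rewrite /c_nabJ -addrA [RHS]addrAC -addrA; congr (_ + (_ - _)).
  by apply: eq_bigr => l _; rewrite jop_frame mulrC.
by rewrite mxE; apply: eq_bigr => l _; rewrite cnab_frame2.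
Qed.

Lemma cbil_vec X Y : gg X Y = \sum_p \sum_q g p q * X 0 p * Y 0 q.
Proof. by apply: eq_bigr => p _; apply: eq_bigr => q _; ring. Qed.

Lemma double_injF (x y : F) : 2 * x = 2 * y -> x = y.
Proof.
move=> /eqP; rewrite -subr_eq0 -mulrBr => /eqP Hx.
apply/eqP; rewrite -subr_eq0; apply/eqP; apply: (ak_two_inj AK).
by rewrite -Hx; ring.
Qed.

Let DJ X Y := Dc X (Y *m J) - Dc X Y *m J.

Let DJE X Y : DJ X Y = - (contorsion nb Dc X (Y *m J) + contorsion nb Dc X (Y *m J)).
Proof. exact: (DcJ AK). Qed.

Let gDJ X Y Z W : gg (DJ X Y) (DJ Z W) =
  4 * gg (contorsion nb Dc X (Y *m J)) (contorsion nb Dc Z (W *m J)).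
Proof.
rewrite !DJE; move: (contorsion nb Dc X (Y *m J)) (contorsion nb Dc Z (W *m J)) => u v.
by rewrite !(gE GR); ring.
Qed.

Let AE X Y k : gg (contorsion nb Dc X Y) k = T k Y X.
Proof. exact: (aE AK). Qed.

(** The factor is the square of the 2 in $DJ=-2AJ$; the remaining [J] is absorbed by the invariance
    of the trace. In [B2_frame] it is absorbed by that of [gam]. *)
Lemma B1_frame i j : c_B1 i j = 4 * bet (E i) (E j).
Proof.
transitivity (tr (fun k l => gg (DJ (E i) k) (DJ (E j) l))).
  apply: eq_bigr => k _; apply: eq_bigr => l _; rewrite cbil_vec mulr_sumr.
  apply: eq_bigr => p _; rewrite mulr_sumr; apply: eq_bigr => q _.
  by rewrite !nabJ_frame; ring.
have [A1 A2] := (A_lin1 AK, A_lin2 AK).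
transitivity (tr (fun k l => 4 * gg (contorsion nb Dc (E i) (k *m J)) (contorsion nb Dc (E j) (l *m J)))).
  by apply: eq_tr => k l; rewrite gDJ.
rewrite trZ; congr (_ * _).
rewrite (tr_acs2 AK (f := fun k l => gg (contorsion nb Dc (E i) k) (contorsion nb Dc (E j) l))); last first.
  by split=> *; move=> c u v; rewrite A2 ?(metricE GR) ?(metric_linr GR).
rewrite /torsion_sq3 tr_exch; apply: eq_tr => k l.
rewrite (metricC GR (contorsion nb Dc (E i) k)).
rewrite -(tr_contract GR (contorsion nb Dc (E i) k) (metric_linr GR (contorsion nb Dc (E j) l))).
  by apply: eq_tr => p q; rewrite !AE.
Qed.

Lemma B2_frame i j : c_B2 i j = 4 * gam (E i) (E j).
Proof.
transitivity (tr (fun k l => gg (DJ k (E i)) (DJ l (E j)))).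
  apply: eq_bigr => k _; apply: eq_bigr => l _; rewrite cbil_vec mulr_sumr.
  apply: eq_bigr => p _; rewrite mulr_sumr; apply: eq_bigr => q _.
  by rewrite !nabJ_frame; ring.
transitivity (tr (fun k l => 4 * gg (contorsion nb Dc k (E i *m J)) (contorsion nb Dc l (E j *m J)))).
  by apply: eq_tr => k l; rewrite gDJ.
rewrite trZ -(gamJ AK); congr (_ * _); rewrite /torsion_sq1 tr_exch; apply: eq_tr => k l.
rewrite (metricC GR (contorsion nb Dc k (E i *m J))).
rewrite -(tr_contract GR (contorsion nb Dc k (E i *m J)) (metric_linr GR (contorsion nb Dc l (E j *m J)))).
apply: eq_tr => p q; rewrite !AE (TC AK p) (TC AK q) mulrNN.
by [].
Qed.

Lemma Btens_frame B : (forall i j, 4 * B i j = c_B1 i j - 2 * c_B2 i j) ->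
  forall i j, Btens (E i) (E j) = B i j.
Proof.
move=> BE i j; do 2!apply: double_injF.
transitivity (4 * B i j); last by ring.
by rewrite BE B1_frame B2_frame /B_tensor; ring.
Qed.

Lemma nab1_frame N (f : V -> F) i j : lin f ->
  cov1 act (cnab d N) f (E i) (E j) = d i (f (E j)) - \sum_e N i j e * f (E e).
Proof.
move=> fP; rewrite /cov1 cact_frame (lin_coord (cnab d N _ _) fP); congr (_ - _).
by apply: eq_bigr => e _; rewrite cnab_frame2.
Qed.

Lemma nab2_frame N (f : V -> V -> F) a i j : lin2 f ->
  cov2 act (cnab d N) f (E a) (E i) (E j) =
  c_nab2 N (fun i j => f (E i) (E j)) a i j.
Proof.
move=> [f1 f2]; rewrite /cov2 cact_frame (lin_coord (cnab d N _ _) (f1 _)) (lin_coord (cnab d N _ _) (f2 _)).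
by congr (_ - _ - _); apply: eq_bigr => e _; rewrite cnab_frame2.
Qed.

Lemma nab3_frame N (f : V -> V -> V -> F) a i j k : lin3 f ->
  cov3 act (cnab d N) f (E a) (E i) (E j) (E k) =
  c_nab3 N (fun i j k => f (E i) (E j) (E k)) a i j k.
Proof.
move=> [f1 f23]; rewrite /cov3 cact_frame (lin_coord (cnab d N _ _) (f1 _ _)).
rewrite (lin_coord (cnab d N _ _) ((f23 _).1 _)) (lin_coord (cnab d N _ _) ((f23 _).2 _)).
by congr (_ - _ - _ - _); apply: eq_bigr => e _; rewrite cnab_frame2.
Qed.

Lemma nab4_frame N (f : V -> V -> V -> V -> F) a i j k l : lin4 f ->
  cov4 act (cnab d N) f (E a) (E i) (E j) (E k) (E l) =
  c_nab4 N (fun i j k l => f (E i) (E j) (E k) (E l)) a i j k l.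
Proof.
move=> [f1 f234]; rewrite /cov4 cact_frame (lin_coord (cnab d N _ _) (f1 _ _ _)).
rewrite (lin_coord (cnab d N _ _) ((f234 _).1 _ _)) (lin_coord (cnab d N _ _) (((f234 _).2 _).1 _)).
rewrite (lin_coord (cnab d N _ _) (((f234 _).2 _).2 _)).
by congr (_ - _ - _ - _ - _); apply: eq_bigr => e _; rewrite cnab_frame2.
Qed.

Lemma eq_nab2 N T1 T2 : (forall i j, T1 i j = T2 i j) ->
  forall a i j, c_nab2 N T1 a i j = c_nab2 N T2 a i j.
Proof.
move=> T12 a i j; rewrite /c_nab2 T12.
by congr (_ - _ - _); apply: eq_bigr => e _; rewrite T12.
Qed.

Lemma eq_nab3 N T1 T2 : (forall i j k, T1 i j k = T2 i j k) ->
  forall a i j k, c_nab3 N T1 a i j k = c_nab3 N T2 a i j k.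
Proof.
move=> T12 a i j k; rewrite /c_nab3 T12.
by congr (_ - _ - _ - _); apply: eq_bigr => e _; rewrite T12.
Qed.

Lemma eq_nab4 N T1 T2 : (forall i j k l, T1 i j k l = T2 i j k l) ->
  forall a i j k l, c_nab4 N T1 a i j k l = c_nab4 N T2 a i j k l.
Proof.
move=> T12 a i j k l; rewrite /c_nab4 T12.
by congr (_ - _ - _ - _ - _); apply: eq_bigr => e _; rewrite T12.
Qed.

Lemma lin_jop (f : V -> F) i : lin f -> f (E i *m J) = \sum_s J i s * f (E s).
Proof. by move=> fP; rewrite jop_frameE lin_sum. Qed.

Lemma lin2_jop (f : V -> V -> F) i j : lin2 f -> f (E i *m J) (E j *m J) =
  \sum_s \sum_u J i s * J j u * f (E s) (E u).
Proof.
move=> [f1 f2]; rewrite (lin_jop _ (f1 _)); apply: eq_bigr => s _.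
rewrite (lin_jop _ (f2 _)) mulr_sumr; apply: eq_bigr => u _; exact: mulrA.
Qed.

Lemma lap_frame f : lap act E (fun i j => gi i j) nb f = c_lap f.
Proof.
apply: eq_bigr => i _; apply: eq_bigr => j _.
rewrite nab1_frame; last exact: cact_lin.
by rewrite cact_frame; congr (_ * (_ - _)); apply: eq_bigr => e _; rewrite cact_frame.
Qed.

Lemma normT_frame : nrmT = c_normT.
Proof.
transitivity (\sum_i \sum_a \sum_j \sum_b \sum_k \sum_c
  gi i a * gi j b * gi k c * c_low i j k * c_low a b c).
  apply: eq_bigr => i _; apply: eq_bigr => a _; rewrite mulr_sumr.
  apply: eq_bigr => j _; rewrite mulr_sumr; apply: eq_bigr => b _.
  rewrite mulr_sumr mulr_sumr.
  apply: eq_bigr => k _; rewrite !mulr_sumr; apply: eq_bigr => c _.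
  by rewrite !T_frame; ring.
apply: eq_bigr => i _; rewrite exchange_big; apply: eq_bigr => j _ /=.
under eq_bigr => a _ do rewrite exchange_big /=.
by rewrite exchange_big.
Qed.

Variables (dt : F -> F) (B : 'I_m -> 'I_m -> F).
Hypotheses (dtD : {morph dt : f h / f + h})
  (dtM : forall f h, dt (f * h) = dt f * h + f * dt h)
  (dtC : forall i f, dt (d i f) = d i (dt f)).
(** Denominators are cleared here and in [flow_J], because [F] allows cancelling 2 but need not
    contain its inverse. *)
Hypothesis BE : forall i j, 4 * B i j = c_B1 i j - 2 * c_B2 i j.
Hypothesis flow_om : forall i j, dt (c_omega g J i j) = - c_P i j.
Hypothesis flow_J : forall i k, 2 * dt (J i k) = - \sum_w
  (c_P i w - (\sum_s \sum_u J i s * J w u * c_P s u)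
   - 2 * \sum_e J i e * (c_Rc e w - \sum_s \sum_u J e s * J w u * c_Rc s u))
  * gi w k.

(** Componentwise, as the coordinate frame does not move with time. *)
Let dv (X : V) : V := \row_k dt (X 0 k).

Let dt_0 : dt 0 = 0.
Proof. by apply: (addrI (dt 0)); rewrite -dtD !addr0. Qed.

Let dt_N x : dt (- x) = - dt x.
Proof. by apply: (addrI (dt x)); rewrite -dtD !subrr dt_0. Qed.

Let dt_cact X f : dt (act X f) = act (dv X) f + act X (dt f).
Proof.
rewrite /cact (big_morph dt dtD dt_0) -big_split; apply: eq_bigr => i _.
by rewrite dtM dtC mxE.
Qed.

Lemma coord_time_derivative : time_derivative act br dt dv.
Proof.
split=> //.
- by move=> X Y; apply/rowP => k; rewrite !mxE dtD.
- by move=> f X; apply/rowP => k; rewrite !mxE dtM.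
- move=> X Y; apply/rowP => k; rewrite [LHS]mxE.
  have -> : (br X Y : V) 0 k = act X ((Y : V) 0 k) - act Y ((X : V) 0 k) by rewrite mxE.
  by rewrite dtD dt_N !dt_cact !mxE; ring.
Qed.

Let DT := coord_time_derivative.

Let dv_frame i : dv (E i) = 0.
Proof.
apply/rowP => k; rewrite [LHS]mxE [RHS]mxE cframeE.
by case: (_ == _); [exact: (dt1 DT) | exact: dt_0].
Qed.

Let dvlin a u v : dv (a *: u + v) = dt a *: u + a *: dv u + dv v.
Proof. exact: (dvE DT). Qed.

Let jop_dt X := dv (X *m J) - dv X *m J.

Let flow_om_fun X Y :
  dt (gg (X *m J) Y) - gg (dv X *m J) Y - gg (X *m J) (dv Y) = - P X Y.
Proof.
have [P1 P2] := P_lin.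
apply/eqP; rewrite -addr_eq0; apply/eqP; move: X Y.
apply: lin2_eq0 => [|i j].
  split=> *; move=> c u v; rewrite !dvlin ?jop_lin ?P1 ?P2 ?mulmxDl -?scalemxAl;
    rewrite !(gE GR) !(dtD, dtM); ring.
rewrite !dv_frame mul0mx (lin0 (cbil_linl g _)) (lin0 (cbil_linr g _)) !subr0.
by rewrite -(cbil_om H) cbil_frame P_frame flow_om addNr.
Qed.

Let flow_J_fun X Y : 2 * gg (jop_dt X) Y = - (P X Y - P (X *m J) (Y *m J))
  + 2 * (Rc (X *m J) Y - Rc (X *m J *m J) (Y *m J)).
Proof.
have [P1 P2] := P_lin; have [R1 R2] := Rc_lin AK.
have gr := metric_linr GR; have gl := metric_lin GR.
apply/eqP; rewrite -subr_eq0; apply/eqP; move: X Y.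
apply: lin2_eq0 => [|i j].
  split=> *; move=> c u v; last first.
    by rewrite ?jop_lin !gr !P2 !R2; ring.
  rewrite /jop_dt !jop_lin !dvlin mulmxDl mulmxDl -!scalemxAl.
  by rewrite !P1 !R1 !(gE GR); ring.
have -> : jop_dt (E i) = \row_k dt (J i k).
  rewrite /jop_dt dv_frame mul0mx subr0; apply/rowP => k.
  by rewrite !mxE; congr dt; rewrite -jop_frame mxE.
rewrite cbil_framer !P_frame !(lin2_jop i j P_lin).
rewrite (lin_jop i (R1 (E j))) (lin_jop i (f := fun X => Rc (X *m J) (E j *m J))); last first.
  by move=> c u v; rewrite jop_lin R1.
apply/eqP; rewrite subr_eq0; apply/eqP.
(* The right-hand side of [flow_J] before its index is raised; pairing with [g] lowers the index and
   cancels [gi]. *)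
pose X w := c_P i w - (\sum_s \sum_u J i s * J w u * c_P s u)
   - 2 * \sum_e J i e * (c_Rc e w - \sum_s \sum_u J e s * J w u * c_Rc s u).
transitivity (- X j).
  rewrite mulr_sumr; under eq_bigr => k _ do rewrite mxE mulrA flow_J mulNr mulr_suml.
  rewrite sumrN exchange_big /=; congr (- _).
  transitivity (\sum_w X w * (gi *m g) w j).
    apply: eq_bigr => w _; rewrite mxE mulr_sumr; apply: eq_bigr => k _.
    by rewrite mulrA.
  rewrite (c_inv H) (bigD1 j) //= mxE eqxx mulr1 big1 ?addr0 // => k kj.
  by rewrite mxE (negbTE kj) mulr0.
have -> : \sum_s \sum_u J i s * J j u * P (E s) (E u) =
    \sum_s \sum_u J i s * J j u * c_P s u.
  by apply: eq_bigr => s _; apply: eq_bigr => u _; rewrite P_frame.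
rewrite /X (_ : \sum_e J i e * _ = \sum_s J i s * Rc (E s) (E j) -
    \sum_s J i s * Rc (E s *m J) (E j *m J)); first by ring.
rewrite -sumrB.
apply: eq_bigr => e _; rewrite mulrBr Rc_frame; congr (_ - _ * _).
rewrite (lin2_jop _ _ (Rc_lin AK)); apply: eq_bigr => s _; apply: eq_bigr => u _.
by rewrite Rc_frame.
Qed.

Lemma component_evolution : dt c_scal - c_lap c_scal =
  4 * (\sum_i \sum_j \sum_k \sum_l gi i k * gi j l
        * (c_Rc i j - B i j) * (c_Rc k l - B k l))
  + 2 * c_lap c_normT
  + 4 * (\sum_i \sum_j \sum_p \sum_q gi i p * gi j q
        * c_nab3 G (c_nab2 G B) j i p q)
  + 16 * (\sum_a \sum_p \sum_r \sum_s \sum_b \sum_q \sum_c \sum_e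
        gi a p * gi r s * gi b q * gi c e
        * c_nab4 G (c_nab3 G c_low) a r s b e * c_low p q c).
Proof.
have Bf := Btens_frame BE.
have BP := nab2_lin LR (chern_conn AK) (Btens_lin AK).
have TP := nT_lin AK.
have := chern_scal_evolution AK DT flow_om_fun flow_J_fun.
rewrite chern_scal_frame !lap_frame normT_frame => ->.
congr (4 * _ + _ + 4 * _ + 16 * _).
- rewrite /ip /metric_tr.
  apply: eq_bigr => i _; rewrite [RHS]exchange_big; apply: eq_bigr => k _ /=.
  rewrite mulr_sumr [RHS]exchange_big; apply: eq_bigr => l _ /=; rewrite mulr_sumr.
  apply: eq_bigr => j _.
  (* The crossed indices of [ip] are straightened by the symmetry of [Rc] and [Btens]. *)
  rewrite /einst !Rc_frame !Bf (cogC H l j) -(Rc_frame l k) (RcC AK) Rc_frame.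
  by rewrite -(Bf l k) (BtensC AK) Bf; ring.
- rewrite /metric_tr [RHS]exchange_big; apply: eq_bigr => j _ /=.
  under eq_bigr => q _ do (rewrite mulr_sumr; under eq_bigr => i _ do rewrite mulr_sumr).
  rewrite exchange_big; apply: eq_bigr => i _; rewrite exchange_big.
  apply: eq_bigr => p _; apply: eq_bigr => q _ /=.
  rewrite (nab3_frame _ _ _ _ _ BP) (_ : c_nab3 G _ j i p q = c_nab3 G (c_nab2 G B) j i p q).
    by ring.
  apply: eq_nab3 => i' j' k'; rewrite (nab2_frame _ _ _ _ (Btens_lin AK)).
  exact: eq_nab2.
- rewrite /metric_tr; apply: eq_bigr => a _; apply: eq_bigr => p _.
  rewrite mulr_sumr; apply: eq_bigr => r _; rewrite mulr_sumr; apply: eq_bigr => s _.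
  do 2!rewrite mulr_sumr; apply: eq_bigr => b _.
  do 2!rewrite mulr_sumr; apply: eq_bigr => q _.
  do 3!rewrite mulr_sumr; rewrite [RHS]exchange_big; apply: eq_bigr => e _.
  do 3!rewrite mulr_sumr; apply: eq_bigr => c _ /=.
  have nTP : lin3 T := T_lin AK.
  rewrite (nab4_frame _ _ _ _ _ _ TP) T_frame (cogC H e c).
  rewrite (_ : c_nab4 G _ a r s b e = c_nab4 G (c_nab3 G c_low) a r s b e).
    by ring.
  apply: eq_nab4 => i' j' k' l'; rewrite /cov_torsion3 (nab3_frame _ _ _ _ _ nTP).
  by apply: eq_nab3 => *; exact: T_frame.
Qed.

End component_formulas.

(** * Both connections in terms of the metric and the almost complex structure *)

Section connection_formulas.
Variables (F : comPzRingType) (m : nat) (d : 'I_m -> F -> F).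
Variables (g gi J : 'M[F]_m) (G L : 'I_m -> 'I_m -> 'I_m -> F).
Hypothesis H : coord_ak d g gi J G L.

(** With [chern_formula], this makes the connection coefficients smooth in time: they are
    expressions in [g], [gi], [J] and first space derivatives. *)
Lemma christoffel_formula i j l : 2 * L i j l =
  \sum_k (d i (g j k) + d j (g i k) - d k (g i j)) * gi k l.
Proof.
have Ls a b c : L a b c = L b a c by apply/eqP; rewrite -subr_eq0 (c_lc_sym H).
have dg a b c : d a (g b c) = \sum_e L a b e * g e c + \sum_e L a c e * g b e.
  by have /eqP := c_lc_metric H a b c; rewrite -addrA -opprD subr_eq0 => /eqP.
transitivity (\sum_k \sum_e (2 * L i j e) * (g e k * gi k l)).
  rewrite exchange_big.
  transitivity (\sum_e 2 * L i j e * (g *m gi) e l).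
    rewrite (mulmx1C (c_inv H)) (bigD1 l) //= mxE eqxx mulr1 big1 ?addr0 // => e el.
    by rewrite mxE (negbTE el) mulr0.
  by apply: eq_bigr => e _; rewrite mxE mulr_sumr.
apply: eq_bigr => k _; rewrite !dg.
have -> : \sum_e L k i e * g e j = \sum_e L i k e * g j e.
  by apply: eq_bigr => e _; rewrite Ls (c_sym H).
have -> : \sum_e L k j e * g i e = \sum_e L j k e * g i e.
  by apply: eq_bigr => e _; rewrite Ls.
have -> : \sum_e L j i e * g e k = \sum_e L i j e * g e k.
  by apply: eq_bigr => e _; rewrite Ls.
transitivity ((2 * \sum_e L i j e * g e k) * gi k l); last by ring.
by rewrite mulr_sumr mulr_suml; apply: eq_bigr => e _; ring.
Qed.

(** Solves $DJ=-2AJ$ for the contorsion by means of $J^2=-1$. *)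
Lemma chern_formula i l k :
  2 * G i l k = 2 * L i l k + \sum_j J l j * c_nabJ d J L i j k.
Proof.
have AK := coord_ak_structure H; have dP := c_der H.
have E j : c_nabJ d J L i j k = - 2 * \sum_e J j e * (G i e k - L i e k).
  rewrite -(nabJ_frame H) (DcJ AK) mxE mxE.
  pose f (X : 'rV[F]_m) := contorsion (cnab d G) (cnab d L) (cframe F i) X 0 k.
  have fP : lin f by move=> a u v; rewrite /f (A_lin2 AK) !mxE.
  rewrite -/(f _) (lin_jop _ _ fP).
  transitivity (- 2 * \sum_s J j s * f (cframe F s)); first by ring.
  congr (_ * _); apply: eq_bigr => e _; congr (_ * _).
  by rewrite /f /contorsion mxE [X in _ + X]mxE !cnab_frame2.
under eq_bigr => j _ do rewrite E mulrCA mulr_sumr.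
rewrite -mulr_sumr exchange_big /=.
transitivity (2 * L i l k - 2 * \sum_e (J *m J) l e * (G i e k - L i e k)).
  rewrite (c_acs H) (bigD1 l) //= big1 => [|e el]; first by rewrite !mxE eqxx /=; ring.
  by rewrite !mxE eq_sym (negbTE el) /= oppr0 mul0r.
rewrite mulNr; congr (_ - 2 * _); apply: eq_bigr => e _.
by rewrite mxE mulr_suml; apply: eq_bigr => j _; rewrite mulrA.
Qed.

End connection_formulas.

(** * Smooth families in a chart *)

Section time_derivative_rules.
Variables (R : realType) (I : set R).
Hypotheses (I_interval : is_interval I).
Hypothesis I_nondegenerate : exists a b, [/\ I a, I b & a < b].

(** A point of a nondegenerate interval is an accumulation point of it; without this, limits of
    difference quotients would not be unique. *)
Lemma dnbhs_within_proper t : I t -> ProperFilter (within I t^').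
Proof.
move=> It; have [c Ic ct] : exists2 c, I c & c != t.
  have [a [b [Ia Ib ab]]] := I_nondegenerate.
  have [E|ne] := eqVneq a t; last by exists a.
  by exists b => //; move: ab; rewrite E lt_neqAle eq_sym => /andP[].
apply: Build_ProperFilter_ex => A; rewrite /within /= => H.
have /nbhs_ballP[d /= d0 Hd] := H.
have ct0 : 0 < `|c - t| by rewrite normr_gt0 subr_eq0.
(* The 1 keeps [s] on the segment from [t] to [c], hence in [I]; the factor 2 makes its distance to
   [t] strictly less than [d]. *)
pose r := Num.min 1 (d / (2 * `|c - t|)).
have r0 : 0 < r by rewrite lt_min ltr01 divr_gt0 // mulr_gt0.
have r1 : r <= 1 by rewrite ge_min lexx.
pose s := t + r * (c - t); exists s.
have rd : r * `|c - t| < d.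
  have : r <= d / (2 * `|c - t|) by rewrite ge_min lexx orbT.
  rewrite ler_pdivlMr ?mulr_gt0 // => h.
  have := mulr_gt0 r0 ct0; nra.
apply: Hd => /=.
- rewrite /ball /= (_ : t - s = - (r * (c - t))); last by rewrite /s; ring.
  by rewrite normrN normrM gtr0_norm.
- apply/eqP => st; have /eqP : r * (c - t) = 0 by rewrite -(subrr t) -{2}st /s; ring.
  by rewrite mulf_eq0 subr_eq0 (negbTE ct) orbF gt_eqF.
- have [lt|lt|E] := ltgtP t c; last by rewrite E eqxx in ct.
    apply: (I_interval It Ic); rewrite /s; apply/andP; split; nra.
  apply: (I_interval Ic It); rewrite /s; apply/andP; split; nra.
Qed.

(** Carries the existence of the limit, which an equation about [dt], a [lim], does not. *)
Definition is_dt (u : R -> R) (t l : R) := tquot u t @ within I t^' --> l.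

Lemma is_dt_unique u t l : I t -> is_dt u t l -> dt I u t = l.
Proof.
by move=> It ul; have P := dnbhs_within_proper It; exact: cvg_lim ul.
Qed.

Lemma is_dt_derivable u t l : is_dt u t l -> derivable_in I u t.
Proof. by move=> ul; apply/cvg_ex; exists l. Qed.

Lemma near_dnbhs_within t : \forall s \near within I t^', I s /\ s != t.
Proof.
suff : nbhs t [set s | s != t -> I s -> I s /\ s != t] by [].
by apply: filterS filterT => s _ st Is.
Qed.

Lemma is_dt_ext u v t l : I t -> (forall s, I s -> u s = v s) ->
  is_dt u t l -> is_dt v t l.
Proof.
move=> It uv ul; apply: cvg_trans ul; apply: near_eq_cvg.
have := near_dnbhs_within t; apply: filterS => s [Is _].
by rewrite /tquot !uv.
Qed.

Lemma is_dt_cst t (c : R) : is_dt (fun=> c) t 0.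
Proof.
rewrite /is_dt (_ : tquot _ _ = fun=> 0); first exact: cvg_cst.
by apply/funext => s; rewrite /tquot subrr mulr0.
Qed.

Lemma is_dtD u v t l k : is_dt u t l -> is_dt v t k ->
  is_dt (fun s => u s + v s) t (l + k).
Proof.
move=> ul vk; rewrite /is_dt (_ : tquot _ _ = tquot u t \+ tquot v t).
  exact: cvgD.
by apply/funext => s; rewrite /tquot /=; ring.
Qed.

Lemma is_dt_cvg u t l : is_dt u t l -> u @ within I t^' --> u t.
Proof.
move=> ul.
have H : (fun s => u t + (s - t) * tquot u t s) @ within I t^' --> u t + (t - t) * l.
  apply: cvgD; first exact: cvg_cst.
  apply: cvgM => //; apply: cvgB; last exact: cvg_cst.
  by apply: cvg_within_filter; apply: cvg_within_filter; exact: cvg_id.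
rewrite subrr mul0r addr0 in H; apply: cvg_trans H; apply: near_eq_cvg.
have := near_dnbhs_within t; apply: filterS => s [_ st].
by rewrite /tquot mulVKf ?subr_eq0 // addrC subrK.
Qed.

Lemma is_dtM u v t l k : is_dt u t l -> is_dt v t k ->
  is_dt (fun s => u s * v s) t (l * v t + u t * k).
Proof.
move=> ul vk; rewrite /is_dt.
rewrite (_ : tquot _ _ = fun s => tquot u t s * v t + u s * tquot v t s); last first.
  by apply/funext => s; rewrite /tquot /=; ring.
apply: cvgD; first by apply: cvgM => //; exact: cvg_cst.
by apply: cvgM => //; exact: is_dt_cvg ul.
Qed.

Lemma is_dtV u t l : I t -> (forall s, I s -> u s != 0) -> is_dt u t l ->
  is_dt (fun s => (u s)^-1) t (- (u t)^-1 * (u t)^-1 * l).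
Proof.
move=> It u0 ul.
have H : (fun s => - (u s)^-1 * (u t)^-1 * tquot u t s) @ within I t^' -->
    - (u t)^-1 * (u t)^-1 * l.
  apply: cvgM => //; apply: cvgM; last exact: cvg_cst.
  by apply: cvgN; apply: cvgV; [exact: u0 | exact: is_dt_cvg ul].
apply: cvg_trans H; apply: near_eq_cvg.
have := near_dnbhs_within t; apply: filterS => s [Is st].
by rewrite /tquot; field; rewrite !u0 //= subr_eq0.
Qed.

End time_derivative_rules.

(** * Closure properties of smooth families *)

Section smooth_families.
Variables (R : realType) (m : nat) (I : set R) (U : set 'rV[R]_m).
Hypotheses (I_interval : is_interval I).
Hypothesis I_nondegenerate : exists a b, [/\ I a, I b & a < b].
Hypothesis U_open : open U.
Implicit Types u v : R -> 'rV[R]_m -> R.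
Local Notation Ck k := (Ck_family k I U).

Let jcont u := {within I `*` U, continuous (fun z : R * 'rV[R]_m => u z.1 z.2)}.

Definition has_pd a (f : 'rV[R]_m -> R) x l :=
  derivable f x (delta_mx 0 a) /\ pd a f x = l.

Lemma jcontP u : jcont u <-> (forall t x, I t -> U x ->
  (fun z : R * 'rV[R]_m => u z.1 z.2) @ within (I `*` U) (nbhs (t, x)) --> u t x).
Proof.
split=> [/subspace_continuousP H t x It Ux|H]; first exact: (H (t, x)).
by apply/subspace_continuousP => -[t x] [/= It Ux]; exact: H.
Qed.

Lemma jcont_ext u v : (forall t x, I t -> U x -> u t x = v t x) ->
  jcont u -> jcont v.
Proof.
move=> uv /jcontP H; apply/jcontP => t x It Ux; rewrite -uv //.
apply: cvg_trans (H t x It Ux); apply: near_eq_cvg.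
suff : nbhs (t, x) [set z | (I `*` U) z -> u z.1 z.2 = v z.1 z.2] by [].
by apply: filterS filterT => -[s y] _ [/= Is Uy]; exact: uv.
Qed.

(** Smoothness only depends on the values on [I] times [U]: quotients in time stay in [I], and space
    derivatives are local in the open set [U]. *)
Lemma Ck_family_ext k u v : (forall t x, I t -> U x -> u t x = v t x) ->
  Ck k u -> Ck k v.
Proof.
elim: k u v => [|k IH] u v uv /= [cu H]; split=> //; try exact: jcont_ext uv cu.
have uvt t x : I t -> U x -> is_dt I (u ^~ x) t (dt I (u ^~ x) t) ->
    is_dt I (v ^~ x) t (dt I (u ^~ x) t).
  by move=> It Ux; apply: is_dt_ext => // s Is; exact: uv.
case: H => du Cu pu; split.
- move=> t x It Ux; apply: is_dt_derivable (uvt t x It Ux _); exact: du.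
- apply: IH Cu => t x It Ux; apply/esym/is_dt_unique => //.
  by apply: uvt => //; exact: du.
- move=> a; have [dpu Cpu] := pu a.
  have nuv t x : I t -> U x -> {near x, u t =1 v t}.
    move=> It Ux; have := open_nbhs_nbhs (conj U_open Ux).
    by apply: filterS => y Uy; exact: uv.
  split=> [t x It Ux|].
    by apply: near_eq_derivable (dpu t x It Ux); exact: nuv.
  by apply: IH Cpu => t x It Ux; apply: near_eq_derive; exact: nuv.
Qed.

Lemma CkS_intro k u (ut : R -> 'rV[R]_m -> R) (ux : 'I_m -> R -> 'rV[R]_m -> R) :
  jcont u ->
  (forall t x, I t -> U x -> is_dt I (u ^~ x) t (ut t x)) -> Ck k ut ->
  (forall a t x, I t -> U x -> has_pd a (u t) x (ux a t x)) ->
  (forall a, Ck k (ux a)) -> Ck k.+1 u.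
Proof.
move=> cu Dt Ct Dx Cx /=; split=> //; split.
- by move=> t x It Ux; apply: is_dt_derivable (Dt t x It Ux).
- by apply: Ck_family_ext Ct => t x It Ux; rewrite (is_dt_unique _ _ _ (Dt t x It Ux)).
- move=> a; split=> [t x It Ux|]; first by have [] := Dx a t x It Ux.
  by apply: Ck_family_ext (Cx a) => t x It Ux; have [_ ->] := Dx a t x It Ux.
Qed.

Lemma CkS_elim k u : Ck k.+1 u -> [/\ jcont u,
  forall t x, I t -> U x -> is_dt I (u ^~ x) t (dt I (u ^~ x) t),
  Ck k (fun t x => dt I (u ^~ x) t),
  forall a t x, I t -> U x -> has_pd a (u t) x (pd a (u t) x)
  & forall a, Ck k (fun t => pd a (u t))].
Proof.
move=> [cu [du Cu pu]]; split=> // [a t x It Ux|a]; last exact: (pu a).2.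
by split=> //; exact: (pu a).1.
Qed.

Lemma Ck0P u : Ck 0 u <-> jcont u.
Proof. by split=> [[]|]. Qed.

#[local] Opaque Ck_family.

Lemma Ck_familyW k u : Ck k.+1 u -> Ck k u.
Proof.
elim: k u => [|k IH] u; first by case/CkS_elim => /Ck0P.
move=> /CkS_elim[cu Dt Ct Dx Cx].
exact: (CkS_intro cu Dt (IH _ Ct) Dx (fun a => IH _ (Cx a))).
Qed.

Lemma Ck_jcont k u : Ck k u -> jcont u. Proof. by case: k => [/Ck0P|k /CkS_elim[]]. Qed.

Lemma jcont_cst c : jcont (fun _ _ => c).
Proof. by apply/jcontP => t x _ _; exact: cvg_cst. Qed.

Lemma Ck_family_cst k c : Ck k (fun _ _ => c).
Proof.
elim: k c => [|k IH] c; first exact/Ck0P/jcont_cst.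
apply: (@CkS_intro k _ (fun _ _ => 0) (fun _ _ _ => 0)) => //.
- exact: jcont_cst.
- by move=> t x _ _; exact: is_dt_cst.
- by move=> a t x _ _; split; [exact: derivable_cst|exact: derive_cst].
Qed.

Lemma Ck_familyD k u v : Ck k u -> Ck k v -> Ck k (fun t x => u t x + v t x).
Proof.
have cD u' v' : jcont u' -> jcont v' -> jcont (fun t x => u' t x + v' t x).
  move=> /jcontP cu /jcontP cv; apply/jcontP => t x It Ux.
  by apply: cvgD; [exact: cu | exact: cv].
elim: k u v => [|k IH] u v Hu Hv.
  by apply/Ck0P; apply: cD; [exact: Ck_jcont Hu|exact: Ck_jcont Hv].
have [cu Dt Ct Dx Cx] := CkS_elim Hu; have [cv Et Et' Ex Ex'] := CkS_elim Hv.
apply: (@CkS_intro k _ (fun t x => dt I (u ^~ x) t + dt I (v ^~ x) t)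
  (fun a t x => pd a (u t) x + pd a (v t) x)).
- exact: cD.
- by move=> t x It Ux; apply: is_dtD; [exact: Dt|exact: Et].
- exact: IH.
- move=> a t x It Ux; have [d1 d2] := Dx a t x It Ux.
  have [e1 e2] := Ex a t x It Ux.
  by split; [exact: derivableD|rewrite /pd deriveD].
- by move=> a; apply: IH; [exact: Cx|exact: Ex'].
Qed.

Lemma Ck_familyM k u v : Ck k u -> Ck k v -> Ck k (fun t x => u t x * v t x).
Proof.
have cM u' v' : jcont u' -> jcont v' -> jcont (fun t x => u' t x * v' t x).
  move=> /jcontP cu /jcontP cv; apply/jcontP => t x It Ux.
  by apply: cvgM; [exact: cu | exact: cv].
elim: k u v => [|k IH] u v Hu Hv.
  by apply/Ck0P; apply: cM; [exact: Ck_jcont Hu|exact: Ck_jcont Hv].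
have [cu Dt Ct Dx Cx] := CkS_elim Hu; have [cv Et Et' Ex Ex'] := CkS_elim Hv.
have [Wu Wv] := (Ck_familyW Hu, Ck_familyW Hv).
apply: (@CkS_intro k _
  (fun t x => dt I (u ^~ x) t * v t x + u t x * dt I (v ^~ x) t)
  (fun a t x => u t x * pd a (v t) x + v t x * pd a (u t) x)).
- exact: cM.
- by move=> t x It Ux; apply: (is_dtM (Dt t x It Ux) (Et t x It Ux)).
- by apply: Ck_familyD; [exact: (IH _ _ Ct Wv)|exact: (IH _ _ Wu Et')].
- move=> a t x It Ux; have [d1 d2] := Dx a t x It Ux.
  have [e1 e2] := Ex a t x It Ux.
  split; first exact: derivableM.
  by rewrite /pd (deriveM d1 e1).
- by move=> a; apply: Ck_familyD; [exact: (IH _ _ Wu (Ex' a))|exact: (IH _ _ Wv (Cx a))].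
Qed.

(** The derivatives of the inverse are polynomial in the inverse itself and the derivatives of [u],
    so the induction on [k] closes. *)
Lemma Ck_familyV k u : (forall t x, I t -> U x -> u t x != 0) ->
  Ck k u -> Ck k (fun t x => (u t x)^-1).
Proof.
have cV u' : (forall t x, I t -> U x -> u' t x != 0) -> jcont u' ->
    jcont (fun t x => (u' t x)^-1).
  move=> u0 /jcontP cu; apply/jcontP => t x It Ux.
  by apply: cvgV; [exact: u0 | exact: cu].
elim: k u => [|k IH] u u0 Hu; first by apply/Ck0P; apply: cV => //; exact: Ck_jcont Hu.
have [cu Dt Ct Dx Cx] := CkS_elim Hu.
have Wu := IH _ u0 (Ck_familyW Hu).
have W2 : Ck k (fun t x => - 1 * ((u t x)^-1 * (u t x)^-1)).
  by apply: Ck_familyM; [exact: Ck_family_cst|exact: Ck_familyM].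
apply: (@CkS_intro k _
  (fun t x => - 1 * ((u t x)^-1 * (u t x)^-1) * dt I (u ^~ x) t)
  (fun a t x => - 1 * ((u t x)^-1 * (u t x)^-1) * pd a (u t) x)).
- exact: cV.
- move=> t x It Ux; rewrite mulN1r -mulNr.
  by apply: is_dtV => // [s Is|]; [exact: u0|exact: Dt].
- exact: Ck_familyM.
- move=> a t x It Ux; have [d1 d2] := Dx a t x It Ux.
  split; first by apply: derivableV => //; exact: u0.
  by rewrite /pd deriveV ?u0 // mulN1r -invfM -expr2.
- by move=> a; exact: Ck_familyM.
Qed.

Lemma smooth_family_pd u a : smooth_family I U u ->
  smooth_family I U (fun t => pd a (u t)).
Proof. by move=> H k; have [_ _ _ _] := CkS_elim (H k.+1); exact. Qed.

Lemma smooth_family_dt u : smooth_family I U u ->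
  smooth_family I U (fun t x => dt I (u ^~ x) t).
Proof. by move=> H k; have [_ _] := CkS_elim (H k.+1). Qed.

Lemma smooth_const_family f : smooth U f -> smooth_family I U (fun _ => f).
Proof.
move=> H k; move: f {H} (H k); elim: k => [|k IH] f /= [cf Hf].
  apply/Ck0P/jcontP => t x It Ux.
  apply: cvg_within_filter.
  by apply: (@cvg_comp _ _ _ snd f); [exact: cvg_snd | exact: cf].
apply: (@CkS_intro k _ (fun _ _ => 0) (fun a _ => pd a f)).
- apply/jcontP => t x It Ux; apply: cvg_within_filter.
  by apply: (@cvg_comp _ _ _ snd f); [exact: cvg_snd | exact: cf].
- by move=> t x _ _; exact: is_dt_cst.
- exact: Ck_family_cst.
- by move=> a t x It Ux; split=> //; exact: (Hf a).1.
- by move=> a; apply: IH; exact: (Hf a).2.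
Qed.

End smooth_families.

(** * Mean value theorem and mixed derivatives relative to an interval *)

Section mixed_derivatives.
Variable R : realType.

Lemma is_dt_epsP (I : set R) u t l : is_dt I u t l <->
  (forall eps, 0 < eps -> exists2 d, 0 < d & forall s, I s -> s != t ->
     `|s - t| < d -> `|l - (s - t)^-1 * (u s - u t)| < eps).
Proof.
split=> [/cvgrPdist_lt H eps e0|H].
  have /nbhs_ballP[d /= d0 Hd] : nbhs t [set s | s != t -> I s ->
    `|l - tquot u t s| < eps] by exact: H.
  by exists d => // s Is st sd; apply: Hd => //; rewrite /ball /= distrC.
apply/cvgrPdist_lt => eps e0; have [d d0 Hd] := H eps e0.
suff : nbhs t [set s | s != t -> I s -> `|l - tquot u t s| < eps] by [].
apply/nbhs_ballP; exists d => //= s; rewrite /ball /= distrC => sd st Is.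
exact: Hd.
Qed.

Lemma is_dt_sub (I I' : set R) u t l : I' `<=` I -> is_dt I u t l -> is_dt I' u t l.
Proof.
move=> II /is_dt_epsP H; apply/is_dt_epsP => eps /H[d d0 Hd].
by exists d => // s /II; exact: Hd.
Qed.

Lemma derive_epsP (V : normedModType R) (f : V -> R) x v l :
  (derivable f x v /\ 'D_v f x = l) <->
  (forall eps, 0 < eps -> exists2 d, 0 < d & forall h : R, h != 0 -> `|h| < d ->
     `|l - h^-1 * (f (x + h *: v) - f x)| < eps).
Proof.
split=> [[df <-] eps e0|H].
  have H : (fun h => h^-1 *: ((f \o shift x) (h *: v) - f x)) @ 0^' --> 'D_v f x.
    exact: df.
  have /cvgrPdist_lt /(_ eps e0) /nbhs_ballP[d /= d0 Hd] := H.
  exists d => // h h0 hd; have /= := Hd h; rewrite /ball /= sub0r normrN.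
  by rewrite [h *: v + x]addrC; apply.
have Hl : (fun h => h^-1 *: ((f \o shift x) (h *: v) - f x)) @ 0^' --> l.
  apply/cvgrPdist_lt => eps e0; have [d d0 Hd] := H eps e0.
  suff : nbhs 0 [set h | h != 0 ->
    `|l - h^-1 *: ((f \o shift x) (h *: v) - f x)| < eps] by [].
  apply/nbhs_ballP; exists d => //= h; rewrite /ball /= sub0r normrN => hd h0.
  by rewrite [h *: v + x]addrC; exact: Hd.
by split; [apply/cvg_ex; exists l|exact: cvg_lim Hl].
Qed.

Lemma is_dt_line (V : normedModType R) (f : V -> R) x v r :
  derivable f (x + r *: v) v ->
  is_dt setT (fun s => f (x + s *: v)) r ('D_v f (x + r *: v)).
Proof.
move=> df; apply/is_dt_epsP => eps e0.
have [d d0 Hd] := (derive_epsP f _ v _).1 (conj df erefl) eps e0.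
exists d => // s _ sr sd; have := Hd (s - r).
by rewrite subr_eq0 -addrA -scalerDl [r + _]addrC subrK; apply.
Qed.

(** Strictly inside the segment from [a] to [b] the relative derivative is the usual one; at its
    ends only continuity is used, for which a one-sided derivative is enough. *)
Lemma MVT_dt (I : set R) (w w' : R -> R) a b : is_interval I -> I a -> I b ->
  (forall s, I s -> is_dt I w s (w' s)) ->
  exists c, [/\ I c, `|c - a| <= `|b - a| & w b - w a = w' c * (b - a)].
Proof.
move=> Iitv Ia Ib Dw.
suff {a b Ia Ib} H a b : a <= b -> I a -> I b ->
    exists c, [/\ I c, a <= c <= b & w b - w a = w' c * (b - a)].
  have [ab|/ltW ba] := leP a b.
    have [c [Ic /andP[ac cb] E]] := H a b ab Ia Ib; exists c; split => //.
    by rewrite !ger0_norm ?subr_ge0 // lerB.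
  have [c [Ic /andP[ac cb] E]] := H b a ba Ib Ia; exists c; split => //.
    by rewrite !ler0_norm ?subr_le0 // lerN2 lerB.
  by rewrite -[LHS]opprB E -mulrN opprB.
move=> ab Ia Ib.
have abI c : a <= c <= b -> I c by exact: Iitv.
have [||c] := @MVT_segment R w w' a b ab.
- move=> s /[!in_itv] /= /andP[sa sb].
  have Is : I s by apply: abI; rewrite !ltW.
  suff [d1 d2] : derivable w s 1 /\ 'D_1 w s = w' s by exact: DeriveDef.
  apply/derive_epsP => eps e0; have [d d0 Hd] := (is_dt_epsP _ _ _ _).1 (Dw s Is) _ e0.
  exists (Num.min d (Num.min (s - a) (b - s))).
    by rewrite !lt_min d0 !subr_gt0 sa sb.
  move=> h h0; rewrite !lt_min => /and3P[hd ha hb].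
  have := Hd (s + h); rewrite [_%:A]mulr1 addrAC subrr add0r; apply => //.
    apply: abI; move: ha hb; rewrite !ltr_norml => /andP[h1 h2] /andP[h3 h4].
    by apply/andP; split; lra.
  by rewrite -subr_eq0 addrAC subrr add0r.
- apply/subspace_continuousP => s /= /[!in_itv] /= /abI Is.
  have H := is_dt_cvg (Dw s Is).
  apply/cvgrPdist_lt => eps e0; have := H; move/cvgrPdist_lt => /(_ eps e0) H1.
  have {}H1 : nbhs s [set z | z != s -> I z -> `|w s - w z| < eps] by exact: H1.
  suff : nbhs s [set z | `[a, b]%classic z -> `|w s - w z| < eps] by [].
  apply: filterS H1 => z Hz; rewrite /= in_itv /= => /abI Iz.
  by have [->|zs] := eqVneq z s; [rewrite subrr normr0|exact: Hz].
- by rewrite in_itv /= => cab E; exists c; split=> //; exact: abI.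
Qed.

(** The difference quotient of [chi] is the limit, as [r] tends to 0, of a second difference
    quotient of [phi]. The mean value theorem in [s], then in [r], makes the latter a value of
    [psi'] near [(t, 0)], and [psi'] is continuous there. *)
Lemma clairaut (I : set R) (phi psi psi' : R -> R -> R) (chi : R -> R) t eps0 :
  is_interval I -> I t -> 0 < eps0 ->
  (forall s r, I s -> `|r| < eps0 -> is_dt I (phi ^~ r) s (psi s r)) ->
  (forall s r, I s -> `|r| < eps0 -> is_dt setT (psi s) r (psi' s r)) ->
  (forall s, I s -> is_dt setT (phi s) 0 (chi s)) ->
  (forall eta, 0 < eta -> exists2 d, 0 < d & forall s r, I s ->
     `|s - t| < d -> `|r| < d -> `|psi' t 0 - psi' s r| < eta) ->
  is_dt I chi t (psi' t 0).
Proof.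
move=> Iitv It eps00 H1 H2 H3 H4; apply/is_dt_epsP => eta eta0.
(* Half of [eta], since only a weak inequality survives the limit in [r]. *)
have e2 : 0 < eta / 2 by rewrite divr_gt0.
have [d d0 Hd] := H4 _ e2; exists d => // s Is st sd.
apply: (@le_lt_trans _ _ (eta / 2)); last by rewrite ltr_pdivrMr // ltr_pMr // ltr1n.
have key r : r != 0 -> `|r| < d -> `|r| < eps0 ->
   `|psi' t 0 - (s - t)^-1 * (r^-1 * (phi s r - phi s 0) - r^-1 * (phi t r - phi t 0))| <= eta / 2.
  move=> r0 rd re.
  have z0 : `|0 : R| < eps0 by rewrite normr0.
  have Dw z : I z -> is_dt I (fun z => phi z r + -1 * phi z 0) z (psi z r + -1 * psi z 0).
    move=> Iz; apply: is_dtD; first exact: H1.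
    have := is_dtM (is_dt_cst I z (-1)) (H1 z 0 Iz z0).
    by rewrite mul0r add0r.
  have [c [Ic ct]] := MVT_dt Iitv It Is Dw.
  have ballI : is_interval [set z | `|z| < eps0].
    move=> x y /=; rewrite !ltr_norml => /andP[x1 x2] /andP[y1 y2] z /andP[z1 z2].
    by rewrite /= ltr_norml; apply/andP; split; lra.
  have Dpsi z : `|z| < eps0 -> is_dt [set z | `|z| < eps0] (psi c) z (psi' c z).
    by move=> ze; apply: is_dt_sub (H2 c z Ic ze).
  have [q [_ q0]] := MVT_dt ballI (z0 : [set z | `|z| < eps0] 0) (re : [set z | `|z| < eps0] r) Dpsi.
  rewrite !subr0 in q0 *; rewrite !mulN1r => -> E.
  rewrite -mulrBr (_ : phi s r - phi s 0 - (phi t r - phi t 0) =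
    phi s r - phi s 0 - (phi t r - phi t 0)) // E.
  rewrite (_ : (s - t)^-1 * (r^-1 * (psi' c q * r * (s - t))) = psi' c q); last first.
    by field; rewrite r0 subr_eq0.
  apply: ltW; apply: Hd => //; first exact: le_lt_trans sd.
  exact: le_lt_trans rd.
have Dlim z : I z -> (fun r => r^-1 * (phi z r - phi z 0)) @ (0 : R)^' --> chi z.
  move=> /H3 /is_dt_epsP Hz; apply/cvgrPdist_lt => eps e0.
  have [d1 d10 Hd1] := Hz eps e0.
  suff : nbhs (0:R) [set r | r != 0 -> `|chi z - r^-1 * (phi z r - phi z 0)| < eps] by [].
  apply/nbhs_ballP; exists d1 => //= r; rewrite /ball /= sub0r normrN => rd r0.
  by have := Hd1 r Logic.I r0; rewrite subr0; apply.
have lim : (fun r => `|psi' t 0 - (s - t)^-1 * (r^-1 * (phi s r - phi s 0) -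
    r^-1 * (phi t r - phi t 0))|) @ (0 : R)^' -->
    `|psi' t 0 - (s - t)^-1 * (chi s - chi t)|.
  apply: cvg_norm; apply: cvgB; first exact: cvg_cst.
  by apply: cvgM; [exact: cvg_cst|apply: cvgB; exact: Dlim].
rewrite -(cvg_lim _ lim) //; apply: limr_le; first by apply/cvg_ex; eexists; exact: lim.
suff : nbhs (0:R) [set r | r != 0 -> `|psi' t 0 - (s - t)^-1 *
   (r^-1 * (phi s r - phi s 0) - r^-1 * (phi t r - phi t 0))| <= eta / 2] by [].
apply/nbhs_ballP; exists (Num.min d eps0) => /=; first by rewrite lt_min d0.
move=> r; rewrite /ball /= sub0r normrN lt_min => /andP[rd re] r0.
exact: key.
Qed.

End mixed_derivatives.

(** * Commutation of the time and space derivatives *)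

Section commuting_derivatives.
Variables (R : realType) (m : nat) (I : set R) (U : set 'rV[R]_m).
Hypotheses (I_interval : is_interval I).
Hypothesis I_nondegenerate : exists a b, [/\ I a, I b & a < b].
Hypothesis U_open : open U.
Variable u : R -> 'rV[R]_m -> R.
Hypothesis u_smooth : smooth_family I U u.
Local Notation e a := (delta_mx 0 a : 'rV[R]_m).
Local Notation elim k H := (CkS_elim (H k.+1)).

Lemma near_lines x v w eps : U x -> 0 < eps -> exists2 d, 0 < d &
  forall r s : R, `|r| < d -> `|s| < d ->
  U (x + r *: v + s *: w) /\ `|x - (x + r *: v + s *: w)| < eps.
Proof.
move=> Ux eps0; have /nbhs_ballP[e0 /= e00 He] := open_nbhs_nbhs (conj U_open Ux).
pose N := `|v| + `|w| + 1; have N0 : 0 < N by rewrite ltr_wpDl // addr_ge0.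
exists (Num.min e0 eps / N); first by rewrite divr_gt0 // lt_min e00.
move=> r s rd sd.
have H : `|x - (x + r *: v + s *: w)| < Num.min e0 eps.
  rewrite -addrA opprD addNKr normrN; apply: le_lt_trans (ler_normD _ _) _.
  rewrite !normrZ; apply: (@le_lt_trans _ _ ((Num.min e0 eps / N) * (`|v| + `|w|))).
    by rewrite mulrDr; apply: lerD; apply: ler_wpM2r => //; exact: ltW.
  rewrite -mulrA gtr_pMr ?lt_min ?e00 // mulrC ltr_pdivrMr // mul1r /N.
  by rewrite ltrDl.
by move: H; rewrite lt_min => /andP[H1 H2]; split=> //; apply: He; rewrite -ball_normE.
Qed.

Lemma jcont_lines f t x v w : Ck_family 0 I U f -> I t -> U x ->
  forall eta, 0 < eta -> exists2 d, 0 < d & forall s r q, I s ->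
    `|s - t| < d -> `|r| < d -> `|q| < d ->
    `|f t x - f s (x + r *: v + q *: w)| < eta.
Proof.
move=> [/jcontP cf _] It Ux eta eta0.
have /cvgrPdist_lt /(_ eta eta0) H := cf t x It Ux.
have {H} : nbhs (t, x) [set z | (I `*` U) z -> `|f t x - f z.1 z.2| < eta] by exact: H.
move=> /nbhs_ballP[d /= d0 Hd].
have [d' d'0 Hd'] := near_lines v w Ux d0.
exists (Num.min d d'); first by rewrite lt_min d0.
move=> s r q Is; rewrite !lt_min => /andP[sd _] /andP[_ rd] /andP[_ qd].
have [Uy yd] := Hd' r q rd qd.
by apply: (Hd (s, _)) => //; split=> /=; rewrite -ball_normE /= ?[`|t - s|]distrC.
Qed.

Lemma pd_dt a t x : I t -> U x ->
  is_dt I (fun s => pd a (u s) x) t (pd a (fun y => dt I (u ^~ y) t) x).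
Proof.
move=> It Ux; have [_ Dt Ct Dx _] := elim 1 u_smooth.
have [_ _ _ Dxt Ctx] := CkS_elim Ct.
have [d d0 Hd] := near_lines (e a) 0 Ux ltr01.
have Ur r : `|r| < d -> U (x + r *: e a).
  move=> rd; have [] := Hd r 0 rd; first by rewrite normr0.
  by rewrite scale0r addr0.
pose psi' s r := pd a (fun y => dt I (u ^~ y) s) (x + r *: e a).
have -> : pd a (fun y => dt I (u ^~ y) t) x = psi' t 0.
  by rewrite /psi' scale0r addr0.
apply: (@clairaut _ I (fun s r => u s (x + r *: e a))
  (fun s r => dt I (u ^~ (x + r *: e a)) s) psi' _ t d) => //.
- by move=> s r Is /Ur Uy; exact: Dt.
- move=> s r Is /Ur Uy; have [df _] := Dxt a s _ Is Uy.
  exact: (is_dt_line df).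
- move=> s Is; have [df _] := Dx a s x Is Ux.
  have := @is_dt_line _ _ (u s) x (e a) 0; rewrite scale0r addr0; apply.
  exact: df.
- move=> eta eta0; have [d' d'0 Hd'] := jcont_lines (e a) 0 (Ctx a) It Ux eta0.
  exists d' => // s r Is sd rd; rewrite {1}/psi' scale0r addr0.
  by have := Hd' s r 0 Is sd rd; rewrite scaler0 addr0 normr0; exact.
Qed.

Lemma dt_pdC a t x : I t -> U x ->
  dt I (fun s => pd a (u s) x) t = pd a (fun y => dt I (u ^~ y) t) x.
Proof. by move=> It Ux; apply: is_dt_unique => //; exact: pd_dt. Qed.

(** [clairaut] again, with a small interval [B] of parameters on the line in the direction [b] in
    the role of time. *)
Lemma pdC a b t x : I t -> U x -> pd a (pd b (u t)) x = pd b (pd a (u t)) x.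
Proof.
move=> It Ux; have [_ _ _ Dx Cx] := elim 1 u_smooth.
have [_ _ _ Dxb Cxb] := CkS_elim (Cx b); have [_ _ _ Dxa _] := CkS_elim (Cx a).
have [d d0 Hd] := near_lines (e a) (e b) Ux ltr01.
have Ur r s : `|r| < d -> `|s| < d -> U (x + r *: e a + s *: e b).
  by move=> rd sd; have [] := Hd r s rd sd.
pose B := [set s : R | `|s| < d].
have B0 : B 0 by rewrite /B /= normr0.
have Bitv : is_interval B.
  move=> y z; rewrite /B /= !ltr_norml => /andP[x1 x2] /andP[y1 y2] q /andP[z1 z2].
  by rewrite ltr_norml; apply/andP; split; lra.
have Bnd : exists a b, [/\ B a, B b & a < b].
  exists 0, (d / 2); split; rewrite /B /= ?normr0 ?divr_gt0 //.
  by rewrite gtr0_norm ?divr_gt0 // ltr_pdivrMr // ltr_pMr // ltr1n.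
have line f c y : derivable f y (e c) ->
    is_dt setT (fun s => f (y + s *: e c)) 0 (pd c f y).
  by move=> df; have := @is_dt_line _ _ f y (e c) 0; rewrite scale0r addr0; exact.
have U0 s : `|s| < d -> U (x + s *: e b).
  by move=> sd; have := Ur 0 s; rewrite normr0 scale0r addr0; exact.
have swap r s : x + r *: e a + s *: e b = x + s *: e b + r *: e a.
  by rewrite addrAC.
pose psi' s r := pd a (pd b (u t)) (x + r *: e a + s *: e b).
have psiE s r : psi' s r = pd a (pd b (u t)) (x + r *: e a + s *: e b) by [].
clearbody psi'.
have E : pd a (pd b (u t)) x = psi' 0 0 by rewrite psiE !scale0r !addr0.
have H1 : is_dt B (fun s => pd a (u t) (x + s *: e b)) 0 (psi' 0 0).
  apply: (@clairaut _ B (fun s r => u t (x + r *: e a + s *: e b))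
    (fun s r => pd b (u t) (x + r *: e a + s *: e b)) psi' _ 0 d) => //.
  - move=> s r /= sd rd; apply: (is_dt_sub (@subsetT _ B)).
    exact: (is_dt_line (Dx b t _ It (Ur r s rd sd)).1).
  - move=> s r /= sd rd.
    rewrite (_ : (fun r => pd b (u t) (x + r *: e a + s *: e b)) =
      fun r => pd b (u t) (x + s *: e b + r *: e a)); last first.
      by apply/funext => q; rewrite swap.
    have Uy := Ur r s rd sd; rewrite swap in Uy; rewrite psiE swap.
    exact: (is_dt_line (Dxb a t _ It Uy).1).
  - move=> s /= sd.
    rewrite (_ : (fun r => u t (x + r *: e a + s *: e b)) =
      fun r => u t (x + s *: e b + r *: e a)); last first.
      by apply/funext => q; rewrite swap.
    exact: (line _ a _ (Dx a t _ It (U0 s sd)).1).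
  - move=> eta eta0; have [d' d'0 Hd'] := jcont_lines (e a) (e b) (Cxb a) It Ux eta0.
    exists d' => // s r _; rewrite subr0 => sd rd; rewrite !psiE !scale0r !addr0.
    by apply: Hd' => //; rewrite subrr normr0.
have H2 : is_dt B (fun s => pd a (u t) (x + s *: e b)) 0 (pd b (pd a (u t)) x).
  exact: (is_dt_sub (@subsetT _ B) (line _ b x (Dxa b t x It Ux).1)).
have e1 := is_dt_unique Bitv Bnd B0 H1; have e2 := is_dt_unique Bitv Bnd B0 H2.
rewrite E -e1; exact: e2.
Qed.

End commuting_derivatives.

(** Bundled with its properties, so that the ring structure on families depends on a single
    parameter. *)
Record time_domain (R : realType) (m : nat) := TimeDomain {
  time_of : set R;
  space_of : set 'rV[R]_m;
  time_interval : is_interval time_of;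
  time_nondegenerate : exists a b, [/\ time_of a, time_of b & a < b];
  space_open : open space_of }.

Arguments time_of {R m} _.
Arguments space_of {R m} _.
Arguments time_interval {R m} _.
Arguments time_nondegenerate {R m} _.
Arguments space_open {R m} _.

(** * The ring of smooth families and its derivations *)

Section smooth_family_ring.
Variables (R : realType) (m : nat) (Dm : time_domain R m).
Local Notation I := (time_of Dm).
Local Notation U := (space_of Dm).
Let Iitv := time_interval Dm.
Let Ind := time_nondegenerate Dm.
Let oU := space_open Dm.

(* Families vanish outside I x U, so that equality on I x U is equality. *)
Record sfam := SFam {
  sfun :> R -> 'rV[R]_m -> R;
  sfun_smooth : smooth_family I U sfun;
  sfun_out : forall t x, ~ (I t /\ U x) -> sfun t x = 0 }.

Definition extend0 (f : R -> 'rV[R]_m -> R) t x :=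
  if `[< I t /\ U x >] then f t x else 0.

Lemma extend0E f t x : I t -> U x -> extend0 f t x = f t x.
Proof. by move=> It Ux; rewrite /extend0 asboolT. Qed.

Lemma extend0_smooth f : smooth_family I U f -> smooth_family I U (extend0 f).
Proof.
move=> fs k; apply: (Ck_family_ext Iitv Ind oU _ (fs k)) => t x It Ux.
by rewrite extend0E.
Qed.

Lemma extend0_out f t x : ~ (I t /\ U x) -> extend0 f t x = 0.
Proof. by move=> H; rewrite /extend0 asboolF. Qed.

Definition mk_sfam f (fs : smooth_family I U f) : sfam :=
  SFam (extend0_smooth fs) (@extend0_out f).

Lemma mk_sfamE f (fs : smooth_family I U f) t x : I t -> U x ->
  mk_sfam fs t x = f t x.
Proof. exact: extend0E. Qed.

Lemma sfam_eq (f h : sfam) : (forall t x, I t -> U x -> f t x = h t x) -> f = h.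
Proof.
move=> fh; have E : sfun f = sfun h.
  apply/funext => t; apply/funext => x.
  have [[It Ux]|H] := pselect (I t /\ U x); first exact: fh.
  by rewrite !sfun_out.
case: f h {fh} E => f fs fo [h hs ho] /= E; case: _ / E hs ho => hs ho.
by congr SFam; exact: Prop_irrelevance.
Qed.

HB.instance Definition _ := gen_eqMixin sfam.
HB.instance Definition _ := gen_choiceMixin sfam.

Lemma smooth_cst c : smooth_family I U (fun _ _ => c).
Proof. by move=> k; exact: Ck_family_cst. Qed.

Definition sfam_cst c := mk_sfam (smooth_cst c).

Lemma smoothD (f h : sfam) : smooth_family I U (fun t x => f t x + h t x).
Proof. by move=> k; apply: Ck_familyD => //; exact: sfun_smooth. Qed.

Lemma smoothM (f h : sfam) : smooth_family I U (fun t x => f t x * h t x).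
Proof. by move=> k; apply: Ck_familyM => //; exact: sfun_smooth. Qed.

Definition sfam_add f h := mk_sfam (smoothD f h).
Definition sfam_mul f h := mk_sfam (smoothM f h).
Definition sfam_opp f := sfam_mul (sfam_cst (-1)) f.

Lemma sfam_addE f h t x : sfam_add f h t x = f t x + h t x.
Proof.
have [[It Ux]|H] := pselect (I t /\ U x); first exact: mk_sfamE.
by rewrite !sfun_out // addr0.
Qed.

Lemma sfam_mulE f h t x : sfam_mul f h t x = f t x * h t x.
Proof.
have [[It Ux]|H] := pselect (I t /\ U x); first exact: mk_sfamE.
by rewrite !sfun_out // mulr0.
Qed.

Lemma sfam_cstE c t x : I t -> U x -> sfam_cst c t x = c.
Proof. exact: mk_sfamE. Qed.

Lemma sfam_oppE f t x : sfam_opp f t x = - f t x.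
Proof.
rewrite sfam_mulE; have [[It Ux]|H] := pselect (I t /\ U x).
  by rewrite sfam_cstE // mulN1r.
by rewrite !sfun_out // mulr0 oppr0.
Qed.

Lemma sfam_addA : associative sfam_add.
Proof. by move=> f h k; apply: sfam_eq => t x _ _; rewrite !sfam_addE addrA. Qed.
Lemma sfam_addC : commutative sfam_add.
Proof. by move=> f h; apply: sfam_eq => t x _ _; rewrite !sfam_addE addrC. Qed.
Lemma sfam_add0 : left_id (sfam_cst 0) sfam_add.
Proof.
by move=> f; apply: sfam_eq => t x It Ux; rewrite sfam_addE sfam_cstE // add0r.
Qed.
Lemma sfam_addN : left_inverse (sfam_cst 0) sfam_opp sfam_add.
Proof.
move=> f; apply: sfam_eq => t x It Ux.
by rewrite sfam_addE sfam_oppE sfam_cstE // addNr.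
Qed.
HB.instance Definition _ :=
  GRing.isZmodule.Build sfam sfam_addA sfam_addC sfam_add0 sfam_addN.

Lemma sfam_mulA : associative sfam_mul.
Proof. by move=> f h k; apply: sfam_eq => t x _ _; rewrite !sfam_mulE mulrA. Qed.
Lemma sfam_mulC : commutative sfam_mul.
Proof. by move=> f h; apply: sfam_eq => t x _ _; rewrite !sfam_mulE mulrC. Qed.
Lemma sfam_mul1 : left_id (sfam_cst 1) sfam_mul.
Proof.
by move=> f; apply: sfam_eq => t x It Ux; rewrite sfam_mulE sfam_cstE // mul1r.
Qed.
Lemma sfam_mulDl : left_distributive sfam_mul +%R.
Proof.
move=> f h k; apply: sfam_eq => t x It Ux.
by rewrite [LHS]sfam_mulE ![in RHS]sfam_addE ![sfam_add _ _ t x]sfam_addE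
  !sfam_mulE mulrDl.
Qed.
HB.instance Definition _ :=
  GRing.Zmodule_isComPzRing.Build sfam sfam_mulA sfam_mulC sfam_mul1 sfam_mulDl.

Implicit Types f h : sfam.

Lemma evD f h t x : (f + h) t x = f t x + h t x. Proof. exact: sfam_addE. Qed.
Lemma evM f h t x : (f * h) t x = f t x * h t x. Proof. exact: sfam_mulE. Qed.
Lemma evN f t x : (- f) t x = - f t x. Proof. exact: sfam_oppE. Qed.
Lemma ev0 t x : (0 : sfam) t x = 0.
Proof.
have [[It Ux]|H] := pselect (I t /\ U x); first exact: sfam_cstE.
by rewrite sfun_out.
Qed.
Lemma ev1 t x : I t -> U x -> (1 : sfam) t x = 1. Proof. exact: sfam_cstE. Qed.

Lemma ev_sum (T : Type) (r : seq T) (p : pred T) (f : T -> sfam) t x :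
  (\sum_(i <- r | p i) f i) t x = \sum_(i <- r | p i) f i t x.
Proof. by apply: (big_morph (fun f : sfam => f t x)) => [f' h'|]; [exact: evD|exact: ev0]. Qed.

Lemma ev_nat n t x : I t -> U x -> (n%:R : sfam) t x = n%:R.
Proof.
move=> It Ux; elim: n => [|n IH]; first exact: ev0.
by rewrite -addn1 !natrD evD IH ev1.
Qed.

Lemma sfam_two_inj f : f + f = 0 -> f = 0.
Proof.
move=> ff; apply: sfam_eq => t x _ _; rewrite ev0.
have : (f + f) t x = 0 by rewrite ff ev0.
by rewrite evD; lra.
Qed.

Definition sfam_pd a f := mk_sfam (smooth_family_pd a (sfun_smooth f)).
Definition sfam_dt f := mk_sfam (smooth_family_dt (sfun_smooth f)).

Lemma sfam_pdE a f t x : I t -> U x -> sfam_pd a f t x = pd a (f t) x.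
Proof. exact: mk_sfamE. Qed.

Lemma sfam_dtE f t x : I t -> U x -> sfam_dt f t x = dt I (f ^~ x) t.
Proof. exact: mk_sfamE. Qed.

Lemma sfam_derivable f a t x : I t -> U x -> derivable (f t) x (delta_mx 0 a).
Proof.
by move=> It Ux; have [_ _ _ H _] := CkS_elim (sfun_smooth f 1); have [] := H a t x It Ux.
Qed.

Lemma sfam_is_dt f t x : I t -> U x -> is_dt I (f ^~ x) t (dt I (f ^~ x) t).
Proof. by move=> It Ux; have [_ H _ _ _] := CkS_elim (sfun_smooth f 1); exact: H. Qed.

Lemma sfam_pdD a f h : sfam_pd a (f + h) = sfam_pd a f + sfam_pd a h.
Proof.
apply: sfam_eq => t x It Ux; rewrite evD !sfam_pdE //.
have df := @sfam_derivable f a t x It Ux; have dh := @sfam_derivable h a t x It Ux.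
have := deriveD df dh.
rewrite (_ : (f t + h t)%R = (f + h) t); last by apply/funext => y; rewrite evD.
by rewrite /pd => ->.
Qed.

Lemma sfam_pdM a f h : sfam_pd a (f * h) = sfam_pd a f * h + f * sfam_pd a h.
Proof.
apply: sfam_eq => t x It Ux; rewrite evD !evM !sfam_pdE //.
have df := @sfam_derivable f a t x It Ux; have dh := @sfam_derivable h a t x It Ux.
have := deriveM df dh.
rewrite (_ : (f t * h t)%R = (f * h) t); last by apply/funext => y; rewrite evM.
by rewrite /pd => ->; rewrite addrC [h t x *: _]mulrC.
Qed.

Lemma sfam_pdC a b f : sfam_pd a (sfam_pd b f) = sfam_pd b (sfam_pd a f).
Proof.
have E c e t x : I t -> U x -> sfam_pd c (sfam_pd e f) t x = pd c (pd e (f t)) x.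
  move=> It Ux; rewrite sfam_pdE // /pd; apply: near_eq_derive.
  by have := open_nbhs_nbhs (conj oU Ux); apply: filterS => y Uy; rewrite sfam_pdE.
apply: sfam_eq => t x It Ux; apply: etrans (E a b t x It Ux) _.
apply: etrans (esym (E b a t x It Ux)).
exact: (pdC oU (sfun_smooth f) a b It Ux).
Qed.

Lemma sfam_dtD f h : sfam_dt (f + h) = sfam_dt f + sfam_dt h.
Proof.
apply: sfam_eq => t x It Ux; rewrite evD !sfam_dtE //.
have df := @sfam_is_dt f t x It Ux; have dh := @sfam_is_dt h t x It Ux.
apply: (is_dt_unique Iitv Ind It); apply: is_dt_ext (is_dtD df dh) => // s Is.
by rewrite evD.
Qed.

Lemma sfam_dtM f h : sfam_dt (f * h) = sfam_dt f * h + f * sfam_dt h.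
Proof.
apply: sfam_eq => t x It Ux; rewrite evD !evM !sfam_dtE //.
have df := @sfam_is_dt f t x It Ux; have dh := @sfam_is_dt h t x It Ux.
apply: (is_dt_unique Iitv Ind It); apply: is_dt_ext (is_dtM df dh) => // s Is.
by rewrite evM.
Qed.

Lemma sfam_dt_pd a f : sfam_dt (sfam_pd a f) = sfam_pd a (sfam_dt f).
Proof.
apply: sfam_eq => t x It Ux.
have e1 : dt I (fun s => pd a (f s) x) t = dt I (sfam_pd a f ^~ x) t.
  have H := @sfam_is_dt (sfam_pd a f) t x It Ux.
  apply: (is_dt_unique Iitv Ind It); apply: is_dt_ext H => // s Is.
  exact: sfam_pdE.
have e2 := dt_pdC Iitv Ind oU (sfun_smooth f) a It Ux.
have e3 : pd a (fun y => dt I (f ^~ y) t) x = pd a (sfam_dt f t) x.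
  rewrite /pd; apply: near_eq_derive.
  by have := open_nbhs_nbhs (conj oU Ux); apply: filterS => y Uy; rewrite sfam_dtE.
apply: etrans (sfam_dtE (sfam_pd a f) It Ux) _.
apply: etrans _ (esym (sfam_pdE a (sfam_dt f) It Ux)).
exact: etrans (esym e1) (etrans e2 e3).
Qed.

End smooth_family_ring.

#[local] Opaque pd dt sfam_pd sfam_dt.

(** * Evaluation at a point and inversion of matrices of families *)

Section smooth_family_matrices.
Variables (R : realType) (m : nat) (Dm : time_domain R m).
Local Notation I := (time_of Dm).
Local Notation U := (space_of Dm).
Local Notation F := (sfam Dm).

Lemma sfam_pd_ev a (f : F) h t x : I t -> U x -> (forall y, U y -> f t y = h y) ->
  sfam_pd a f t x = pd a h x.
Proof.
move=> It Ux fh; apply: etrans (sfam_pdE a f It Ux) _; apply: near_eq_derive.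
by have := open_nbhs_nbhs (conj (space_open Dm) Ux); apply: filterS => y Uy; exact: fh.
Qed.

Lemma sfam_dt_ev (f : F) h t x : I t -> U x -> (forall s, I s -> f s x = h s) ->
  sfam_dt f t x = dt I h t.
Proof.
move=> It Ux fh; apply: etrans (sfam_dtE f It Ux) _; apply/esym.
apply: (is_dt_unique (time_interval Dm) (time_nondegenerate Dm) It).
apply: is_dt_ext (@sfam_is_dt _ _ _ f t x It Ux) => //.
Qed.

Lemma sfam_derivations : derivations (@sfam_pd R m Dm).
Proof. by split; [exact: sfam_pdD|exact: sfam_pdM|exact: sfam_pdC]. Qed.

(** The membership proof is an argument because evaluation is a ring morphism only inside the
    domain: elsewhere all families, including 1, vanish. *)
Definition at_point (t : R) x (p : I t /\ U x) (f : F) : R := f t x.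

Section at_point.
Variables (t : R) (x : 'rV[R]_m) (p : I t /\ U x).

Lemma at_point_additive : zmod_morphism (at_point p).
Proof. by move=> f h; rewrite /at_point evD evN. Qed.

Lemma at_point_multiplicative : monoid_morphism (at_point p).
Proof. by case: p => It Ux; split=> [|f h]; rewrite /at_point ?ev1 ?evM. Qed.

HB.instance Definition _ := GRing.isZmodMorphism.Build F R (at_point p) at_point_additive.
HB.instance Definition _ := GRing.isMonoidMorphism.Build F R (at_point p) at_point_multiplicative.
End at_point.

Lemma det_inv_smooth (g : 'M[F]_m) :
  (forall t x (p : I t /\ U x), map_mx (at_point p) g \in unitmx) ->
  smooth_family I U (fun t x => (\det g t x)^-1).
Proof.
move=> gu k; apply: Ck_familyV.
- exact: time_interval.
- exact: time_nondegenerate.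
- exact: space_open.
- move=> t x It Ux; have := gu t x (conj It Ux).
  by rewrite unitmxE det_map_mx unitfE.
- exact: sfun_smooth.
Qed.

(** Cramer's formula: the determinant may be inverted pointwise, since it vanishes nowhere on the
    domain. *)
Definition sfam_minv (g : 'M[F]_m) gu : 'M[F]_m :=
  mk_sfam (@det_inv_smooth g gu) *: \adj g.

Lemma sfam_minvK g gu : @sfam_minv g gu *m g = 1%:M.
Proof.
rewrite /sfam_minv -scalemxAl mul_adj_mx scale_scalar_mx; congr (_%:M).
apply: sfam_eq => t x It Ux; rewrite evM mk_sfamE // ev1 // mulVf //.
by have := gu t x (conj It Ux); rewrite unitmxE det_map_mx unitfE.
Qed.

Lemma sfam_minv_ev g gu t x : I t -> U x -> forall i j, @sfam_minv g gu i j t x =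
  invmx (\matrix_(i, j) g i j t x) i j.
Proof.
move=> It Ux i j; pose p := conj It Ux.
have E : map_mx (at_point p) (sfam_minv gu) *m map_mx (at_point p) g = 1%:M.
  by rewrite -map_mxM sfam_minvK map_mx1.
have -> : \matrix_(i, j) g i j t x = map_mx (at_point p) g.
  by apply/matrixP => k l; rewrite !mxE.
have [u1 u2] := mulmx1_unit E.
transitivity (map_mx (at_point p) (sfam_minv gu) i j); first by rewrite [RHS]mxE.
by rewrite -[invmx _]mul1mx -E -mulmxA mulmxV // mulmx1.
Qed.

End smooth_family_matrices.

(** * The flow in a chart *)

Section geometry_in_chart.
Variables (R : realType) (m : nat) (M : smooth_manifold R m) (I : set R).
Hypothesis I_interval : is_interval I.
Hypothesis I_nondegenerate : exists a b, [/\ I a, I b & a < b].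
Variables (S : R -> almost_kahler M) (D Ups : R -> christoffel M).
Hypothesis D_levi_civita : forall t, I t -> is_levi_civita (S t) (D t).
Hypothesis Ups_chern : forall t, I t -> is_chern (S t) (Ups t).
Variable c : chart M.
Local Notation U := (cdom c).
Local Notation pt := 'rV[R]_m.

Definition chart_domain := TimeDomain I_interval I_nondegenerate (@codom_open _ _ M c).
Local Notation Dm := chart_domain.
Local Notation F := (sfam Dm).
Local Notation pdF := (@sfam_pd R m Dm).

Lemma nabla1E (G : christoffel M) (W : components R m) a i x :
  nabla G c W [:: a; i] [::] x =
  pd a (W [:: i] [::]) x - \sum_e G c x a i e * W [:: e] [::] x.
Proof. by rewrite /nabla /= big_ord0 addr0 big_ord_recl big_ord0 addr0. Qed.

Lemma nabla2E (G : christoffel M) (W : components R m) a i j x :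
  nabla G c W [:: a; i; j] [::] x =
  pd a (W [:: i; j] [::]) x - \sum_e G c x a i e * W [:: e; j] [::] x
  - \sum_e G c x a j e * W [:: i; e] [::] x.
Proof.
by rewrite /nabla /= big_ord0 addr0 !big_ord_recl big_ord0 addr0 opprD addrA.
Qed.

Lemma nabla3E (G : christoffel M) (W : components R m) a i j k x :
  nabla G c W [:: a; i; j; k] [::] x =
  pd a (W [:: i; j; k] [::]) x - \sum_e G c x a i e * W [:: e; j; k] [::] x
  - \sum_e G c x a j e * W [:: i; e; k] [::] x
  - \sum_e G c x a k e * W [:: i; j; e] [::] x.
Proof.
by rewrite /nabla /= big_ord0 addr0 !big_ord_recl big_ord0 addr0 !opprD !addrA.
Qed.

Lemma nabla4E (G : christoffel M) (W : components R m) a i j k l x :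
  nabla G c W [:: a; i; j; k; l] [::] x =
  pd a (W [:: i; j; k; l] [::]) x - \sum_e G c x a i e * W [:: e; j; k; l] [::] x
  - \sum_e G c x a j e * W [:: i; e; k; l] [::] x
  - \sum_e G c x a k e * W [:: i; j; e; l] [::] x
  - \sum_e G c x a l e * W [:: i; j; k; e] [::] x.
Proof.
by rewrite /nabla /= big_ord0 addr0 !big_ord_recl big_ord0 addr0 !opprD !addrA.
Qed.

Lemma nabla11E (G : christoffel M) (A : pt -> 'M[R]_m) i j k x :
  nabla G c (comp11 A) [:: i; j] [:: k] x =
  pd i (fun y => A y j k) x - \sum_e G c x i j e * A x e k
  + \sum_e G c x i e k * A x j e.
Proof. by rewrite /nabla /= !big_ord_recl !big_ord0 !addr0. Qed.

Definition frozen (f : pt -> R) (fs : smooth U f) : F :=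
  @mk_sfam R m Dm (fun=> f)
    (smooth_const_family I_interval I_nondegenerate (@codom_open _ _ M c) fs).

Lemma frozenE f (fs : smooth U f) t x : I t -> U x -> frozen fs t x = f x.
Proof. by move=> It Ux; apply: (@mk_sfamE R m Dm). Qed.

Section time_change.
(* sigma is the identity for the flow, and constant for the geometry at one
   time. *)
Variable sigma : R -> R.
Hypothesis sigmaI : forall t, I t -> I (sigma t).
Variables (g J : 'M[F]_m) (G L : 'I_m -> 'I_m -> 'I_m -> F).
Hypothesis gE : forall t x, I t -> U x -> forall i j, g i j t x = metric (S (sigma t)) c x i j.
Hypothesis JE : forall t x, I t -> U x -> forall i j, J i j t x = acs (S (sigma t)) c x i j.
Hypothesis GE : forall t x, I t -> U x -> forall i j k, G i j k t x = Ups (sigma t) c x i j k.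
Hypothesis LE : forall t x, I t -> U x -> forall i j k, L i j k t x = D (sigma t) c x i j k.

Lemma metric_unit (K : almost_kahler M) x : U x -> metric K c x \in unitmx.
Proof.
move=> Ux; rewrite -row_free_unit -kermx_eq0; apply/eqP/row_matrixP => i.
rewrite row0; apply/eqP; apply: contraT => v0.
have := metric_pos K Ux v0.
have -> : row i (kermx (metric K c x)) *m metric K c x = 0.
  by rewrite -row_mul mulmx_ker row0.
by rewrite mul0mx mxE ltxx.
Qed.

Lemma family_unit t x (p : I t /\ U x) : map_mx (at_point (Dm := Dm) p) g \in unitmx.
Proof.
have -> : map_mx (at_point (Dm := Dm) p) g = metric (S (sigma t)) c x.
  by apply/matrixP => i j; rewrite mxE /at_point gE //; case: p.
by apply: metric_unit; case: p.
Qed.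

Definition family_inv : 'M[F]_m := @sfam_minv R m Dm g family_unit.

Lemma family_invE t x : I t -> U x -> forall i j,
  family_inv i j t x = ginv (S (sigma t)) c x i j.
Proof.
move=> It Ux i j; rewrite (@sfam_minv_ev R m Dm) // /ginv.
rewrite (_ : \matrix_(i, j) g i j t x = metric (S (sigma t)) c x) //.
by apply/matrixP => k l; rewrite mxE gE.
Qed.

Lemma family_omega t x : I t -> U x -> forall i j,
  c_omega g J i j t x = omega (S (sigma t)) c x i j.
Proof.
move=> It Ux i j; rewrite mxE ev_sum (omegaE (S (sigma t)) Ux); apply: eq_bigr => a _.
by rewrite evM JE // gE.
Qed.

Lemma family_ak : coord_ak pdF g family_inv J G L.
Proof.
have ex (f h : F) : (forall t x, I t -> U x -> f t x = h t x) -> f = h.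
  by move=> fh; apply: sfam_eq.
have pdE (f : F) (h : R -> pt -> R) a t x : I t -> U x ->
    (forall y, U y -> f t y = h t y) -> pdF a f t x = pd a (h t) x.
  by move=> It Ux fh; apply: sfam_pd_ev.
split.
- exact: sfam_derivations.
- exact: sfam_two_inj.
- move=> i j; apply: ex => t x It Ux; rewrite !gE //.
  by rewrite -[in LHS](metric_sym (S (sigma t)) Ux) mxE.
- exact: sfam_minvK.
- apply/matrixP => i j; apply: ex => t x It Ux.
  have := congr1 (fun A : 'M[R]_m => A i j) (acs_sqr (S (sigma t)) Ux).
  rewrite !mxE evN ev_sum; case: (_ == _); rewrite ?ev1 ?ev0 // => <-;
    by apply: eq_bigr => k _; rewrite evM !JE.
- apply/matrixP => i j; apply: ex => t x It Ux.
  have := congr1 (fun A : 'M[R]_m => A i j) (acs_isometry (S (sigma t)) Ux).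
  rewrite !mxE ev_sum gE // => <-; apply: eq_bigr => k _.
  rewrite !mxE evM ev_sum JE //; congr (_ * _); apply: eq_bigr => l _.
  by rewrite evM JE // gE.
- move=> i j k; apply: ex => t x It Ux.
  have [_ H _ _] := Ups_chern (sigmaI It); have := H c x Ux i j k.
  rewrite nabla2E /comp20 => E; rewrite ev0 -[RHS]E !evD !evN !ev_sum.
  congr (_ - _ - _).
  + by apply: sfam_pd_ev => // y Uy; exact: family_omega.
  + by apply: eq_bigr => e _; rewrite evM GE // family_omega.
  + by apply: eq_bigr => e _; rewrite evM GE // family_omega.
- move=> i j k; apply: ex => t x It Ux.
  have [_ _ H _] := Ups_chern (sigmaI It); have := H c x Ux i j k.
  rewrite nabla11E => E; rewrite ev0 -[RHS]E !evD !evN !ev_sum.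
  congr (_ - _ + _).
  + by apply: sfam_pd_ev => // y Uy; exact: JE.
  + by apply: eq_bigr => e _; rewrite evM GE // JE.
  + by apply: eq_bigr => e _; rewrite evM GE // JE.
- move=> i j k; apply: ex => t x It Ux.
  have [_ _ _ H] := Ups_chern (sigmaI It); have := H c x Ux i j k.
  rewrite /torsion => E; rewrite !evD !evN !GE // E; congr (- _).
  rewrite ev_sum; apply: eq_bigr => a _; rewrite ev_sum; apply: eq_bigr => b _.
  by rewrite !evM evD evN !JE // !GE.
- move=> i j k; apply: ex => t x It Ux; rewrite !evD ev0.
  rewrite -[RHS](omega_closed (S (sigma t)) Ux i j k).
  by congr (_ + _ + _); apply: sfam_pd_ev => // y Uy; exact: family_omega.
- move=> i j k; apply: ex => t x It Ux.
  have [_ H _] := D_levi_civita (sigmaI It); have := H c x Ux i j k.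
  by rewrite /torsion evD evN !LE // ev0.
- move=> i j k; apply: ex => t x It Ux.
  have [_ _ H] := D_levi_civita (sigmaI It); have := H c x Ux i j k.
  rewrite nabla2E /comp20 => E; rewrite ev0 -[RHS]E !evD !evN !ev_sum.
  congr (_ - _ - _).
  + by apply: sfam_pd_ev => // y Uy; exact: gE.
  + by apply: eq_bigr => e _; rewrite evM LE // gE.
  + by apply: eq_bigr => e _; rewrite evM LE // gE.
Qed.

End time_change.
End geometry_in_chart.

#[local] Opaque pd dt sfam_pd sfam_dt sfam_mul sfam_add sfam_opp sfam_cst mk_sfam frozen.

(** * Smooth dependence of the metric and of the connections on time *)

Section flow_families.
Variables (R : realType) (m : nat) (M : smooth_manifold R m) (I : set R).
Hypothesis I_interval : is_interval I.
Hypothesis I_nondegenerate : exists a b, [/\ I a, I b & a < b].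
Variables (S : R -> almost_kahler M) (D Ups : R -> christoffel M).
Hypothesis D_levi_civita : forall t, I t -> is_levi_civita (S t) (D t).
Hypothesis Ups_chern : forall t, I t -> is_chern (S t) (Ups t).
Variable c : chart M.
Local Notation U := (cdom c).
Local Notation Dm := (chart_domain I_interval I_nondegenerate c).
Local Notation F := (sfam Dm).
Local Notation pdF := (@sfam_pd R m Dm).
Local Notation cst := (@sfam_cst R m Dm).

Hypothesis omega_smooth : forall i j,
  smooth_family I U (fun t x => omega (S t) c x i j).
Hypothesis acs_smooth_t : forall i k,
  smooth_family I U (fun t x => acs (S t) c x i k).

Definition fam_J : 'M[F]_m := \matrix_(i, k) @mk_sfam R m Dm _ (acs_smooth_t i k).
(** The flow provides smoothness in time of $\omega$ and $J$ only; the metric is recovered as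
    $g_{ij}=-J_i^a\omega_{aj}$. *)
Definition fam_g : 'M[F]_m :=
  \matrix_(i, j) - \sum_a fam_J i a * @mk_sfam R m Dm _ (omega_smooth a j).

Lemma fam_JE t x : I t -> U x -> forall i j, fam_J i j t x = acs (S t) c x i j.
Proof. by move=> It Ux i j; rewrite mxE (@mk_sfamE R m Dm). Qed.

Lemma fam_gE t x : I t -> U x -> forall i j, fam_g i j t x = metric (S t) c x i j.
Proof.
move=> It Ux i j; rewrite mxE evN ev_sum.
transitivity (- \sum_b (acs (S t) c x *m acs (S t) c x) i b * metric (S t) c x j b).
  congr (- _).
  transitivity (\sum_a acs (S t) c x i a *
      \sum_b acs (S t) c x a b * metric (S t) c x j b).
    apply: eq_bigr => a _.
    by rewrite evM fam_JE // (@mk_sfamE R m Dm) // (omegaE (S t) Ux).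
  under eq_bigr => a _ do rewrite mulr_sumr.
  rewrite exchange_big; apply: eq_bigr => b _; rewrite mxE mulr_suml.
  by apply: eq_bigr => a _; rewrite mulrA.
rewrite (acs_sqr (S t) Ux) (bigD1 i) //= big1 => [|b bi].
  by rewrite !mxE eqxx mulN1r addr0 opprK -[in LHS](metric_sym (S t) Ux) mxE.
by rewrite !mxE eq_sym (negbTE bi) /= oppr0 mul0r.
Qed.

Let half : F := cst 2^-1.

Definition fam_gi : 'M[F]_m := @family_inv R m M I I_interval I_nondegenerate S c id fam_g fam_gE.

Lemma fam_giE t x : I t -> U x -> forall i j, fam_gi i j t x = ginv (S t) c x i j.
Proof. by move=> It Ux; apply: family_invE. Qed.

(** [fam_L] and [fam_G] are the right-hand sides of [christoffel_formula] and [chern_formula],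
    halved; they are smooth in time by construction. *)
Definition fam_L i j l : F := half *
  \sum_k (pdF i (fam_g j k) + pdF j (fam_g i k) - pdF k (fam_g i j)) * fam_gi k l.
Definition fam_G i l k : F := fam_L i l k +
  half * \sum_j fam_J l j * c_nabJ pdF fam_J fam_L i j k.

#[local] Opaque fam_J fam_g fam_gi.

Section frozen.
Variables (t : R) (It : I t).
Local Notation frz := (@frozen R m M I I_interval I_nondegenerate c).

Let gz : 'M[F]_m := \matrix_(i, j) frz (metric_smooth (S t) c i j).
Let Jz : 'M[F]_m := \matrix_(i, j) frz (acs_smooth (S t) c i j).
Let Gz i j k : F := let: And4 GC _ _ _ := Ups_chern It in frz (GC.1 c i j k).
Let Lz i j k : F := let: And3 LC _ _ := D_levi_civita It in frz (LC.1 c i j k).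
Let sigmaI : forall s, I s -> I ((fun=> t) s) := fun _ _ => It.

Let gzE s x : I s -> U x -> forall i j, gz i j s x = metric (S t) c x i j.
Proof. by move=> Is Ux i j; rewrite mxE frozenE. Qed.
Let JzE s x : I s -> U x -> forall i j, Jz i j s x = acs (S t) c x i j.
Proof. by move=> Is Ux i j; rewrite mxE frozenE. Qed.
Let GzE s x : I s -> U x -> forall i j k, Gz i j k s x = Ups t c x i j k.
Proof. by move=> Is Ux i j k; rewrite /Gz; case: Ups_chern => *; rewrite frozenE. Qed.
Let LzE s x : I s -> U x -> forall i j k, Lz i j k s x = D t c x i j k.
Proof. by move=> Is Ux i j k; rewrite /Lz; case: D_levi_civita => *; rewrite frozenE. Qed.

#[local] Opaque family_inv.

Let giz : 'M[F]_m := @family_inv R m M I I_interval I_nondegenerate S c (fun=> t) gz gzE.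

Let Hz := @family_ak R m M I I_interval I_nondegenerate S D Ups D_levi_civita
  Ups_chern c (fun=> t) sigmaI gz Jz Gz Lz gzE JzE GzE LzE.

(** The geometry of the single time [t], extended constantly in time, satisfies [coord_ak] as well,
    hence [christoffel_formula]. At time [t] both right-hand sides agree, as they involve only space
    derivatives. *)
Lemma fam_LE x : U x -> forall i j l, fam_L i j l t x = D t c x i j l.
Proof.
move=> Ux i j l; rewrite /fam_L /half evM (sfam_cstE (Dm := Dm) _ It Ux) -(LzE It Ux).
transitivity (2^-1 * (2 * Lz i j l) t x); last first.
  by rewrite evM (ev_nat (Dm := Dm) _ It Ux) mulKf // pnatr_eq0.
have P a b e : pdF a (fam_g b e) t x = pdF a (gz b e) t x.
  transitivity (pd a (fun y => metric (S t) c y b e) x).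
    by apply: sfam_pd_ev => // y Uy; exact: fam_gE.
  by apply/esym; apply: sfam_pd_ev => // y Uy; exact: gzE.
pose f k : F := (pdF i (gz j k) + pdF j (gz i k) - pdF k (gz i j)) * giz k l.
have E k : ((pdF i (fam_g j k) + pdF j (fam_g i k) - pdF k (fam_g i j)) *
    fam_gi k l) t x = f k t x.
  rewrite [LHS]evM (fam_giE It Ux) /f [RHS]evM (family_invE gzE It Ux).
  by rewrite [in LHS]evD [in LHS]evD evN (P i j k) (P j i k) (P k i j) -evN -!evD.
rewrite (christoffel_formula Hz) -/giz [in LHS]ev_sum (eq_bigr _ (fun k _ => E k)) -ev_sum.
exact: erefl.
Qed.

Let nabJE x : U x -> forall i j k,
  c_nabJ pdF fam_J fam_L i j k t x = c_nabJ pdF Jz Lz i j k t x.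
Proof.
move=> Ux i j k; rewrite /c_nabJ ![in LHS]evD evN ![in RHS]evD evN ![in LHS]ev_sum ![in RHS]ev_sum.
have E1 : pdF i (fam_J j k) t x = pdF i (Jz j k) t x.
  transitivity (pd i (fun y => acs (S t) c y j k) x).
    by apply: sfam_pd_ev => // y Uy; exact: fam_JE.
  by apply/esym; apply: sfam_pd_ev => // y Uy; exact: JzE.
have E2 e : (fam_L i j e * fam_J e k) t x = (Lz i j e * Jz e k) t x.
  by rewrite evM [RHS]evM (fam_LE Ux) (fam_JE It Ux) (LzE It Ux) (JzE It Ux).
have E3 e : (fam_L i e k * fam_J j e) t x = (Lz i e k * Jz j e) t x.
  by rewrite evM [RHS]evM (fam_LE Ux) (fam_JE It Ux) (LzE It Ux) (JzE It Ux).
by rewrite E1 (eq_bigr _ (fun e _ => E2 e)) (eq_bigr _ (fun e _ => E3 e)).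
Qed.

Lemma fam_GE x : U x -> forall i l k, fam_G i l k t x = Ups t c x i l k.
Proof.
move=> Ux i l k; rewrite /fam_G /half evD evM (sfam_cstE (Dm := Dm) _ It Ux) (fam_LE Ux).
rewrite -(GzE It Ux) -(LzE It Ux).
transitivity (2^-1 * (2 * Gz i l k) t x); last first.
  by rewrite evM (ev_nat (Dm := Dm) _ It Ux) mulKf // pnatr_eq0.
rewrite (chern_formula Hz) evD evM (ev_nat (Dm := Dm) _ It Ux) mulrDr.
rewrite mulKf ?[in LHS]ev_sum; last by rewrite pnatr_eq0.
have E j : (fam_J l j * c_nabJ pdF fam_J fam_L i j k) t x =
    (Jz l j * c_nabJ pdF Jz Lz i j k) t x.
  by rewrite evM [RHS]evM (nabJE Ux) (fam_JE It Ux) (JzE It Ux).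
by rewrite (eq_bigr _ (fun j _ => E j)) -ev_sum.
Qed.

End frozen.

Lemma flow_ak : coord_ak pdF fam_g fam_gi fam_J fam_G fam_L.
Proof.
apply: (@family_ak R m M I I_interval I_nondegenerate S D Ups D_levi_civita
  Ups_chern c id (fun t It => It) fam_g fam_J fam_G fam_L fam_gE).
- exact: fam_JE.
- by move=> t x It Ux i j k; exact: fam_GE.
- by move=> t x It Ux i j k; exact: fam_LE.
Qed.

End flow_families.

(** * Component formulas evaluated at a point of the chart *)

Section evaluation.
Variables (R : realType) (m : nat) (M : smooth_manifold R m) (I : set R).
Hypothesis I_interval : is_interval I.
Hypothesis I_nondegenerate : exists a b, [/\ I a, I b & a < b].
Variable c : chart M.
Local Notation U := (cdom c).
Local Notation pt := 'rV[R]_m.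
Local Notation Dm := (chart_domain I_interval I_nondegenerate c).
Local Notation F := (sfam Dm).
Local Notation pdF := (@sfam_pd R m Dm).

Lemma nabla0E (Gm : christoffel M) (f : pt -> R) a :
  nabla Gm c (comp00 f) [:: a] [::] = pd a f.
Proof. by apply/funext => x; rewrite /nabla /= !big_ord0 addr0 subr0. Qed.

Lemma nabla01E (Gm : christoffel M) (X : 'I_m -> pt -> R) a k x :
  nabla Gm c (comp01 X) [:: a] [:: k] x = pd a (X k) x + \sum_e Gm c x a e k * X e x.
Proof. by rewrite /nabla /= big_ord0 subr0 big_ord_recl big_ord0 addr0. Qed.

Lemma nabla_mixedE (Gm : christoffel M) (W : components R m) a b k x :
  nabla Gm c W [:: a; b] [:: k] x =
  pd a (W [:: b] [:: k]) x - \sum_e Gm c x a b e * W [:: e] [:: k] x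
  + \sum_e Gm c x a e k * W [:: b] [:: e] x.
Proof. by rewrite /nabla /= !big_ord_recl !big_ord0 !addr0. Qed.

Section frozen_time.
Variables (t : R) (It : I t) (Gm : christoffel M) (N : 'I_m -> 'I_m -> 'I_m -> F).
Hypothesis NE : forall x, U x -> forall i j k, N i j k t x = Gm c x i j k.

Lemma pd_cst a (r : R) (x : pt) : pd a (fun=> r) x = 0.
Proof. exact: (derive_cst r x (delta_mx 0 a)). Qed.

(** [is_curvature] describes [Q] by its action on vector fields. Testing it on coordinate fields,
    here [X], isolates the components, and the torsion terms of the two sides cancel. *)
Lemma curv_ev (Q : curvature M) : is_curvature Gm Q -> forall x, U x ->
  forall a b e k, c_curv pdF N a b e k t x = Q c x a b e k.
Proof.
move=> HQ x Ux a b e k.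
pose X d := (fun=> (d == e)%:R) : pt -> R.
have Xs d : smooth U (X d).
  have cs r q : Ck q U (fun=> r).
    elim: q r => [|q IH] r.
      by split; [move=> y _; exact: cst_continuous|].
    split; first by move=> y _; exact: cst_continuous.
    move=> i; split=> [y _|]; first exact: derivable_cst.
    by rewrite (_ : pd i (fun=> r) = fun=> 0);
      [exact: IH|apply/funext => y; exact: pd_cst].
  by move=> q; exact: cs.
have sumX (f : 'I_m -> R) y : \sum_d f d * X d y = f e.
  rewrite (bigD1 e) //= /X eqxx mulr1 big1 ?addr0 // => d /negbTE ->.
  by rewrite mulr0.
have DX b' k' : nabla Gm c (comp01 X) [:: b'] [:: k'] = fun y => Gm c y b' e k'.
  by apply/funext => y; rewrite nabla01E pd_cst add0r (sumX (fun d => Gm c y b' d k')).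
have pdN i j l r : pdF i (N j l r) t x = pd i (fun y => Gm c y j l r) x.
  by apply: sfam_pd_ev => // y Uy; exact: NE.
have := HQ c X Xs x Ux a b k; cbv zeta.
rewrite !nabla_mixedE !DX (sumX (fun d => Q c x a b d k)) => E.
have S1 : \sum_f torsion Gm c x a b f * Gm c x f e k =
  \sum_f Gm c x a b f * Gm c x f e k - \sum_f Gm c x b a f * Gm c x f e k.
  by rewrite -sumrB; apply: eq_bigr => f _; rewrite /torsion mulrBl.
rewrite /c_curv evD evD evN ev_sum !pdN.
have -> : \sum_f (N b e f * N a f k - N a e f * N b f k) t x =
  \sum_f Gm c x a f k * Gm c x b e f - \sum_f Gm c x b f k * Gm c x a e f.
  rewrite -sumrB; apply: eq_bigr => f _.
  by rewrite evD evN !evM !(NE Ux); ring.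
have {E S1} -> : Q c x a b e k =
    pd a (fun y => Gm c y b e k) x - pd b (fun y => Gm c y a e k) x
    + (\sum_f Gm c x a f k * Gm c x b e f - \sum_f Gm c x b f k * Gm c x a e f).
  move: E; under eq_bigr => f _ do rewrite DX.
  under [X in _ - (_ - X + _) = _ -> _]eq_bigr => f _ do rewrite DX.
  under [X in _ + X - _ = _ -> _]eq_bigr => f _ do rewrite DX.
  under [X in _ - (_ - _ + X) = _ -> _]eq_bigr => f _ do rewrite DX.
  under [X in _ = _ - X -> _]eq_bigr => f _ do rewrite DX.
  by rewrite S1; lra.
by [].
Qed.

Lemma nab2_ev (T : 'I_m -> 'I_m -> F) (W : components R m) :
  (forall y, U y -> forall i j, T i j t y = W [:: i; j] [::] y) ->
  forall x, U x -> forall a i j,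
  c_nab2 pdF N T a i j t x = nabla Gm c W [:: a; i; j] [::] x.
Proof.
move=> TW x Ux a i j; rewrite nabla2E /c_nab2 evD evD !evN !ev_sum.
have E1 e : (N a i e * T e j) t x = Gm c x a i e * W [:: e; j] [::] x.
  by rewrite evM (NE Ux) (TW x Ux).
have E2 e : (N a j e * T i e) t x = Gm c x a j e * W [:: i; e] [::] x.
  by rewrite evM (NE Ux) (TW x Ux).
rewrite (eq_bigr _ (fun e _ => E1 e)) (eq_bigr _ (fun e _ => E2 e)).
by rewrite (@sfam_pd_ev R m Dm a (T i j) (W [:: i; j] [::]) t x It Ux) // => y Uy; exact: TW.
Qed.

Lemma nab3_ev (T : 'I_m -> 'I_m -> 'I_m -> F) (W : components R m) :
  (forall y, U y -> forall i j k, T i j k t y = W [:: i; j; k] [::] y) ->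
  forall x, U x -> forall a i j k,
  c_nab3 pdF N T a i j k t x = nabla Gm c W [:: a; i; j; k] [::] x.
Proof.
move=> TW x Ux a i j k; rewrite nabla3E /c_nab3 3!evD !evN !ev_sum.
have E1 e : (N a i e * T e j k) t x = Gm c x a i e * W [:: e; j; k] [::] x.
  by rewrite evM (NE Ux) (TW x Ux).
have E2 e : (N a j e * T i e k) t x = Gm c x a j e * W [:: i; e; k] [::] x.
  by rewrite evM (NE Ux) (TW x Ux).
have E3 e : (N a k e * T i j e) t x = Gm c x a k e * W [:: i; j; e] [::] x.
  by rewrite evM (NE Ux) (TW x Ux).
rewrite (eq_bigr _ (fun e _ => E1 e)) (eq_bigr _ (fun e _ => E2 e)) (eq_bigr _ (fun e _ => E3 e)).
by rewrite (@sfam_pd_ev R m Dm a (T i j k) (W [:: i; j; k] [::]) t x It Ux) // => y Uy;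
  exact: TW.
Qed.

Lemma nab4_ev (T : 'I_m -> 'I_m -> 'I_m -> 'I_m -> F) (W : components R m) :
  (forall y, U y -> forall i j k l, T i j k l t y = W [:: i; j; k; l] [::] y) ->
  forall x, U x -> forall a i j k l,
  c_nab4 pdF N T a i j k l t x = nabla Gm c W [:: a; i; j; k; l] [::] x.
Proof.
move=> TW x Ux a i j k l; rewrite nabla4E /c_nab4 4!evD !evN !ev_sum.
have E1 e : (N a i e * T e j k l) t x = Gm c x a i e * W [:: e; j; k; l] [::] x.
  by rewrite evM (NE Ux) (TW x Ux).
have E2 e : (N a j e * T i e k l) t x = Gm c x a j e * W [:: i; e; k; l] [::] x.
  by rewrite evM (NE Ux) (TW x Ux).
have E3 e : (N a k e * T i j e l) t x = Gm c x a k e * W [:: i; j; e; l] [::] x.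
  by rewrite evM (NE Ux) (TW x Ux).
have E4 e : (N a l e * T i j k e) t x = Gm c x a l e * W [:: i; j; k; e] [::] x.
  by rewrite evM (NE Ux) (TW x Ux).
rewrite (eq_bigr _ (fun e _ => E1 e)) (eq_bigr _ (fun e _ => E2 e)).
rewrite (eq_bigr _ (fun e _ => E3 e)) (eq_bigr _ (fun e _ => E4 e)).
by rewrite (@sfam_pd_ev R m Dm a (T i j k l) (W [:: i; j; k; l] [::]) t x It Ux) // => y Uy;
  exact: TW.
Qed.

Lemma hess_ev (f : F) (h : pt -> R) : (forall y, U y -> f t y = h y) ->
  forall x, U x -> forall i j,
  (pdF i (pdF j f) - \sum_e N i j e * pdF e f) t x =
  nabla2 Gm c (comp00 h) [:: i; j] [::] x.
Proof.
move=> fh x Ux i j; rewrite /nabla2 nabla1E evD evN ev_sum nabla0E.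
have E1 e : (N i j e * pdF e f) t x =
    Gm c x i j e * nabla Gm c (comp00 h) [:: e] [::] x.
  by rewrite evM (NE Ux) nabla0E (@sfam_pd_ev R m Dm e f h t x It Ux).
rewrite (eq_bigr _ (fun e _ => E1 e)).
rewrite (@sfam_pd_ev R m Dm i (pdF j f) (pd j h) t x It Ux) // => y Uy.
exact: (@sfam_pd_ev R m Dm j f h t y It Uy).
Qed.

End frozen_time.
Section structure_at_time.
Variables (t : R) (It : I t) (K : almost_kahler M) (Gm Lm : christoffel M).
Variables (g gi J : 'M[F]_m) (G L : 'I_m -> 'I_m -> 'I_m -> F).
Hypothesis gE : forall x, U x -> forall i j, g i j t x = metric K c x i j.
Hypothesis giE : forall x, U x -> forall i j, gi i j t x = ginv K c x i j.
Hypothesis JE : forall x, U x -> forall i j, J i j t x = acs K c x i j.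
Hypothesis GE : forall x, U x -> forall i j k, G i j k t x = Gm c x i j k.
Hypothesis LE : forall x, U x -> forall i j k, L i j k t x = Lm c x i j k.
Variables (Rm Om : curvature M).
Hypothesis RmP : is_curvature Lm Rm.
Hypothesis OmP : is_curvature Gm Om.

Lemma omup_ev x : U x -> forall i j, c_omup gi J i j t x = omega_up K c x i j.
Proof.
move=> Ux i j; rewrite /c_omup ev_sum mxE; apply: eq_bigr => s _.
by rewrite evM (JE Ux) (giE Ux).
Qed.

Lemma P_ev x : U x -> forall a b, c_P pdF g gi J G a b t x = chern_P K Om c x a b.
Proof.
move=> Ux a b; rewrite /c_P ev_sum mxE; apply: eq_bigr => i _.
rewrite ev_sum; apply: eq_bigr => j _; rewrite evM (omup_ev Ux); congr (_ * _).
rewrite ev_sum; apply: eq_bigr => k _.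
by rewrite evM (gE Ux) (curv_ev It GE OmP Ux).
Qed.

Lemma scal_ev x : U x -> c_scal pdF g gi J G t x = chern_scalar K Om c x.
Proof.
move=> Ux; rewrite /c_scal ev_sum; apply: eq_bigr => a _.
rewrite ev_sum; apply: eq_bigr => b _.
by rewrite evM (omup_ev Ux) (P_ev Ux).
Qed.

Lemma Rc_ev x : U x -> forall b e, c_Rc pdF L b e t x = ricci Rm c x b e.
Proof.
move=> Ux b e; rewrite /c_Rc ev_sum mxE; apply: eq_bigr => a _.
exact: (curv_ev It LE RmP Ux).
Qed.

Lemma low_ev x : U x -> forall i j k, c_low g G i j k t x = low_torsion K Gm c x i j k.
Proof.
move=> Ux i j k; rewrite /c_low ev_sum; apply: eq_bigr => l _.
by rewrite evM evD evN !(GE Ux) (gE Ux).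
Qed.

Lemma nabJ_ev x : U x -> forall i j k, c_nabJ pdF J L i j k t x = DJ K Lm c x i j k.
Proof.
move=> Ux i j k; rewrite /DJ nabla11E /c_nabJ evD evD evN !ev_sum.
have E1 e : (L i j e * J e k) t x = Lm c x i j e * acs K c x e k.
  by rewrite evM (LE Ux) (JE Ux).
have E2 e : (L i e k * J j e) t x = Lm c x i e k * acs K c x j e.
  by rewrite evM (LE Ux) (JE Ux).
rewrite (eq_bigr _ (fun e _ => E1 e)) (eq_bigr _ (fun e _ => E2 e)).
by rewrite (@sfam_pd_ev R m Dm i (J j k) (fun y => acs K c y j k) t x It Ux) // => y Uy;
  exact: JE.
Qed.

Lemma B1_ev x : U x -> forall i j, c_B1 pdF g gi J L i j t x = B1 K Lm c x i j.
Proof.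
move=> Ux i j; rewrite /c_B1 mxE; do 4!(rewrite ev_sum; apply: eq_bigr => ? _).
by rewrite 3!evM (giE Ux) (gE Ux) !(nabJ_ev Ux).
Qed.

Lemma B2_ev x : U x -> forall i j, c_B2 pdF g gi J L i j t x = B2 K Lm c x i j.
Proof.
move=> Ux i j; rewrite /c_B2 mxE; do 4!(rewrite ev_sum; apply: eq_bigr => ? _).
by rewrite 3!evM (giE Ux) (gE Ux) !(nabJ_ev Ux).
Qed.

Lemma normT_ev x : U x -> c_normT g gi G t x = normsq_torsion K Gm c x.
Proof.
move=> Ux; rewrite /c_normT; do 6!(rewrite ev_sum; apply: eq_bigr => ? _).
by rewrite 4!evM !(giE Ux) !(low_ev Ux).
Qed.

Lemma lap_ev (f : F) (h : pt -> R) : (forall y, U y -> f t y = h y) ->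
  forall x, U x -> c_lap pdF gi G f t x = laplacian K Gm c h x.
Proof.
move=> fh x Ux; rewrite /c_lap; do 2!(rewrite ev_sum; apply: eq_bigr => ? _).
by rewrite evM (giE Ux) (hess_ev It GE fh Ux).
Qed.

Definition c_B i j : F := sfam_cst Dm 4^-1 * c_B1 pdF g gi J L i j
  - sfam_cst Dm 2^-1 * c_B2 pdF g gi J L i j.

Lemma B_ev x : U x -> forall i j, c_B i j t x = tensorB K Lm c x i j.
Proof.
move=> Ux i j; rewrite /c_B evD evN !evM !(sfam_cstE (Dm := Dm) _ It Ux).
by rewrite (B1_ev Ux) (B2_ev Ux) !mxE.
Qed.

Lemma normsq2_ev (A : 'I_m -> 'I_m -> F) (W : mxfield M) x : U x ->
  (forall i j, A i j t x = W c x i j) ->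
  (\sum_i \sum_j \sum_k \sum_l gi i k * gi j l * A i j * A k l) t x = normsq2 K W c x.
Proof.
move=> Ux AW; do 4!(rewrite ev_sum; apply: eq_bigr => ? _).
by rewrite 3!evM !(giE Ux) !AW.
Qed.

End structure_at_time.
End evaluation.

(** * The flow equations as identities between families *)

Section flow_in_chart.
Variables (R : realType) (m : nat) (M : smooth_manifold R m) (I : set R).
Hypothesis I_interval : is_interval I.
Hypothesis I_nondegenerate : exists a b, [/\ I a, I b & a < b].
Variable c : chart M.
Local Notation U := (cdom c).
Local Notation Dm := (chart_domain I_interval I_nondegenerate c).
Local Notation F := (sfam Dm).
Local Notation pdF := (@sfam_pd R m Dm).
Variables (S : R -> almost_kahler M) (D Ups : R -> christoffel M).
Variables (Rm Om : R -> curvature M).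
Hypothesis RmP : forall t, I t -> is_curvature (D t) (Rm t).
Hypothesis OmP : forall t, I t -> is_curvature (Ups t) (Om t).
Hypothesis flow : symplectic_curvature_flow I S Rm Om.
Variables (g gi J : 'M[F]_m) (G L : 'I_m -> 'I_m -> 'I_m -> F).
Hypothesis gE : forall t x, I t -> U x -> forall i j, g i j t x = metric (S t) c x i j.
Hypothesis giE : forall t x, I t -> U x -> forall i j, gi i j t x = ginv (S t) c x i j.
Hypothesis JE : forall t x, I t -> U x -> forall i j, J i j t x = acs (S t) c x i j.
Hypothesis omE : forall t x, I t -> U x -> forall i j, c_omega g J i j t x = omega (S t) c x i j.
Hypothesis GE : forall t x, I t -> U x -> forall i j k, G i j k t x = Ups t c x i j k.
Hypothesis LE : forall t x, I t -> U x -> forall i j k, L i j k t x = D t c x i j k.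
Hypothesis AK : coord_ak pdF g gi J G L.

Local Notation cP := (c_P pdF g gi J G).
Local Notation cRc := (c_Rc pdF L).
Local Notation cB := (c_B g gi J L).

Let PE t x (It : I t) (Ux : U x) :=
  @P_ev R m M I I_interval I_nondegenerate c t It (S t) (Ups t) g gi J G
   (fun x => @gE t x It) (fun x => @giE t x It) (fun x => @JE t x It)
   (fun x => @GE t x It) (Om t) (OmP It) x Ux.
Let RcE t x (It : I t) (Ux : U x) :=
  @Rc_ev R m M I I_interval I_nondegenerate c t It (D t) L
   (fun x => @LE t x It) (Rm t) (RmP It) x Ux.

Lemma flow_omega_family i j : sfam_dt (c_omega g J i j) = - cP i j.
Proof.
apply: sfam_eq => t x It Ux; rewrite evN (PE It Ux) -(flow_omega flow It Ux).
by apply: sfam_dt_ev => // s Is; exact: omE.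
Qed.

Lemma flow_acs_family i k : 2 * sfam_dt (J i k) = - \sum_w
  (cP i w - (\sum_s \sum_u J i s * J w u * cP s u)
   - 2 * \sum_e J i e * (cRc e w - \sum_s \sum_u J e s * J w u * cRc s u))
  * gi w k.
Proof.
apply: sfam_eq => t x It Ux; rewrite evN evM (ev_nat (Dm := Dm) _ It Ux) ev_sum.
have -> : sfam_dt (J i k) t x = dt I (fun s => acs (S s) c x i k) t.
  by apply: sfam_dt_ev => // s Is; exact: JE.
rewrite (flow_acs flow It Ux) mulrN mulr_sumr; congr (- _); apply: eq_bigr => w _.
rewrite [RHS]evM (giE It Ux) mulrA; congr (_ * _).
rewrite evD evD evN evN evM (ev_nat (Dm := Dm) _ It Ux) (PE It Ux) 2!ev_sum.
have E1 s : (\sum_u J i s * J w u * cP s u) t x =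
    \sum_u acs (S t) c x i s * acs (S t) c x w u * chern_P (S t) (Om t) c x s u.
  by rewrite ev_sum; apply: eq_bigr => u _; rewrite 2!evM !(JE It Ux) (PE It Ux).
have E2 e : (J i e * (cRc e w - \sum_s \sum_u J e s * J w u * cRc s u)) t x =
    2 * (acs (S t) c x i e * anti_part (S t) (ricci (Rm t)) c x e w).
  rewrite evM (JE It Ux) evD evN (RcE It Ux) ev_sum.
  have E3 s : (\sum_u J e s * J w u * cRc s u) t x =
    \sum_u acs (S t) c x e s * acs (S t) c x w u * ricci (Rm t) c x s u.
    by rewrite ev_sum; apply: eq_bigr => u _; rewrite 2!evM !(JE It Ux) (RcE It Ux).
  by rewrite (eq_bigr _ (fun s _ => E3 s)) [in RHS]mxE; field.
rewrite (eq_bigr _ (fun s _ => E1 s)) (eq_bigr _ (fun e _ => E2 e)) -mulr_sumr.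
by rewrite [in LHS]mxE; field.
Qed.

Lemma four_B i j : 4 * cB i j = c_B1 pdF g gi J L i j - 2 * c_B2 pdF g gi J L i j.
Proof.
rewrite /c_B; apply: sfam_eq => t x It Ux.
rewrite [in LHS]evM (ev_nat (Dm := Dm) 4 It Ux) [in LHS]evD [in LHS]evN 2![in LHS]evM.
rewrite [in RHS]evD [in RHS]evN [in RHS]evM (ev_nat (Dm := Dm) 2 It Ux).
by rewrite !(sfam_cstE (Dm := Dm) _ It Ux); field.
Qed.

Lemma chart_evolution t x : I t -> U x ->
  dt I (fun s => chern_scalar (S s) (Om s) c x) t
    - laplacian (S t) (Ups t) c (chern_scalar (S t) (Om t) c) x
  = 4 * normsq2 (S t) (fun d y => ricci (Rm t) d y - tensorB (S t) (D t) d y) c x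
    + 2 * laplacian (S t) (Ups t) c (normsq_torsion (S t) (Ups t) c) x
    + 4 * (\sum_i \sum_j \sum_p \sum_q ginv (S t) c x i p * ginv (S t) c x j q
             * nabla2 (Ups t) c (comp20 (tensorB (S t) (D t) c)) [:: j; i; p; q] [::] x)
    + 16 * (\sum_a \sum_p \sum_r \sum_e \sum_b \sum_q \sum_s \sum_d
              ginv (S t) c x a p * ginv (S t) c x r e * ginv (S t) c x b q
              * ginv (S t) c x s d
              * nabla2 (Ups t) c (comp30 (low_torsion (S t) (Ups t) c))
                  [:: a; r; e; b; d] [::] x
              * low_torsion (S t) (Ups t) c x p q s).
Proof.
move=> It Ux.
have gt y := @gE t y It; have git y := @giE t y It; have Jt y := @JE t y It.
have Gt y := @GE t y It; have Lt y := @LE t y It.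
have sE y : U y -> c_scal pdF g gi J G t y = chern_scalar (S t) (Om t) c y.
  by move=> Uy; exact: (scal_ev It gt git Jt Gt (OmP It) Uy).
have nE y : U y -> c_normT g gi G t y = normsq_torsion (S t) (Ups t) c y.
  by move=> Uy; exact: (normT_ev gt git Gt Uy).
have lE y : U y -> forall i j k, c_low g G i j k t y = low_torsion (S t) (Ups t) c y i j k.
  by move=> Uy; exact: (low_ev gt Gt Uy).
have BE y : U y -> forall i j, cB i j t y = tensorB (S t) (D t) c y i j.
  by move=> Uy; exact: (B_ev It gt git Jt Lt Uy).
have RBE i j : (cRc i j - cB i j) t x =
    (ricci (Rm t) c x - tensorB (S t) (D t) c x) i j.
  by rewrite evD evN (RcE It Ux) (BE x Ux) [RHS]mxE [X in _ = _ + X]mxE.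
have n2E y : U y -> forall a i j, c_nab2 pdF G cB a i j t y =
    nabla (Ups t) c (comp20 (tensorB (S t) (D t) c)) [:: a; i; j] [::] y.
  by move=> Uy; exact: (nab2_ev It Gt (W := comp20 (tensorB (S t) (D t) c)) BE Uy).
have n3E y : U y -> forall b a i j, c_nab3 pdF G (c_nab2 pdF G cB) b a i j t y =
    nabla2 (Ups t) c (comp20 (tensorB (S t) (D t) c)) [:: b; a; i; j] [::] y.
  by move=> Uy; exact: (nab3_ev It Gt n2E Uy).
have m3E y : U y -> forall a i j k, c_nab3 pdF G (c_low g G) a i j k t y =
    nabla (Ups t) c (comp30 (low_torsion (S t) (Ups t) c)) [:: a; i; j; k] [::] y.
  by move=> Uy; exact: (nab3_ev It Gt (W := comp30 (low_torsion (S t) (Ups t) c)) lE Uy).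
have m4E y : U y -> forall b a i j k,
    c_nab4 pdF G (c_nab3 pdF G (c_low g G)) b a i j k t y =
    nabla2 (Ups t) c (comp30 (low_torsion (S t) (Ups t) c)) [:: b; a; i; j; k] [::] y.
  by move=> Uy; exact: (nab4_ev It Gt m3E Uy).
have E := component_evolution AK (@sfam_dtD R m Dm) (@sfam_dtM R m Dm)
  (@sfam_dt_pd R m Dm) four_B flow_omega_family flow_acs_family.
have {E} := congr1 (fun f : F => f t x) E.
cbv beta; rewrite evD evN.
rewrite (lap_ev It git Gt sE Ux).
have -> : sfam_dt (c_scal pdF g gi J G) t x =
    dt I (fun s => chern_scalar (S s) (Om s) c x) t.
  apply: sfam_dt_ev => // s Is.
  exact: (scal_ev Is (fun y => @gE s y Is) (fun y => @giE s y Is)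
    (fun y => @JE s y Is) (fun y => @GE s y Is) (OmP Is) Ux).
move=> ->; rewrite 3!evD 4!evM !(ev_nat (Dm := Dm) _ It Ux) (lap_ev It git Gt nE Ux).
congr (4 * _ + _ + 4 * _ + 16 * _).
- exact: (normsq2_ev git (A := fun i j => cRc i j - cB i j)
    (W := fun d y => ricci (Rm t) d y - tensorB (S t) (D t) d y) Ux RBE).
- do 4!(rewrite ev_sum; apply: eq_bigr => ? _).
  by rewrite 2!evM 2!(git x Ux) (n3E x Ux).
- do 8!(rewrite ev_sum; apply: eq_bigr => ? _).
  by rewrite 5!evM 4!(git x Ux) (m4E x Ux) (lE x Ux).
Qed.

End flow_in_chart.

Theorem theoremC (R : realType) (n : nat) (M : smooth_manifold R n.*2)
    (I : set R) (I_interval : is_interval I)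
    (I_nondegenerate : exists a b, [/\ I a, I b & a < b])
    (S : R -> almost_kahler M)
    (D : R -> christoffel M) (Rm : R -> curvature M)
    (Ups : R -> christoffel M) (Om : R -> curvature M)
    (D_levi_civita : forall t, I t -> is_levi_civita (S t) (D t))
    (Rm_curvature : forall t, I t -> is_curvature (D t) (Rm t))
    (Ups_chern : forall t, I t -> is_chern (S t) (Ups t))
    (Om_curvature : forall t, I t -> is_curvature (Ups t) (Om t))
    (flow : symplectic_curvature_flow I S Rm Om) :
  forall (t : R) (c : chart M) (x : 'rV[R]_(n.*2)), I t -> cdom c x ->
    let Rc := ricci (Rm t) in
    let B := tensorB (S t) (D t) in
    let tau := low_torsion (S t) (Ups t) c in
    let gi := ginv (S t) c x in
    let lap := laplacian (S t) (Ups t) c in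
    dt I (fun s => chern_scalar (S s) (Om s) c x) t
      - lap (chern_scalar (S t) (Om t) c) x
    = 4 * normsq2 (S t) (fun d y => Rc d y - B d y) c x
      + 2 * lap (normsq_torsion (S t) (Ups t) c) x
      + 4 * (\sum_i \sum_j \sum_p \sum_q gi i p * gi j q
               * nabla2 (Ups t) c (comp20 (B c)) [:: j; i; p; q] [::] x)
      + 16 * (\sum_a \sum_p \sum_r \sum_e \sum_b \sum_q \sum_s \sum_d
                gi a p * gi r e * gi b q * gi s d
                * nabla2 (Ups t) c (comp30 tau) [:: a; r; e; b; d] [::] x
                * tau x p q s).
Proof.
move=> t c x It Ux; cbv zeta.
(* The equation at [(t, x)] is the value there of an identity in the ring of families over the
   chart; what follows identifies those families with the given geometry at every time of [I]. *)
pose os := flow_omega_smooth flow c; pose as_ := flow_acs_smooth flow c.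
have gE s y (Is : I s) Uy :=
  @fam_gE R _ M I I_interval I_nondegenerate S c os as_ s y Is Uy.
have giE s y (Is : I s) Uy :=
  @fam_giE R _ M I I_interval I_nondegenerate S c os as_ s y Is Uy.
have JE s y (Is : I s) Uy :=
  @fam_JE R _ M I I_interval I_nondegenerate S c as_ s y Is Uy.
have GE s y (Is : I s) Uy := @fam_GE R _ M I I_interval I_nondegenerate S D Ups
  D_levi_civita Ups_chern c os as_ s Is y Uy.
have LE s y (Is : I s) Uy := @fam_LE R _ M I I_interval I_nondegenerate S D Ups
  D_levi_civita Ups_chern c os as_ s Is y Uy.
have omE s y (Is : I s) Uy := @family_omega R _ M I I_interval I_nondegenerate S c id
  _ _ gE JE s y Is Uy.
exact: (chart_evolution Rm_curvature Om_curvature flow gE giE JE omE GE LE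
  (flow_ak I_interval I_nondegenerate D_levi_civita Ups_chern os as_) It Ux).
Qed.
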